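(* Let $M$ be a smooth $n$-dimensional hypersurface of $\mathbb{R}^{n+1}$ and let $a\in[0,n)$. Then for every $\varphi\in C^1_c(M)$, \[ (n-a)\int_M\frac{\varphi^2}{|x|^a}\,dV+a\int_M\left(\frac{x}{|x|}\cdot\nu_M\right)^2\frac{\varphi^2}{|x|^a}\,dV \leq \left(\int_M\frac{\varphi^2}{|x|^a}\,dV\right)^{1/2} \left(\int_M\frac{4|\nabla_T\varphi|^2+|H\varphi|^2}{|x|^{a-2}}\,dV\right)^{1/2}. \]
   Context: $x$ denotes the position vector in $\mathbb{R}^{n+1}$ and $|x|$ its Euclidean norm; $dV$ is the $n$-dimensional volume (Hausdorff) measure on $M$. $\nu_M$ is a unit normal vector field to $M$. $C^1_c(M)$ is the space of $C^1$ functions with compact support on $M$ (if $M$ is compact without boundary, this is all of $C^1(M)$). The tangential gradient is $\nabla_T\varphi=\nabla\varphi-(\nabla\varphi\cdot\nu_M)\nu_M$ (for any $C^1$ extension of $\varphi$). $H$ is the mean curvature of $M$, defined as the sum (not the average) of the principal curvatures, namely $H=\operatorname{div}_T\nu_M=\sum_{i=1}^{n+1}\delta_i\nu_M^i$ with $\delta_i f=\partial_i f-\nu_M^i\sum_j(\partial_jf)\nu_M^j$. *)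

(* Defs.v *)
From HB Require Import structures.
From mathcomp Require Import all_boot all_order all_algebra.
From mathcomp Require Import all_classical all_reals all_analysis.
Set Implicit Arguments. Unset Strict Implicit. Unset Printing Implicit Defensive.
Import Order.TTheory GRing.Theory Num.Theory.
Import numFieldNormedType.Exports.
Local Open Scope classical_set_scope.
Local Open Scope ring_scope.

Section Hypersurface.
Variables (R : realType) (n : nat).
Local Notation V := 'rV[R]_n.+1.

(** Euclidean inner product and Euclidean norm on R^{n+1}
    (the library norm on row vectors is the max norm, so we do not use it). *)
Definition dot (u v : V) : R := \sum_(i < n.+1) u 0 i * v 0 i.
Definition enorm (v : V) : R := Num.sqrt (dot v v).

Definition partial (f : V -> R) (i : 'I_n.+1) (x : V) : R :=
  'D_(delta_mx 0 i) f x.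
Definition grad (f : V -> R) (x : V) : V := \row_i partial f i x.

Fixpoint Ck (k : nat) (U : set V) (f : V -> R) : Prop :=
  match k with
  | 0 => forall x, U x -> {for x, continuous f}
  | k'.+1 => (forall x, U x -> differentiable f x) /\
             (forall i, Ck k' U (partial f i))
  end.
Definition smooth_on (U : set V) (f : V -> R) : Prop := forall k, Ck k U f.

Definition C1 (f : V -> R) : Prop :=
  (forall x, differentiable f x) /\ (forall i, continuous (partial f i)).

Definition local_def (M : set V) (U : set V) (f : V -> R) : Prop :=
  open U /\ smooth_on U f /\ (forall x, U x -> grad f x != 0) /\
  (forall x, U x -> (M x <-> f x = 0)).

Definition is_hypersurface (M : set V) : Prop :=
  forall p, M p -> exists U f, U p /\ local_def M U f.

Definition tangent (M : set V) (p v : V) : Prop :=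
  exists U f, U p /\ local_def M U f /\ dot (grad f p) v = 0.

(** nu is a smooth unit normal vector field to M (given as a smooth map on an
    open neighbourhood of M, which is needed to differentiate it). *)
Definition unit_normal_field (M : set V) (nu : V -> V) : Prop :=
  (exists W, open W /\ M `<=` W /\ forall i, smooth_on W (fun y => nu y 0 i)) /\
  (forall p, M p -> enorm (nu p) = 1 /\
     forall v, tangent M p v -> dot (nu p) v = 0).

Definition gradT (nu : V -> V) (phi : V -> R) (x : V) : V :=
  grad phi x - dot (grad phi x) (nu x) *: nu x.

(** Mean curvature H = div_T nu = sum_i delta_i nu^i (sum of principal
    curvatures). *)
Definition meancurv (nu : V -> V) (x : V) : R :=
  \sum_(i < n.+1) (partial (fun y => nu y 0 i) i x -
     nu x 0 i * \sum_(j < n.+1) partial (fun y => nu y 0 i) j x * nu x 0 j).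

Definition C1c (M : set V) (phi : V -> R) : Prop :=
  C1 phi /\ exists K, compact K /\ K `<=` M /\
                      (forall x, M x -> ~ K x -> phi x = 0).

Fixpoint omega (k : nat) : R :=
  match k with
  | 0 => 1
  | 1 => 2
  | k'.+2 => (2 * pi / k'.+2%:R) * omega k'
  end.

Definition diamE (C : set V) : \bar R :=
  ereal_sup [set (enorm (x - y))%:E | x in C & y in C].

Definition hcontrib (C : set V) : \bar R :=
  if `[< C = set0 >] then 0%E
  else (omega n * (fine (diamE C) / 2) ^+ n)%:E.

Definition hausdorff_pre (d : R) (A : set V) : \bar R :=
  ereal_inf [set (\sum_(0 <= i <oo) hcontrib (C i))%E |
     C in [set C : nat -> set V |
            A `<=` \bigcup_i C i /\ forall i, (diamE (C i) <= d%:E)%E]].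

Definition hausdorff (A : set V) : \bar R :=
  ereal_sup [set hausdorff_pre d A | d in [set d : R | 0 < d]].

(** Integral over M, w.r.t. the n-dimensional Hausdorff measure dV, of a
    nonnegative function g (layer-cake / Choquet form). *)
Definition intM (M : set V) (g : V -> R) : \bar R :=
  (\int[lebesgue_measure]_(t in [set t : R | (0 <= t)%R])
     hausdorff (M `&` [set x | (t < g x)%R]))%E.

End Hypersurface.

(* Main.v *)
(** Idea.  Let [Y] be the tangential part of the field
    [phi^2 (|x|^2 + d)^(-a/2) x].  Its tangential divergence is
      [w phi^2 (n - a |x^T|^2 / (|x|^2 + d)) - w phi (H phi nu - 2 grad_T phi) . x],
    with [w = (|x|^2 + d)^(-a/2)], and integrates to [0] over [M].  Since
    [|H phi nu - 2 grad_T phi|^2 = 4 |grad_T phi|^2 + (H phi)^2], Cauchy-Schwarz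
    bounds the first term by the right-hand side, and Fatou's lemma lets [d -> 0].

    The divergence theorem is proved directly for the Hausdorff measure.  Near
    [z] in [M], at scale [rho], moving [x] by [h e_i] and then back to [M] along
    the fixed direction [nu z] is bi-Lipschitz with constants [1 + O(rho h)], hence
    almost preserves integrals; dividing by [h -> 0] bounds the integral of an
    oblique derivative of [g] by [C rho] times the integral of [|g|].  Summing over
    a partition of unity of scale [rho] and letting [rho -> 0] yields [0]. *)
Require Import Defs.
From HB Require Import structures.
From mathcomp Require Import all_boot all_order all_algebra.
From mathcomp Require Import all_classical all_reals all_analysis.
From mathcomp Require Import measurable_realfun.
From mathcomp Require Import ring lra zify.
Set Implicit Arguments. Unset Strict Implicit. Unset Printing Implicit Defensive.
Import Order.TTheory GRing.Theory Num.Theory.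
Import numFieldNormedType.Exports.
Local Open Scope classical_set_scope.
Local Open Scope ring_scope.

(** * Hausdorff measure of hypersurfaces as a measure *)

(** No area formula is used: [H] enters only through its additivity on separated sets and its
    behaviour under Lipschitz maps, so integrals are compared through their superlevel sets. The
    decisive feature of the local estimate is that its right side contains [|g|] and no derivative
    of [g]. A cutoff of scale [rho] has a gradient of order [1 / rho], which would cancel the gain
    [rho]; as it is, nonnegative cutoffs with sum 1 give the bound [C rho] times the integral of
    [|Y|].

    The parameter [d] is there because [M] may pass through the origin, where [|x|^(-a) x] need not
    be differentiable. The origin itself is a null set, since [0 <= a < n] forces [n > 0]. The
    integrals of the statement may be infinite, and so may the area of [M]; genuine integration
    takes place on the compact support, which has finite area, and both sides are transferred by
    monotonicity. Cauchy-Schwarz for integrals is replaced by [2 b c <= l b^2 + c^2 / l] with a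
    constant [l], which integrates term by term and is optimised afterwards. *)

Section EuclideanNorm.
Context {R : realType} {n : nat}.
Local Notation V := 'rV[R]_n.+1.
Implicit Types u v w : V.

Lemma dotC u v : dot u v = dot v u.
Proof. by apply: eq_bigr => i _; rewrite mulrC. Qed.

Lemma dotDl u v w : dot (u + v) w = dot u w + dot v w.
Proof. by rewrite -big_split; apply: eq_bigr => i _; rewrite mxE mulrDl. Qed.

Lemma dotDr u v w : dot w (u + v) = dot w u + dot w v.
Proof. by rewrite !(dotC w) dotDl. Qed.

Lemma dotZl a u v : dot (a *: u) v = a * dot u v.
Proof. by rewrite mulr_sumr; apply: eq_bigr => i _; rewrite mxE mulrA. Qed.

Lemma dotZr a u v : dot u (a *: v) = a * dot u v.
Proof. by rewrite !(dotC u) dotZl. Qed.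

Lemma dotNl u v : dot (- u) v = - dot u v.
Proof. by rewrite -scaleN1r dotZl mulN1r. Qed.

Lemma dotBl u v w : dot (u - v) w = dot u w - dot v w.
Proof. by rewrite dotDl dotNl. Qed.

Lemma dotBr u v w : dot w (u - v) = dot w u - dot w v.
Proof. by rewrite !(dotC w) dotBl. Qed.

Lemma dot_delta u i : dot u (delta_mx 0 i) = u 0 i.
Proof.
rewrite /dot (bigD1 i)//= mxE !eqxx mulr1 big1 ?addr0// => j ji.
by rewrite mxE (negbTE ji) andbF mulr0.
Qed.

Lemma dot_ge0 u : 0 <= dot u u.
Proof. by apply: sumr_ge0 => i _; rewrite -expr2 sqr_ge0. Qed.

Lemma enorm_ge0 u : 0 <= enorm u.
Proof. exact: sqrtr_ge0. Qed.

Lemma sqr_enorm u : enorm u ^+ 2 = dot u u.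
Proof. by rewrite sqr_sqrtr// dot_ge0. Qed.

Lemma enorm0 : enorm (0 : V) = 0.
Proof. by rewrite /enorm -(scale0r (0 : V)) dotZl mul0r sqrtr0. Qed.

Lemma coord_le_norm u i : `|u 0 i| <= `|u|.
Proof.
rewrite [leRHS]/Num.Def.normr/= mx_normrE; apply/bigmax_geP; right => /=.
by exists (0, i).
Qed.

Lemma norm_leP u (c : R) : 0 <= c -> (forall i, `|u 0 i| <= c) -> `|u| <= c.
Proof.
move=> c0 h; rewrite [leLHS]/Num.Def.normr/= mx_normrE; apply/bigmax_leP; split => //.
by move=> [i j] _ /=; rewrite ord1.
Qed.

(** Topology and Lipschitz bounds are expressed in the library max norm, diameters in [enorm]. The
    factors [n.+1] in later constants come from [dot_le_norm] and [enorm_le_norm]. *)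
Lemma norm_le_enorm u : `|u| <= enorm u.
Proof.
apply: norm_leP (enorm_ge0 u) _ => i.
rewrite -(@ler_pXn2r _ 2)// ?nnegrE ?enorm_ge0// sqr_enorm real_normK ?num_real//.
rewrite /dot (bigD1 i)//= -expr2 lerDl.
by apply: sumr_ge0 => j _; rewrite -expr2 sqr_ge0.
Qed.

Lemma dot_le_norm u v : `|dot u v| <= n.+1%:R * `|u| * `|v|.
Proof.
apply: le_trans (ler_norm_sum _ _ _) _.
have -> : n.+1%:R * `|u| * `|v| = \sum_(i < n.+1) `|u| * `|v|.
  by rewrite sumr_const card_ord -mulrA mulr_natl.
apply: ler_sum => i _.
by rewrite normrM ler_pM// coord_le_norm.
Qed.

Lemma enorm_le_norm u : enorm u <= n.+1%:R * `|u|.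
Proof.
rewrite -(@ler_pXn2r _ 2)// ?nnegrE ?enorm_ge0 ?mulr_ge0// sqr_enorm.
apply: le_trans (ler_norm _) _; apply: le_trans (dot_le_norm _ _) _.
by rewrite exprMn -mulrA -expr2 ler_wpM2r ?sqr_ge0// expr2 ler_peMl// ler1n.
Qed.

Lemma row_decomp u : u = \sum_i u 0 i *: delta_mx 0 i.
Proof. exact: row_sum_delta. Qed.

End EuclideanNorm.

Section HausdorffOuter.
Context {R : realType} {n : nat}.
Local Notation V := 'rV[R]_n.+1.
Implicit Types A B C : set V.

Lemma omega_ge0 k : 0 <= omega R k.
Proof.
suff: 0 <= omega R k /\ 0 <= omega R k.+1 by case.
elim: k => [|k [h1 h2]]; first by split.
split => //; rewrite [omega R k.+2]/= mulr_ge0// divr_ge0// mulr_ge0// pi_ge0//.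
Qed.

Lemma diamE_ge0 C : C !=set0 -> (0 <= diamE C)%E.
Proof.
move=> [x Cx]; apply: ereal_sup_ubound; exists x => //; exists x => //.
by rewrite subrr enorm0.
Qed.

Lemma diamE_le C (d : R) :
  (forall x y, C x -> C y -> enorm (x - y) <= d) -> (diamE C <= d%:E)%E.
Proof.
by move=> h; apply: ge_ereal_sup => _ [x Cx [y Cy <-]]; rewrite lee_fin h.
Qed.

Lemma enorm_le_diamE C (d : R) x y : (diamE C <= d%:E)%E ->
  C x -> C y -> enorm (x - y) <= fine (diamE C).
Proof.
move=> Cd Cx Cy; have C0 : (0 <= diamE C)%E by apply: diamE_ge0; exists x.
rewrite -lee_fin fineK ?fin_numElt; last first.
  by rewrite (lt_le_trans _ C0)//= (le_lt_trans Cd)// ltey.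
by apply: ereal_sup_ubound; exists x => //; exists y.
Qed.

Lemma hcontrib_ge0 C : (0 <= hcontrib C)%E.
Proof.
rewrite /hcontrib; case: asboolP => // /eqP/set0P C0.
by rewrite lee_fin mulr_ge0 ?omega_ge0// exprn_ge0// divr_ge0// fine_ge0// diamE_ge0.
Qed.

Lemma hcontrib0 : hcontrib (set0 : set V) = 0%E.
Proof. by rewrite /hcontrib asboolT. Qed.

Lemma hcontrib_le C (d : R) : 0 <= d -> (diamE C <= d%:E)%E ->
  (hcontrib C <= (omega R n * (d / 2) ^+ n)%:E)%E.
Proof.
move=> d0 Cd; rewrite /hcontrib; case: asboolP => [_|/eqP/set0P C0].
  by rewrite lee_fin mulr_ge0 ?omega_ge0// exprn_ge0// divr_ge0.
have fC0 := fine_ge0 (diamE_ge0 C0).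
rewrite lee_fin ler_wpM2l ?omega_ge0// lerXn2r ?nnegrE ?divr_ge0//.
rewrite ler_pM2r ?invr_gt0//.
by rewrite -lee_fin fineK// fin_numElt (lt_le_trans _ (diamE_ge0 C0)) ?ltNy0// (le_lt_trans Cd)// ltey.
Qed.

(* All subsets are admissible covering sets, so [mu_ext] is applied over the
   discrete sigma-algebra. *)
Definition discrete_space : Type := V.
HB.instance Definition _ := Pointed.on discrete_space.
HB.instance Definition _ := @isMeasurable.Build default_measure_display
  discrete_space setT I (fun _ _ => I) (fun _ _ => I).

(** The value [+oo] on sets of diameter above [d] replaces the side condition on covers, so that
    [hausdorff_pre d] becomes an instance of [mu_ext] and inherits countable subadditivity. *)
Definition gauge (d : R) (C : set discrete_space) : \bar R :=
  if (diamE C <= d%:E)%E then hcontrib C else +oo%E.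

Lemma gauge_ge0 d C : (0 <= gauge d C)%E.
Proof. by rewrite /gauge; case: ifP => // _; exact: hcontrib_ge0. Qed.

Lemma diamE_set0 : diamE (set0 : set V) = -oo%E.
Proof.
rewrite /diamE (_ : [set _ | _ in _ & _ in _] = set0) ?ereal_sup0//.
by rewrite -subset0 => x [].
Qed.

Lemma gauge0 d : gauge d set0 = 0%E.
Proof. by rewrite /gauge diamE_set0 leNye hcontrib0. Qed.

Lemma hausdorff_preE d A : hausdorff_pre d A = mu_ext (gauge d) A.
Proof.
apply/eqP; rewrite eq_le; apply/andP; split.
  apply: le_ereal_inf_tmp => _ [C [_ AC] <-].
  have [Cd|] := pselect (forall i, (diamE (C i) <= d%:E)%E).
    apply: ereal_inf_lbound; exists C => //.
    by apply: eq_eseriesr => i _; rewrite /gauge Cd.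
  move=> /existsNP[i /negP/negbTE Ci].
  rewrite (@eseries_pinfty _ _ xpredT i) ?leey//; last by rewrite /gauge Ci.
  by move=> k _; rewrite -ltNye (lt_le_trans _ (gauge_ge0 _ _)).
apply: ereal_inf_le_tmp => _ [C [AC Cd] <-]; exists C; first by split.
by apply: eq_eseriesr => i _; rewrite /gauge Cd.
Qed.

Lemma hausdorff_pre_ge0 d A : (0 <= hausdorff_pre d A)%E.
Proof. by rewrite hausdorff_preE; apply: mu_ext_ge0 => // C; exact: gauge_ge0. Qed.

Lemma hausdorff_pre_le d A : 0 < d -> (hausdorff_pre d A <= hausdorff A)%E.
Proof. by move=> d0; apply: ereal_sup_ubound; exists d. Qed.

Lemma hausdorff_ge0 A : (0 <= hausdorff A)%E.
Proof.
by apply: (@le_trans _ _ (hausdorff_pre 1 A)); rewrite ?hausdorff_pre_ge0 ?hausdorff_pre_le.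
Qed.

Lemma hausdorff0 : hausdorff (set0 : set V) = 0%E.
Proof.
apply/eqP; rewrite eq_le hausdorff_ge0 andbT.
apply: ge_ereal_sup => _ [d d0 <-]; rewrite hausdorff_preE mu_ext0//.
  exact: gauge0.
exact: gauge_ge0.
Qed.

Lemma le_hausdorff : {homo @hausdorff R n : A B / A `<=` B >-> (A <= B)%E}.
Proof.
move=> A B AB; apply: ge_ereal_sup => _ [d d0 <-].
apply: le_trans (hausdorff_pre_le B d0); rewrite !hausdorff_preE.
exact: le_mu_ext.
Qed.

Lemma hausdorff_sigma_subadditive : sigma_subadditive (@hausdorff R n).
Proof.
move=> F; apply: ge_ereal_sup => _ [d d0 <-]; rewrite hausdorff_preE.
have /le_trans := @mu_ext_sigma_subadditive _ discrete_space R (gauge d) (gauge_ge0 d) F.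
apply.
apply: lee_nneseries => [i _ _|i _]; first exact/mu_ext_ge0/gauge_ge0.
by rewrite -hausdorff_preE hausdorff_pre_le.
Qed.

HB.instance Definition _ := isOuterMeasure.Build R V (@hausdorff R n)
  hausdorff0 hausdorff_ge0 le_hausdorff hausdorff_sigma_subadditive.

Lemma hausdorff_pre_antimono d d' A : d <= d' ->
  (hausdorff_pre d' A <= hausdorff_pre d A)%E.
Proof.
move=> dd'; apply: ereal_inf_le_tmp => _ [C [AC Cd] <-]; exists C => //.
by split=> // i; apply: le_trans (Cd i) _; rewrite lee_fin.
Qed.

(** A covering set of diameter at most [d < e] cannot meet both [A] and [B], so every cover of the
    union splits into a cover of [A] and a cover of [B] with no set used twice. *)
Lemma hausdorff_pre_separated d e A B : 0 < d -> d < e ->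
  (forall x y, A x -> B y -> e <= enorm (x - y)) ->
  (hausdorff_pre d A + hausdorff_pre d B <= hausdorff_pre d (A `|` B))%E.
Proof.
move=> d0 de sep; apply: le_ereal_inf_tmp => _ [C [ABC Cd] <-].
pose piece D i := if `[< C i `&` D !=set0 >] then C i else set0.
have pieceE D i : piece D i = C i \/ piece D i = set0.
  by rewrite /piece; case: asboolP; [left|right].
have cover D : D `<=` A `|` B -> (hausdorff_pre d D <= \sum_(0 <= i <oo) hcontrib (piece D i))%E.
  move=> DAB; apply: ereal_inf_lbound; exists (piece D) => //; split.
    move=> x Dx; have [i _ Cix] := ABC _ (DAB _ Dx); exists i => //.
    by rewrite /piece asboolT//; exists x.
  by move=> i; case: (pieceE D i) => ->//; rewrite diamE_set0 leNye.
apply: le_trans (leeD (cover A _) (cover B _)) _; [by left|by right|].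
rewrite -nneseriesD//; [|by move=> i _ _; exact: hcontrib_ge0..].
apply: lee_nneseries => [i _ _|i _]; first by rewrite adde_ge0 ?hcontrib_ge0.
rewrite /piece; case: asboolP => [[x [Cx Ax]]|_]; last first.
  by rewrite hcontrib0 add0e; case: asboolP => // _; rewrite ?hcontrib0 hcontrib_ge0.
rewrite asboolF ?hcontrib0 ?adde0// => -[y [Cy By]].
have := sep _ _ Ax By; apply/negP; rewrite -ltNge; apply: le_lt_trans de.
by rewrite -lee_fin (le_trans _ (Cd i))//; apply: ereal_sup_ubound; exists x => //; exists y.
Qed.

(** The metric outer measure property. In [key] the scales [d1] and [d2] stay independent, so that
    the suprema defining the two measures can be taken one after the other. *)
Lemma hausdorff_separated e A B : 0 < e ->
  (forall x y, A x -> B y -> e <= enorm (x - y)) ->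
  (hausdorff A + hausdorff B <= hausdorff (A `|` B))%E.
Proof.
move=> e0 sep.
have key d1 d2 : 0 < d1 -> 0 < d2 ->
    (hausdorff_pre d1 A + hausdorff_pre d2 B <= hausdorff (A `|` B))%E.
  move=> d10 d20; pose d := Num.min (e / 2) (Num.min d1 d2).
  have d0 : 0 < d by rewrite !lt_min d10 d20 divr_gt0.
  have de : d < e by rewrite gt_min ltr_pdivrMr// ltr_pMr// ltr1n.
  apply: le_trans (hausdorff_pre_le _ d0).
  apply: le_trans (hausdorff_pre_separated d0 de sep).
  by apply: leeD; apply: hausdorff_pre_antimono; rewrite !ge_min lexx !orbT.
have [Boo|] := eqVneq (hausdorff B) +oo%E.
  by rewrite Boo; apply: le_trans (leey _) _; rewrite -Boo le_hausdorff.
move=> Boo; have Bfin : hausdorff B \is a fin_num.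
  by rewrite ge0_fin_numE ?hausdorff_ge0// ltey.
rewrite -leeBrDr//; apply: ge_ereal_sup => _ [d1 d10 <-].
rewrite leeBrDr// addeC.
have [ABoo|ABoo] := eqVneq (hausdorff (A `|` B)) +oo%E; first by rewrite ABoo leey.
have pfin : hausdorff_pre d1 A \is a fin_num.
  rewrite ge0_fin_numE ?hausdorff_pre_ge0//.
  apply: le_lt_trans (hausdorff_pre_le _ d10) _.
  by apply: le_lt_trans (le_hausdorff (@subsetUl _ A B)) _; rewrite ltey.
rewrite -leeBrDr//; apply: ge_ereal_sup => _ [d2 d20 <-].
by rewrite leeBrDr// addeC key.
Qed.

End HausdorffOuter.

(** * Caratheodory's criterion for the Hausdorff outer measure *)

Section Caratheodory.
Context {R : realType} {n : nat}.
Local Notation V := 'rV[R]_n.+1.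
Local Notation H := (@hausdorff R n).

(* The layers [t_k <= f < t_(k+1)], [t_k] increasing to [t], satisfy
   [H(layer k) <= m t_(k+1) - m t_(k-1)], where [m s = H(X `&` [f < s])], because
   layers at positive distance are additive; the bounds telescope. *)
Lemma caratheodory_sublevel (f : V -> R) (t : R) :
  (forall x y, `|f x - f y| <= `|x - y|) ->
  H.-caratheodory [set x | f x < t].
Proof.
move=> lipf; apply: le_caratheodory_measurable => X.
pose U := [set x | f x < t]; change (H (X `&` U) + H (X `&` ~` U) <= H X)%E.
rewrite {}/U.
have [->|Xoo] := eqVneq (H X) +oo%E; first by rewrite leey.
have fin A : A `<=` X -> H A \is a fin_num.
  move=> AX; rewrite ge0_fin_numE ?hausdorff_ge0//.
  by rewrite (le_lt_trans (le_hausdorff AX))// ltey.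
pose m s := fine (H (X `&` [set x | f x < s])).
pose L s u := X `&` [set x | s <= f x < u].
have mE s : H (X `&` [set x | f x < s]) = (m s)%:E.
  by rewrite fineK// fin//; exact: subIsetl.
have LE s u : H (L s u) = (fine (H (L s u)))%:E.
  by rewrite fineK// fin//; exact: subIsetl.
have sep s s' (A : set V) (B := X `&` [set x | f x < s]) :
    s < s' -> (forall x, A x -> s' <= f x) -> (H B + H A <= H (B `|` A))%E.
  move=> ss' As'; apply: (@hausdorff_separated _ _ (s' - s)); first by rewrite subr_gt0.
  move=> x y [Xx /= fx] /As' fy; apply: le_trans (norm_le_enorm _).
  rewrite distrC; apply: le_trans (lipf _ _); rewrite ler_normr; apply/orP; left.
  by rewrite lerB// ltW.
have layer s s' u : s < s' -> s' <= u -> fine (H (L s' u)) <= m u - m s.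
  move=> ss' s'u; rewrite lerBrDl -lee_fin EFinD -mE -LE -mE.
  apply: le_trans (sep _ s' _ _ _) _ => //; first by move=> x [_ /andP[]].
  apply: le_hausdorff => x [[Xx /= fx]|[Xx /= /andP[_ fx]]]; split => //=.
  by rewrite (lt_le_trans fx)// ltW// (lt_le_trans ss').
pose tk k := t - k.+1%:R^-1.
have tkS k : tk k < tk k.+1 by rewrite ltrD2l ltrN2 ltf_pV2 ?posrE// ltr_nat.
have tkt k : tk k < t by rewrite ltrBlDr ltrDl invr_gt0.
pose a k := m (tk k).
pose S := sup (range a).
pose b := fine (H (X `&` ~` [set x | f x < t])).
have bE : H (X `&` ~` [set x | f x < t]) = b%:E.
  by rewrite fineK// fin//; exact: subIsetl.
have ab k : a k + b <= fine (H X).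
  rewrite -lee_fin EFinD -mE -bE fineK ?fin//.
  apply: le_trans (sep _ t _ _ _) _ => //.
    by move=> x [_ /negP]; rewrite -leNgt.
  by apply: le_hausdorff => x [[]|[]].
have supa : has_sup (range a).
  split; first by exists (a 0%N), 0%N.
  by exists (fine (H X) - b) => _ [k _ <-]; rewrite lerBrDr.
have aS k : a k <= S by apply: ub_le_sup; [exact: supa.2 | exists k].
have Sb : S + b <= fine (H X).
  by rewrite -lerBrDr; apply: ge_sup => [|_ [k _ <-]]; [exact: supa.1|rewrite lerBrDr].
(* What remains is left continuity of [m] at [t]: by [ab], the part where [f >= t] adds up with each
   part [f < t_k], from which it has positive distance. *)
suff mS : m t <= S.
  by rewrite mE bE -[H X]fineK ?fin// -EFinD lee_fin (le_trans _ Sb)// lerD2r.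
(* [F 0] is the part below [t_(K+1)], the other sets are the later layers. Each layer costs a
   difference over two steps, so the sum telescopes in two interleaved chains; hence the two [S]. *)
have mt K : m t <= S + S - a K.
  pose F i := if i is j.+1 then L (tk (K + i)%N) (tk (K + i.+1)%N) else
     X `&` [set x | f x < tk K.+1].
  rewrite -lee_fin -mE.
  have sub : X `&` [set x | f x < t] `<=` \bigcup_i F i.
    move=> x [Xx /= fx].
    have : exists k, f x < tk k.
      by have [k hk] := ltr_add_invr fx; exists k; rewrite /tk ltrBrDr.
    move=> ex; case: (ex_minnP ex) => k fk kmin.
    have mono : {homo tk : i j / (i <= j)%N >-> i <= j}.
      by apply: homo_leq => // [??? /le_trans|i]; [exact|exact: ltW].
    have [kK|Kk] := leqP k K.+1.
      by exists 0%N => //=; split => //=; rewrite (lt_le_trans fk)// mono.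
    have [j kE] : exists j, k = (K + j.+2)%N by exists (k - K.+2)%N; lia.
    exists j.+1 => //; split => //=; rewrite -kE fk andbT leNgt; apply/negP => /kmin.
    by rewrite kE; lia.
  apply: le_trans (le_hausdorff sub) _.
  apply: le_trans (hausdorff_sigma_subadditive F) _.
  apply: lime_le; first by apply: is_cvg_nneseries => i _ _; exact: hausdorff_ge0.
  exists 1%N => // -[//|N] _ /=.
  suff : (\sum_(0 <= i < N.+1) H (F i) <= (a K.+1 + (a (K + N).+1 + a (K + N)%N - a K - a K.+1))%:E)%E.
    move/le_trans; apply; rewrite lee_fin.
    by have := aS (K + N).+1; have := aS (K + N)%N; lra.
  elim: N => [|N IH].
    by rewrite big_nat1 addn0 /F mE lee_fin /a; lra.
  rewrite big_nat_recr//=; apply: le_trans (leeD IH (lexx _)) _.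
  rewrite LE -EFinD lee_fin !addnS.
  have := @layer (tk (K + N)%N) (tk (K + N).+1) (tk (K + N).+2) (tkS _) (ltW (tkS _)).
  rewrite /a; lra.
apply/ler_addgt0Pr => e e0.
have [_ [K _ <-]] := sup_adherent e0 supa; rewrite -/S => SK.
by have := mt K; lra.
Qed.

End Caratheodory.

(** Tonelli's theorem on the region [0 <= t < G x] under the graph. Restricting [m] to [D] makes it
    finite, which supplies the sigma-finiteness that Tonelli needs. *)
Lemma layer_cake d (T : measurableType d) (R : realType)
    (m : {measure set T -> \bar R}) (D : set T) (g : T -> R) :
  measurable D -> (m D < +oo)%E -> measurable_fun D g ->
  (forall x, D x -> 0 <= g x) ->
  (\int[m]_(x in D) (g x)%:E =
   \int[lebesgue_measure]_(t in [set t : R | (0 <= t)%R])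
     m (D `&` [set x | (t < g x)%R]))%E.
Proof.
move=> mD Doo mg g0.
pose m' : {finite_measure set T -> \bar R} := mfrestr mD Doo.
rewrite (@eq_measure_integral _ _ _ D m'); last first.
  by move=> A mA AD; rewrite /m' /= /mfrestr /mrestr setIidl.
pose G := g \_ D.
have mG : measurable_fun setT G by apply/(measurable_restrictT _ mD).
have G0 x : 0 <= G x by rewrite /G /patch; case: ifPn => // /set_mem /g0.
have -> : (\int[m']_(x in D) (g x)%:E = \int[m']_x (G x)%:E)%E.
  rewrite integral_mkcond; apply: eq_integral => x _.
  by rewrite /G !patchE; case: ifP.
pose S := [set p : T * R | 0 <= p.2 < G p.1].
have mS : measurable S.
  have mle : measurable_fun [set: T * R] (fun p : T * R => 0 <= p.2).
    exact: measurable_fun_ler.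
  have mlt : measurable_fun [set: T * R] (fun p : T * R => p.2 < G p.1).
    by apply: measurable_fun_ltr => //; exact: measurableT_comp.
  have := measurable_and mle mlt => /(_ measurableT [set true] I).
  by rewrite setTI; congr measurable; apply/seteqP; split => p /=.
pose f (p : T * R) : \bar R := (\1_S p)%:E.
have mf : measurable_fun setT f by apply/measurable_EFinP; exact: measurable_indic.
have f0 p : (0 <= f p)%E by rewrite lee_fin.
have -> : (\int[m']_x (G x)%:E = \int[m']_x \int[lebesgue_measure]_t f (x, t))%E.
  apply: eq_integral => x _.
  have -> : (fun t => f (x, t)) = EFin \o \1_(`[0, G x[%classic : set R).
    apply/funext => t; rewrite /f /= !indicE; congr (_%:R%:E); apply/idP/idP;
      by rewrite !inE /S/= in_itv.
  rewrite integral_indic// setIT /= lebesgue_measure_itv/= lte_fin.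
  by case: ltgtP (G0 x) => // [_|<-]; rewrite ?sube0.
rewrite fubini_tonelli// [RHS]integral_mkcond; apply: eq_integral => t _.
rewrite patchE; case: ifPn => [|/negP]; rewrite inE/= => t0.
  have -> : (fun x => f (x, t)) = EFin \o \1_([set x | t < G x]).
    apply/funext => x; rewrite /f /= !indicE; congr ((nat_of_bool _)%:R%:E).
    by apply/idP/idP; rewrite !inE /S/= t0.
  rewrite integral_indic//; last first.
    have := measurable_fun_ltr (@measurable_cst _ _ T R setT t) mG.
    move=> /(_ measurableT [set true] I).
    by rewrite setTI; congr measurable; apply/seteqP; split => p /=.
  rewrite setIT /m' /= /mfrestr /mrestr setIC; congr (m _).
  apply/seteqP; split => x [Dx] /=; rewrite /G patchE mem_set//.
rewrite integral0_eq// => x _; rewrite /f indicE memNset// /S/= => /andP[t0' _].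
exact: t0.
Qed.

(** * Integrals for the Hausdorff measure and Lipschitz images *)

Section HausdorffMeasure.
Context {R : realType} {n : nat}.
Local Notation V := 'rV[R]_n.+1.
Local Notation H := (@hausdorff R n).
Local Notation T := (caratheodory_type H).

Lemma hausdorff_measurableE (A : set V) : H.-caratheodory A -> measurable (A : set T).
Proof. by []. Qed.

(** The distance [f] to [C] is 1-Lipschitz, and a nonempty closed [C] is the intersection of the
    sublevels [f < 1 / (k + 1)]. *)
Lemma closed_hausdorff_measurable (C : set V) : closed C -> measurable (C : set T).
Proof.
move=> clC; have [->|/set0P[c Cc]] := eqVneq C set0; first exact: measurable0.
pose f x : R := inf [set `|x - y| | y in C].
have hi x : has_inf [set `|x - y| | y in C].
  by split; [exists `|x - c|, c | exists 0 => _ [y _ <-]].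
have lip1 x y : f x <= f y + `|x - y|.
  rewrite -lerBlDr; apply: lb_le_inf; first exact: (hi y).1.
  move=> _ [z Cz <-]; rewrite lerBlDr.
  apply: (@le_trans _ _ `|x - z|); first by apply: ge_inf; [exact: (hi x).2|exists z].
  have -> : x - z = (x - y) + (y - z) by rewrite subrKA.
  by rewrite addrC ler_normD.
have lip x y : `|f x - f y| <= `|x - y|.
  rewrite ler_norml lerBlDl lip1 andbT lerNl opprB lerBlDl distrC.
  exact: lip1.
have -> : C = \bigcap_k [set x | f x < k.+1%:R^-1].
  apply/seteqP; split=> [x Cx k _ /=|x h].
    apply: (@le_lt_trans _ _ `|x - x|); last by rewrite subrr normr0 invr_gt0.
    by apply: ge_inf; [exact: (hi x).2|exists x].
  apply: clC => U /nbhs_ballP[e /= e0 eU].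
  have [k] := ltr_add_invr e0; rewrite add0r => ke.
  have fxe : 0 < e - f x by rewrite subr_gt0 (lt_trans (h k I)).
  have [_ [y Cy <-]] := inf_adherent fxe (hi x); rewrite -/(f x) (addrC (f x)) subrK => xy.
  by exists y; split => //; apply: eU; rewrite -ball_normE.
apply: bigcapT_measurable => k; apply: hausdorff_measurableE; exact: caratheodory_sublevel.
Qed.

Lemma within_measurable (D : set V) (f : V -> R) : closed D ->
  {within D, continuous f} -> measurable_fun (D : set T) (f : T -> R).
Proof.
move=> clD /continuousP cf.
apply: (measurability _ (RGenOpens.measurableE R)).
move=> _ [_ [a [b ->] <-]].
have oab : open (`]a, b[%classic : set R) by exact: interval_open.
have [U oU UE] := (open_subspaceP _ _).1 (cf _ oab).
rewrite setIC; change (measurable ((f @^-1` `]a, b[%classic `&` D) : set T)).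
rewrite -UE; apply: measurableI; last exact: closed_hausdorff_measurable.
rewrite -[U]setCK; apply: measurableC; apply: closed_hausdorff_measurable.
exact: open_closedC.
Qed.

(** The hypothesis says that [p] factors through [q] by an [l]-Lipschitz map. With a common
    parameter set no inverse has to be built, and exchanging [p] and [q] gives the reverse estimate.
    Covers of mesh [d / l] are carried to covers of mesh [d]. *)
Lemma hausdorff_lipschitz (I : set V) (p q : V -> V) (l : R) : 0 < l ->
  (forall x y, I x -> I y -> enorm (p x - p y) <= l * enorm (q x - q y)) ->
  (H (p @` I) <= (l ^+ n)%:E * H (q @` I))%E.
Proof.
move=> l0 lip; have ln0 : 0 < l ^+ n by rewrite exprn_gt0.
apply: ge_ereal_sup => _ [d d0 <-].
have dl0 : 0 < d / l by rewrite divr_gt0.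
apply: (@le_trans _ _ ((l ^+ n)%:E * hausdorff_pre (d / l) (q @` I))%E); last first.
  by rewrite lee_pmul2l// hausdorff_pre_le.
rewrite -lee_pdivrMl//; apply: le_ereal_inf_tmp => _ [C [IC Cd] <-].
rewrite lee_pdivrMl// -nneseriesZl//; last by move=> i _; exact: hcontrib_ge0.
pose D i := p @` (I `&` q @^-1` C i).
have Ddiam i : D i !=set0 -> (diamE (D i) <= (l * fine (diamE (C i)))%:E)%E.
  move=> _; apply: diamE_le => _ _ [x [Ix Cx] <-] [y [Iy Cy] <-].
  by apply: le_trans (lip _ _ Ix Iy) _; rewrite ler_pM2l// (enorm_le_diamE (Cd i)).
have DC i : D i !=set0 -> C i !=set0 by move=> [_ [x [_ Cx] _]]; exists (q x).
apply: (@le_trans _ _ (\sum_(0 <= i <oo) hcontrib (D i))%E).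
  apply: ereal_inf_lbound; exists D => //; split.
    move=> _ [x Ix <-]; have [|i _ Ci] := IC (q x); first by exists x.
    by exists i => //; exists x.
  move=> i; have [->|/set0P Di] := eqVneq (D i) set0; first by rewrite diamE_set0 leNye.
  apply: le_trans (Ddiam _ Di) _; rewrite lee_fin mulrC -ler_pdivlMr//.
  have Ci := DC _ Di; rewrite -lee_fin fineK// fin_numElt.
  by rewrite (lt_le_trans _ (diamE_ge0 Ci)) ?ltNy0// (le_lt_trans (Cd i))// ltey.
apply: lee_nneseries => [i _ _|i _]; first exact: hcontrib_ge0.
have [->|/set0P Di] := eqVneq (D i) set0.
  by rewrite hcontrib0 mule_ge0 ?hcontrib_ge0// lee_fin ltW.
have Ci := DC _ Di.
apply: le_trans (hcontrib_le _ (Ddiam _ Di)) _.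
  by rewrite mulr_ge0 ?(ltW l0)// fine_ge0// diamE_ge0.
rewrite /hcontrib asboolF; last exact/eqP/set0P.
by rewrite -EFinM lee_fin -mulrA exprMn mulrCA.
Qed.

(** Monotonicity in [t] suffices, so [g] may be arbitrary. *)
Lemma measurable_hausdorff_superlevel (D : set V) (g : V -> R) :
  (H D < +oo)%E -> measurable_fun setT (fun t : R => H (D `&` [set x | t < g x])).
Proof.
move=> Doo.
have fin t : H (D `&` [set x | t < g x]) \is a fin_num.
  rewrite ge0_fin_numE ?hausdorff_ge0//.
  by apply: le_lt_trans Doo; apply: le_hausdorff; exact: subIsetl.
rewrite (_ : (fun _ => _) = EFin \o (fun t : R => fine (H (D `&` [set x | t < g x])))).
  apply/measurable_EFinP; apply: (nonincreasing_measurable measurableT) => s t st.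
  rewrite -lee_fin !fineK//; apply: le_hausdorff => x [Dx /= tg]; split => //=.
  exact: le_lt_trans tg.
by apply/funext => t /=; rewrite fineK.
Qed.

Definition hausdorff_outer : {outer_measure set V -> \bar R} := H.

Definition hmeasure : {measure set T -> \bar R} :=
  (hausdorff_outer : set (caratheodory_type hausdorff_outer) -> \bar R).

Lemma intME (D : set V) (g : V -> R) : measurable (D : set T) -> (H D < +oo)%E ->
  measurable_fun (D : set T) (g : T -> R) -> (forall x, D x -> 0 <= g x) ->
  (\int[hmeasure]_(x in D) (g x)%:E)%E = intM D g.
Proof. by move=> mD Doo mg g0; rewrite layer_cake. Qed.

(** The comparison holds level by level: the points with [g > t] lie in the image of [J] under [p],
    and the image of [J] under [q] lies in the points with [k > t]. Only levels [t >= 0] occur, so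
    surjectivity and agreement are asked only where [g] is positive. *)
Lemma integral_lipschitz_le (A B I : set V) (p q : V -> V) (g k : V -> R) (l : R) :
  measurable (A : set T) -> measurable (B : set T) ->
  (H A < +oo)%E -> (H B < +oo)%E ->
  measurable_fun (A : set T) (g : T -> R) ->
  measurable_fun (B : set T) (k : T -> R) ->
  (forall x, 0 <= g x) -> (forall x, 0 <= k x) -> 0 < l ->
  (forall x y, I x -> I y -> enorm (p x - p y) <= l * enorm (q x - q y)) ->
  (forall y, A y -> 0 < g y -> exists2 x, I x & p x = y) ->
  (forall x, I x -> A (p x) -> 0 < g (p x) -> B (q x) /\ k (q x) = g (p x)) ->
  (\int[hmeasure]_(x in A) (g x)%:E <=
   (l ^+ n)%:E * \int[hmeasure]_(x in B) (k x)%:E)%E.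
Proof.
move=> mA mB Aoo Boo mg mk g0 k0 l0 lip surj agree.
have ln0 : 0 < l ^+ n by rewrite exprn_gt0.
have mt : measurable [set t : R | 0 <= t] by rewrite -set_itvcy; exact: measurable_itv.
rewrite !intME// /intM -ge0_integralZl//.
- apply: ge0_le_integral => //.
  + by move=> t _; exact: hausdorff_ge0.
  + by apply: measurable_funTS; exact: measurable_hausdorff_superlevel.
  + by apply: measurable_funTS; apply: measurable_funeM; exact: measurable_hausdorff_superlevel.
  + move=> t /= t0.
    pose J := [set x | I x /\ A (p x) /\ t < g (p x)].
    apply: (@le_trans _ _ (H (p @` J))).
      apply: le_hausdorff => y [Ay /= ty].
      have [x Ix xy] := surj y Ay (le_lt_trans t0 ty).
      by exists x => //; rewrite /J /= xy.
    apply: (@le_trans _ _ ((l ^+ n)%:E * H (q @` J))%E).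
      by apply: hausdorff_lipschitz => // x y [Ix _] [Iy _]; exact: lip.
    rewrite lee_pmul2l//; apply: le_hausdorff => _ [x [Ix [Ax tx]] <-].
    by have [Bq /= kq] := agree _ Ix Ax (le_lt_trans t0 tx); split => //=; rewrite kq.
- by apply: measurable_funTS; exact: measurable_hausdorff_superlevel.
- by move=> t _; exact: hausdorff_ge0.
- by rewrite lee_fin ltW.
Qed.

(** The integral of a nonnegative function is a supremum over simple functions below it, so
    monotonicity needs no measurability. This serves [intM] over sets whose area is not known to be
    finite. *)
Lemma ge0_le_integralT d (X : measurableType d) (m : {measure set X -> \bar R})
    (f k : X -> \bar R) :
  (forall x, 0 <= f x)%E -> (forall x, f x <= k x)%E ->
  (\int[m]_x f x <= \int[m]_x k x)%E.
Proof.
move=> f0 fk; have k0 x : (0 <= k x)%E by exact: le_trans (fk x).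
rewrite !ge0_integralTE//; apply: ereal_sup_le => _ [h hf <-]; exists h => // x.
exact: le_trans (hf x) (fk x).
Qed.

Lemma le_intM (D D' : set V) (g : V -> R) : D `<=` D' -> (intM D g <= intM D' g)%E.
Proof.
move=> DD'; rewrite /intM integral_mkcond [leRHS]integral_mkcond.
apply: ge0_le_integralT => t; rewrite !patchE; case: ifP => // _.
  exact: hausdorff_ge0.
by apply: le_hausdorff; exact: setSI.
Qed.

End HausdorffMeasure.

(** * Functions of class C1 near a point *)

Section C1Functions.
Context {R : realType} {n : nat}.
Local Notation V := 'rV[R]_n.+1.
Implicit Types (f g : V -> R) (x y v : V).

Lemma derive_dot f x v : differentiable f x -> 'D_v f x = dot (grad f x) v.
Proof.
move=> df; rewrite deriveE// [v in LHS]row_decomp linear_sum.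
by apply: eq_bigr => i _; rewrite linearZ/= mxE /partial deriveE// mulrC.
Qed.

Lemma line_is_derive f x v (s : R) : derivable f (x + s *: v) v ->
  is_derive s 1 (fun s : R => f (x + s *: v)) ('D_v f (x + s *: v)).
Proof.
move=> df.
have E : (fun h : R => h^-1 *: (((fun s : R => f (x + s *: v)) \o shift s) (h *: (1 : R)) - f (x + s *: v)))
       = (fun h : R => h^-1 *: ((f \o shift (x + s *: v)) (h *: v) - f (x + s *: v))).
  apply/funext => h /=; congr (_ *: (f _ - _)).
  by rewrite [h *: (1 : R)]mulr1 scalerDl addrCA.
by apply: DeriveDef; rewrite /derivable /derive E.
Qed.

Lemma mvt_segment f x y :
  (forall s : R, 0 <= s <= 1 -> differentiable f (x + s *: (y - x))) ->
  exists2 s : R, 0 <= s <= 1 & f y - f x = dot (grad f (x + s *: (y - x))) (y - x).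
Proof.
move=> df; set v := y - x.
have xy : x + v = y by rewrite /v addrC subrK.
have dphi (s : R) : 0 <= s <= 1 -> is_derive s 1 (fun s : R => f (x + s *: v)) ('D_v f (x + s *: v)).
  by move=> s01; apply: line_is_derive; apply: diff_derivable; exact: df.
have [||s] := @MVT_segment R (fun s => f (x + s *: v)) (fun s => 'D_v f (x + s *: v)) 0 1 ler01.
- by move=> s; rewrite in_itv/= => /andP[s0 s1]; apply: dphi; rewrite !ltW.
- apply: derivable_within_continuous => s; rewrite in_itv/= => s01.
  by have [] := dphi s s01.
rewrite in_itv/= => s01; rewrite scale1r scale0r addr0 subr0 mulr1 xy => ->.
by exists s => //; rewrite derive_dot//; exact: df.
Qed.

Lemma segment_le_max x y z (s : R) : 0 <= s <= 1 ->
  `|x + s *: (y - x) - z| <= Num.max `|x - z| `|y - z|.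
Proof.
move=> /andP[s0 s1].
have -> : x + s *: (y - x) - z = s *: (y - z) + (1 - s) *: (x - z).
  by apply/rowP => i; rewrite !mxE; ring.
apply: le_trans (ler_normD _ _) _; rewrite !normrZ (ger0_norm s0) ger0_norm ?subr_ge0//.
set M := Num.max _ _; have -> : M = s * M + (1 - s) * M by ring.
by rewrite lerD// ler_wpM2l ?subr_ge0// le_max lexx ?orbT.
Qed.

(** Pointwise, because [nu] is smooth only on some neighbourhood of [M]. Continuity of the partial
    derivatives at [x] alone already bounds them near [x]. *)
Definition C1at f x :=
  (\forall y \near x, differentiable f y) /\
  forall i, {for x, continuous (partial f i)}.

Lemma C1at_differentiable f x : C1at f x -> differentiable f x.
Proof. by case=> /nbhs_singleton. Qed.

Lemma C1at_continuous f x : C1at f x -> {for x, continuous f}.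
Proof. by move=> /C1at_differentiable /differentiable_continuous. Qed.

Lemma C1at_lipschitz f x : C1at f x -> exists r C : R, [/\ 0 < r, 0 < C,
  forall y, `|y - x| < r -> differentiable f y,
  forall y, `|y - x| < r -> `|grad f y| <= C &
  forall y z, `|y - x| < r -> `|z - x| < r -> `|f y - f z| <= C * `|y - z|].
Proof.
move=> [dfx cf].
pose C : R := \sum_i (`|partial f i x| + 1).
have C0 : 0 < C.
  by rewrite /C big_ord_recl ltr_pwDl// ?sumr_ge0// => [|i _]; rewrite ?addr_ge0// ltr_wpDl.
have : \forall y \near x, differentiable f y /\ forall i, `|partial f i y| <= C.
  have H1 : \forall y \near x, forall i, `|partial f i x - partial f i y| < 1.
    apply: (@filter_forall _ _ (fun (i : 'I_n.+1) (y : V) => `|partial f i x - partial f i y| < 1) (nbhs x) (@nbhs_filter _ x)) => i.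
    by have /cvgrPdist_lt/(_ 1 ltr01) := cf i.
  near=> y; split; first by near: y.
  move=> i; have h : `|partial f i x - partial f i y| < 1.
    by move: i; near: y.
  rewrite /C (bigD1 i)//= -[leLHS]addr0 lerD//; last first.
    by apply: sumr_ge0 => j _; rewrite addr_ge0.
  rewrite -lerBlDl; apply: le_trans (ltW h).
  by rewrite (le_trans (lerB_dist _ _))// distrC.
move=> /nbhs_ballP[r /= r0 hr].
have inr y : `|y - x| < r -> ball x r y by rewrite -ball_normE /= distrC.
have gC y : `|y - x| < r -> `|grad f y| <= C.
  by move=> /inr/hr[_ h]; apply: norm_leP (ltW C0) _ => i; rewrite mxE.
exists r, (n.+1%:R * C); split => //.
- by rewrite mulr_gt0.
- by move=> y /inr/hr[].
- by move=> y /gC h; apply: le_trans h _; rewrite ler_peMl ?(ltW C0)// ler1n.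
move=> y z yr zr.
have seg (s : R) : 0 <= s <= 1 -> `|z + s *: (y - z) - x| < r.
  by move=> s01; rewrite (le_lt_trans (segment_le_max _ _ _ s01))// gt_max zr.
have [s s01 ->] := @mvt_segment f z y (fun s h => (hr _ (inr _ (seg s h))).1).
apply: le_trans (dot_le_norm _ _) _.
by rewrite ler_wpM2r// ler_wpM2l// gC// seg.
Unshelve. all: by end_near. Qed.

Lemma C1at_cst (c : R) x : C1at (fun=> c) x.
Proof.
split; first by near=> y; exact: differentiable_cst.
move=> i; rewrite (_ : partial _ i = cst 0); first exact: (@cst_continuous V R 0 x).
by apply/funext => y; rewrite /partial derive_cst.
Unshelve. all: by end_near. Qed.

Lemma partial_coord i j x : partial (fun y => y 0 j) i x = (i == j)%:R.
Proof.
have @f : {linear V -> R}.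
  by exists (fun N : V => N 0 j); do 2![eexists]; do ?[constructor];
     rewrite ?mxE// => ? *; rewrite ?mxE//; move=> ?; rewrite !mxE.
have fcont : continuous f by exact: coord_continuous.
rewrite /partial (_ : (fun y : V => y 0 j) = f)// deriveE.
  by rewrite diff_lin//= mxE eqxx eq_sym.
exact: linear_differentiable.
Qed.

Lemma partialD f g x i : differentiable f x -> differentiable g x ->
  partial (fun y => f y + g y) i x = partial f i x + partial g i x.
Proof. by move=> df dg; rewrite /partial -deriveD//; exact: diff_derivable. Qed.

Lemma partialM f g x i : differentiable f x -> differentiable g x ->
  partial (fun y => f y * g y) i x = f x * partial g i x + g x * partial f i x.
Proof.
by move=> df dg; rewrite /partial -[RHS]/(_ *: _ + _ *: _) -deriveM//; exact: diff_derivable.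
Qed.

Lemma partial_comp (h : R -> R) f x i : differentiable f x -> derivable h (f x) 1 ->
  partial (h \o f) i x = derive1 h (f x) * partial f i x.
Proof.
move=> df /derivable1_diffP dh; have dhf := differentiable_comp df dh.
by rewrite /partial (deriveE _ dhf) (diff_comp df dh) /= (diff1E dh) (deriveE _ df) mulrC.
Qed.

Lemma continuous_near f g x : (\forall y \near x, f y = g y) ->
  {for x, continuous f} -> {for x, continuous g}.
Proof.
move=> fg cf; apply/(@cvgrPdist_lt _ _ _ (nbhs x) _ g (g x)) => e e0; have /cvgrPdist_lt/(_ e e0) h := cf.
near=> y; rewrite -(nbhs_singleton fg).
have <- : f y = g y by near: y.
by near: y.
Unshelve. all: by end_near. Qed.

Lemma C1atD f g x : C1at f x -> C1at g x -> C1at (fun y => f y + g y) x.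
Proof.
move=> [df cf] [dg cg].
split; first by near=> y; apply: differentiableD; near: y.
move=> i; apply: (@continuous_near (fun y => partial f i y + partial g i y)).
  by near=> y; rewrite partialD//; near: y.
by apply: continuousD; [exact: cf|exact: cg].
Unshelve. all: by end_near. Qed.

Lemma C1atM f g x : C1at f x -> C1at g x -> C1at (fun y => f y * g y) x.
Proof.
move=> [df cf] [dg cg].
split; first by near=> y; apply: differentiableM; near: y.
move=> i; apply: (@continuous_near (fun y => f y * partial g i y + g y * partial f i y)).
  by near=> y; rewrite partialM//; near: y.
have cfx := differentiable_continuous (nbhs_singleton df).
have cgx := differentiable_continuous (nbhs_singleton dg).
by apply: continuousD; apply: continuousM; [exact: cfx|exact: cg|exact: cgx|exact: cf].
Unshelve. all: by end_near. Qed.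

Lemma C1at_comp (h : R -> R) f x : C1at f x ->
  (\forall t \near f x, derivable h t 1) -> {for f x, continuous (derive1 h)} ->
  C1at (h \o f) x.
Proof.
move=> [df cf] dh ch.
have cfx : {for x, continuous f} by exact: differentiable_continuous (nbhs_singleton df).
have dhf : \forall y \near x, derivable h (f y) 1 by exact: (cfx _ dh).
split; first by near=> y; apply: differentiable_comp; [|apply/derivable1_diffP]; near: y.
move=> i; apply: (@continuous_near (fun y => derive1 h (f y) * partial f i y)).
  by near=> y; rewrite partial_comp//; near: y.
by apply: continuousM; [exact: (continuous_comp cfx ch)|exact: cf].
Unshelve. all: by end_near. Qed.

Lemma Ck_C1at k (U : set V) f x : open U -> Ck k.+1 U f -> U x -> C1at f x.
Proof.
move=> oU [df Ckf] Ux; split.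
  by apply: filterS (open_nbhs_nbhs (conj oU Ux)); exact: df.
move=> i; case: k Ckf => [|k] Ckf; first exact: Ckf.
by apply: differentiable_continuous; exact: (Ckf i).1.
Qed.

Lemma C1_C1at f x : C1 f -> C1at f x.
Proof.
move=> [df cf]; split; first by near=> y; exact: df.
by move=> i; exact: cf.
Unshelve. all: by end_near. Qed.

End C1Functions.

(** * Local geometry of a hypersurface *)

Section LocalChart.
Context {R : realType} {n : nat}.
Local Notation V := 'rV[R]_n.+1.
Implicit Types (f : V -> R) (x y v : V).

Lemma diff_eps f x (e : R) : differentiable f x -> 0 < e ->
  exists2 d : R, 0 < d & forall w, `|w| < d ->
    `|f (x + w) - f x - dot (grad f x) w| <= e * `|w|.
Proof.
move=> df e0; have /eqaddoP/(_ e e0) := diff_locally df.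
move=> /nbhs_ballP[d /= d0 hd]; exists d => // w wd.
have wb : ball (0 : V) d w by rewrite -ball_normE /ball_/= sub0r normrN.
have := hd _ wb; rewrite -derive_dot// (deriveE _ df) (addrC x) => h.
have {}h : `|f (w + x) - (f x + 'd f x w)| <= e * `|w| := h.
by rewrite -addrA -opprD.
Qed.

Definition regular_near f p (r C : R) :=
  forall y, `|y - p| < r -> [/\ differentiable f y, `|grad f y| <= C &
    forall y', `|y' - p| < r -> `|f y - f y'| <= C * `|y - y'|].

Lemma regular_nearS f p (r r' C C' : R) : r' <= r -> C <= C' ->
  regular_near f p r C -> regular_near f p r' C'.
Proof.
move=> rr CC h y yr; have [d g l] := h y (lt_le_trans yr rr); split => //.
  exact: le_trans g CC.
move=> y' y'r; apply: le_trans (l y' (lt_le_trans y'r rr)) _.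
by rewrite ler_wpM2r.
Qed.

Lemma C1at_regular_near f p : C1at f p ->
  exists r C : R, [/\ 0 < r, 0 < C & regular_near f p r C].
Proof.
move=> /C1at_lipschitz[r [C [r0 C0 h1 h2 h3]]]; exists r, C; split => // y yr.
by split; [exact: h1|exact: h2|move=> y' y'r; exact: h3].
Qed.

(** By monotonicity one pair can serve all indices; the inverse of [1 + \sum_i (r i)^-1] is a
    positive number below every [r i]. *)
Lemma finite_uniform (I : finType) (P : I -> R -> R -> Prop) :
  (forall i r r' C C', 0 < r' -> r' <= r -> C <= C' -> P i r C -> P i r' C') ->
  (forall i, exists r C : R, [/\ 0 < r, 0 < C & P i r C]) ->
  exists r C : R, [/\ 0 < r, 0 < C & forall i, P i r C].
Proof.
move=> mono /choice[r /choice[C h]].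
have r0 i : 0 < r i by have [] := h i.
have C0 i : 0 < C i by have [] := h i.
have s0 : 0 < 1 + \sum_i (r i)^-1.
  by rewrite ltr_pwDl// sumr_ge0// => i _; rewrite invr_ge0 ltW.
exists (1 + \sum_i (r i)^-1)^-1, (1 + \sum_i C i); split.
- by rewrite invr_gt0.
- by rewrite ltr_pwDl// sumr_ge0// => i _; rewrite ltW.
move=> i; have [_ _] := h i; apply: mono; first by rewrite invr_gt0.
  rewrite -[leRHS]invrK lef_pV2 ?posrE ?invr_gt0//.
  rewrite (bigD1 i)//= addrCA lerDl addr_ge0// sumr_ge0// => j _.
  by rewrite invr_ge0 ltW.
rewrite (bigD1 i)//= addrCA lerDl addr_ge0// sumr_ge0// => j _.
exact: ltW.
Qed.

Variables (M : set V) (nu : V -> V).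
Hypotheses (hM : is_hypersurface M) (hnu : unit_normal_field M nu).

Lemma dot_nu z : M z -> dot (nu z) (nu z) = 1.
Proof. by move=> /(hnu.2)[h _]; rewrite -sqr_enorm h expr1n. Qed.

Lemma norm_nu_le1 z : M z -> `|nu z| <= 1.
Proof. by move=> /(hnu.2)[h _]; rewrite -h norm_le_enorm. Qed.

Lemma dot_gt0 (v : V) : v != 0 -> 0 < dot v v.
Proof.
move=> v0; rewrite lt_neqAle dot_ge0 andbT eq_sym -sqr_enorm sqrf_eq0.
apply: contra v0 => /eqP v0; have := norm_le_enorm v.
by rewrite v0 normr_le0.
Qed.

(** The projection [v] of [nu z] off the gradient is tangent, hence orthogonal to [nu z]. This
    forces equality in Cauchy-Schwarz for the gradient and the unit vector [nu z], so the two are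
    parallel. *)
Lemma grad_normal (U : set V) F z : local_def M U F -> U z -> M z ->
  grad F z = dot (grad F z) (nu z) *: nu z.
Proof.
move=> ld Uz Mz; have [oU [sF [gF MF]]] := ld.
set g := grad F z; set N := nu z.
have g0 : 0 < dot g g by apply: dot_gt0; exact: gF.
have N1 : dot N N = 1 by exact: dot_nu.
pose v := N - (dot g N / dot g g) *: g.
have gv : dot g v = 0 by rewrite dotBr dotZr divfK ?subrr// gt_eqF.
have Nv : dot N v = 0 by apply: (hnu.2 z Mz).2; exists U, F.
have gN : dot g N ^+ 2 = dot g g.
  move: Nv; rewrite dotBr dotZr N1 (dotC N g) => /eqP; rewrite subr_eq0 => /eqP/esym.
  by rewrite mulrAC -expr2 => /(congr1 ( *%R^~ (dot g g))); rewrite divfK ?gt_eqF// mul1r.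
have : dot (g - dot g N *: N) (g - dot g N *: N) = 0.
  by rewrite dotBl !dotBr !dotZl !dotZr N1 (dotC N g) -gN; ring.
apply: contra_eq; rewrite -subr_eq0 => w0.
by rewrite gt_eqF// dot_gt0.
Qed.

(** Later arguments about the shape of [M] near [p] use three facts on [F]: its gradient is
    Lipschitz (second derivatives enter here), parallel to [nu] on [M], and of size at least [m] in
    that direction. *)
Lemma local_chart p : M p -> exists F, exists r C m : R,
  [/\ 0 < r, 0 < C & 0 < m] /\
  [/\ forall y, `|y - p| < r -> [/\ M y <-> F y = 0, differentiable F y & `|grad F y| <= C],
    forall y y', `|y - p| < r -> `|y' - p| < r -> `|grad F y - grad F y'| <= C * `|y - y'|,
    forall z, M z -> `|z - p| < r ->
       grad F z = dot (grad F z) (nu z) *: nu z /\ m <= `|dot (grad F z) (nu z)|,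
    forall i y, `|y - p| < r -> differentiable (fun y => nu y 0 i) y /\
       `|grad (fun y => nu y 0 i) y| <= C &
    forall y y', `|y - p| < r -> `|y' - p| < r -> `|nu y - nu y'| <= C * `|y - y'|].
Proof.
move=> Mp; have [U [F [Up ld]]] := hM Mp; have [oU [sF [gF MF]]] := ld.
have [[W [oW [MW snu]]] _] := hnu.
have [rU /= rU0 hU] := (nbhs_ballP _ _).1 (open_nbhs_nbhs (conj oU Up)).
have hF := C1at_regular_near (Ck_C1at oU (sF 1%N) Up).
have hpart i := C1at_regular_near (@Ck_C1at _ _ 0 U (partial F i) p oU ((sF 2%N).2 i) Up).
have hnui i := C1at_regular_near (Ck_C1at oW (snu i 1%N) (MW _ Mp)).
pose P (k : unit + ('I_n.+1 + 'I_n.+1)) := regular_near (match k with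
  | inl _ => F | inr (inl i) => partial F i | inr (inr i) => fun y => nu y 0 i end) p.
have [||r [C [r0 C0 h]]] := @finite_uniform _ P.
- by move=> k ? ? ? ? _; exact: regular_nearS.
- by case=> [?|[i|i]]; [exact: hF|exact: hpart|exact: hnui].
have {}hF := h (inl tt); have {}hpart i := h (inr (inl i)).
have {}hnui i := h (inr (inr i)).
pose m := `|grad F p|.
have m0 : 0 < m by rewrite normr_gt0 gF.
(* The gradient is [C]-Lipschitz, so the radius [m / (2 * C)] keeps it at least half as large as at
   [p]. *)
pose r' := Num.min r (Num.min rU (m / (2 * C))).
have r'0 : 0 < r' by rewrite !lt_min r0 rU0 divr_gt0// mulr_gt0.
have r'r : r' <= r by rewrite ge_min lexx.
have r'U y : `|y - p| < r' -> U y.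
  move=> yp; apply: hU; rewrite -ball_normE /ball_/= distrC.
  by apply: lt_le_trans yp _; rewrite !ge_min lexx orbT.
have gradL y y' : `|y - p| < r' -> `|y' - p| < r' ->
    `|grad F y - grad F y'| <= C * `|y - y'|.
  move=> yp y'p; apply: norm_leP => [|i]; first by rewrite mulr_ge0// ltW.
  have [_ _] := hpart i y (lt_le_trans yp r'r).
  by rewrite !mxE; apply; exact: lt_le_trans r'r.
exists F, r', C, (m / 2); split; first by split; rewrite ?divr_gt0.
split => //.
- move=> y yp; have [dF gF' _] := hF y (lt_le_trans yp r'r).
  by split => //; apply: MF; exact: r'U.
- move=> z Mz zp; have Uz := r'U _ zp; have gz := grad_normal ld Uz Mz; split => //.
  apply: (@le_trans _ _ `|grad F z|); last first.
    by rewrite [in leLHS]gz normrZ ler_piMr// norm_nu_le1.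
  rewrite -[grad F z](subKr (grad F p)); apply: le_trans (lerB_dist _ _).
  rewrite lerBrDl -lerBrDr.
  have -> : `|grad F p| - m / 2 = m / 2 by rewrite -/m; field.
  apply: le_trans (gradL _ _ _ zp) _; first by rewrite subrr normr0.
  rewrite distrC mulrC -ler_pdivlMr//.
  apply: le_trans (ltW zp) _; rewrite !ge_min; apply/orP; right; apply/orP; right.
  by rewrite invfM mulrA.
- move=> i y yp; have [dn gn _] := hnui i y (lt_le_trans yp r'r); by split.
- move=> y y' yp y'p; apply: norm_leP => [|i]; first by rewrite mulr_ge0// ltW.
  have [_ _] := hnui i y (lt_le_trans yp r'r).
  by rewrite !mxE; apply; exact: lt_le_trans r'r.
Qed.

(** [F] vanishes at both ends of the chord, so its first-order term divided by [h k] tends to 0.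
    That term contains [dot (nu z) (u k)] with a factor bounded below by [m]. *)
Lemma tangent_limit z (h : nat -> R) (u : nat -> V) (B : R) : M z ->
  (forall k, h k != 0) -> h @ \oo --> (0 : R) ->
  (forall k, `|u k| <= B) -> (forall k, M (z + h k *: u k)) ->
  (fun k => dot (nu z) (u k)) @ \oo --> (0 : R).
Proof.
move=> Mz h0 hcvg uB Mu.
have [F [r [C [m [[r0 C0 m0] [hF _ hz _ _]]]]]] := local_chart Mz.
have zz : `|z - z| < r by rewrite subrr normr0.
have [gz mz] := hz z Mz zz; have [Fz dF _] := hF z zz.
have B0 : 0 <= B by apply: le_trans (uB 0%N).
apply/cvgrPdist_lt => e e0.
pose e' := m * e / (2 * (B + 1)).
have e'0 : 0 < e' by rewrite divr_gt0 ?mulr_gt0// ltr_wpDl.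
have [d d0 hd] := diff_eps dF e'0.
have hk : \forall k \near \oo, `|h k| < Num.min r d / (B + 1).
  have /cvgrPdist_lt/(_ (Num.min r d / (B + 1))) := hcvg.
  have -> : 0 < Num.min r d / (B + 1) by rewrite divr_gt0 ?lt_min ?r0// ltr_wpDl.
  move=> /(_ isT); apply: filterS => k; by rewrite sub0r normrN.
near=> k.
have hkB : `|h k *: u k| < Num.min r d.
  rewrite normrZ; apply: (@le_lt_trans _ _ (`|h k| * (B + 1))).
    by rewrite ler_wpM2l// (le_trans (uB k))// lerDl.
  by rewrite -ltr_pdivlMr ?ltr_wpDl//; near: k.
have wd : `|h k *: u k| < d by apply: lt_le_trans hkB _; rewrite ge_min lexx orbT.
have wr : `|z + h k *: u k - z| < r.
  by rewrite addrC addKr; apply: lt_le_trans hkB _; rewrite ge_min lexx.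
have := hd _ wd; have [[Fw _] _ _] := hF _ wr.
rewrite (Fw (Mu k)) (Fz.1 Mz) subrr sub0r normrN dotZr normrM normrZ mulrCA.
rewrite ler_pM2l ?normr_gt0// gz dotZl normrM => le1.
rewrite sub0r normrN -(ltr_pM2l m0); apply: (@le_lt_trans _ _ (e' * `|u k|)).
  by apply: le_trans le1; rewrite ler_wpM2r.
apply: (@le_lt_trans _ _ (e' * (B + 1))).
  by rewrite ler_wpM2l ?(ltW e'0)// (le_trans (uB k))// lerDl.
have -> : e' * (B + 1) = m * e / 2 by rewrite /e'; field; rewrite lt0r_neq0// ltr_wpDl.
by rewrite ltr_pdivrMr// ltr_pMr ?mulr_gt0// ltr1n.
Unshelve. all: by end_near. Qed.

End LocalChart.

Section SecondDifference.
Context {R : realType} {n : nat}.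
Local Notation V := 'rV[R]_n.+1.
Implicit Types (F : V -> R) (x y u : V).

Lemma partial_shift F u y i : partial (fun y => F (y + u)) i y = partial F i (y + u).
Proof.
have E : (fun h : R => h^-1 *: (((fun y => F (y + u)) \o shift y) (h *: delta_mx 0 i) - F (y + u)))
       = (fun h : R => h^-1 *: ((F \o shift (y + u)) (h *: delta_mx 0 i) - F (y + u))).
  by apply/funext => h /=; rewrite addrA.
by rewrite /partial /derive E.
Qed.

Lemma differentiable_shift F u y : differentiable F (y + u) ->
  differentiable (fun y => F (y + u)) y.
Proof.
move=> dF; apply: (@differentiable_comp _ _ _ _ (fun y => y + u) F) => //.
Qed.

(** The mean value theorem for [F (y + u) - F y] as a function of [y], whose gradient is [O(|u|)].
    With [u] the full shift of a point, this is what makes the correction [c] Lipschitz with a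
    constant proportional to [h]. *)
Lemma second_difference F (p : V) (r C : R) x y u :
  (forall z, `|z - p| < r -> differentiable F z) ->
  (forall z z', `|z - p| < r -> `|z' - p| < r -> `|grad F z - grad F z'| <= C * `|z - z'|) ->
  `|x - p| < r -> `|y - p| < r -> `|x + u - p| < r -> `|y + u - p| < r ->
  `|(F (y + u) - F y) - (F (x + u) - F x)| <= n.+1%:R * C * `|u| * `|y - x|.
Proof.
move=> dF gF xp yp xup yup.
have seg (s : R) : 0 <= s <= 1 ->
    `|x + s *: (y - x) - p| < r /\ `|x + s *: (y - x) + u - p| < r.
  move=> s01; split; first by rewrite (le_lt_trans (segment_le_max _ _ _ s01))// gt_max xp.
  have -> : x + s *: (y - x) + u - p = (x + u) + s *: ((y + u) - (x + u)) - p.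
    by apply/rowP => i; rewrite !mxE; ring.
  by rewrite (le_lt_trans (segment_le_max _ _ _ s01))// gt_max xup.
pose k y := F (y + u) - F y.
have dk z : differentiable F z -> differentiable F (z + u) -> differentiable k z.
  by move=> d1 d2; apply: differentiableB => //; exact: differentiable_shift.
have gk z : differentiable F z -> differentiable F (z + u) -> grad k z = grad F (z + u) - grad F z.
  move=> d1 d2; apply/rowP => i; rewrite !mxE -partial_shift /partial -deriveB//.
  - by apply: diff_derivable; exact: differentiable_shift.
  - exact: diff_derivable.
have [|s s01 ks] := @mvt_segment _ _ k x y.
  by move=> s /seg[s1 s2]; apply: dk; exact: dF.
have [s1 s2] := seg _ s01.
rewrite -/(k y) -/(k x) ks gk; [|exact: dF..].
apply: le_trans (dot_le_norm _ _) _; rewrite ler_wpM2r// -mulrA ler_wpM2l//.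
apply: le_trans (gF _ _ s2 s1) _; by rewrite addrAC subrr add0r.
Qed.

End SecondDifference.

Section RegularPatch.
Context {R : realType} {n : nat}.
Local Notation V := 'rV[R]_n.+1.
Local Notation H := (@hausdorff R n).
Variables (M : set V) (nu : V -> V).
Local Notation cball z r := [set x : V | `|x - z| <= r].

(* [patch_flat] bounds the normal part of a chord of [M], and [patch_shift] says
   that [x + h e_i] returns to [M] along the fixed direction [nu z], by a
   correction [c x] that is [O(h)] and [O(h)]-Lipschitz. *)
Record regular_patch (z : V) (r C : R) : Prop := RegularPatch {
  patch_closed : closed (M `&` cball z r);
  patch_finite : (H (M `&` cball z r) < +oo)%E;
  patch_flat : forall rho x y, rho <= r -> M x -> M y ->
    `|x - z| <= rho -> `|y - z| <= rho ->
    `|dot (x - y) (nu z)| <= C * rho * `|x - y|;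
  patch_shift : forall i (h : R), `|h| <= r -> exists c : V -> R,
    (forall x, M x -> `|x - z| <= r ->
       `|c x| <= C * `|h| /\ M (x + (h *: delta_mx 0 i + c x *: nu z))) /\
    (forall x y, M x -> M y -> `|x - z| <= r -> `|y - z| <= r ->
       `|c x - c y| <= C * `|h| * `|x - y|);
  patch_normal : forall x, `|x - z| <= r -> `|nu x - nu z| <= C * `|x - z| /\
    forall i, `|grad (fun y => nu y 0 i) x| <= C }.

Lemma closed_cball (z : V) (r : R) : closed (cball z r).
Proof.
move=> x cx; apply/ler_addgt0Pr => e e0.
have [y [/= yz]] := cx _ (nbhsx_ballx x e e0); rewrite -ball_normE /ball_/= => xy.
have -> : x - z = (y - z) + (x - y) by rewrite [RHS]addrC subrKA.
by rewrite (le_trans (ler_normD _ _))// lerD// ltW.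
Qed.

Lemma regular_patchS z (r r' C C' : R) : 0 < r' -> r' <= r -> C <= C' ->
  regular_patch z r C -> regular_patch z r' C'.
Proof.
move=> r'0 r'r CC' [cl fin flat shift nrm].
have sub : M `&` cball z r' = (M `&` cball z r) `&` cball z r'.
  by rewrite -setIA; congr (_ `&` _); rewrite setIidr// => x /= /le_trans; exact.
split.
- by rewrite sub; apply: closedI => //; exact: closed_cball.
- apply: le_lt_trans fin; apply: le_hausdorff; rewrite sub; exact: subIsetl.
- move=> rho x y rr' Mx My xz yz; apply: le_trans (flat _ _ _ (le_trans rr' r'r) Mx My xz yz) _.
  by rewrite !ler_wpM2r// (le_trans _ xz).
- move=> i h hr'; have [c [c1 c2]] := shift i h (le_trans hr' r'r); exists c; split.
    move=> x Mx xz; have [cx Mc] := c1 _ Mx (le_trans xz r'r); split => //.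
    by apply: le_trans cx _; rewrite ler_wpM2r.
  move=> x y Mx My xz yz; apply: le_trans (c2 _ _ Mx My (le_trans xz r'r) (le_trans yz r'r)) _.
  by rewrite !ler_wpM2r.
- move=> x xz; have [n1 n2] := nrm x (le_trans xz r'r); split => [|i].
    by apply: le_trans n1 _; rewrite ler_wpM2r.
  exact: le_trans (n2 i) _.
Qed.

End RegularPatch.

(** * Finite area of small pieces of the hypersurface *)

Section FiniteArea.
Context {R : realType} {n : nat}.
Local Notation V := 'rV[R]_n.+1.
Local Notation H := (@hausdorff R n).

Lemma exists_cell (N : nat) (w s : R) : (0 < N)%N -> 0 <= s <= N%:R * w ->
  exists k : 'I_N, k%:R * w <= s <= k.+1%:R * w.
Proof.
elim: N => // N IH _ /andP[s0 sN].
have [sN'|sN'] := leP s (N%:R * w); last by exists ord_max; rewrite /= (ltW sN').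
case: N IH sN sN' => [_ sN sN'|N IH sN sN'].
  by exists ord0; rewrite /= mul0r s0.
have [//||k hk] := IH; first by rewrite s0.
by exists (widen_ord (leqnSn _) k).
Qed.

Lemma hausdorff_pre_finite_cover (I : finType) (D : I -> set V) (A : set V) (d b : R) :
  A `<=` \bigcup_i D i -> (forall i, (diamE (D i) <= d%:E)%E) ->
  (forall i, (hcontrib (D i) <= b%:E)%E) ->
  (hausdorff_pre d A <= (#|I|%:R * b)%:E)%E.
Proof.
move=> AD Dd Db.
pose C i := if insub i : option 'I_#|I| is Some o then D (enum_val o) else set0.
apply: (@le_trans _ _ (\sum_(0 <= i <oo) hcontrib (C i))%E).
  apply: ereal_inf_lbound; exists C => //; split.
    move=> x /AD[i _ Dix]; exists (enum_rank i) => //.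
    by rewrite /C insubT ?ltn_ord//= => lt; rewrite (_ : Sub _ _ = enum_rank i) ?enum_rankK//; exact: val_inj.
  by move=> i; rewrite /C; case: insubP => // _; rewrite diamE_set0 leNye.
rewrite (@nneseries_split _ _ 0 #|I|)//; last by move=> i _; exact: hcontrib_ge0.
rewrite add0n [X in (_ + X)%E]eseries0 ?adde0; last first.
  by move=> i Ii _; rewrite /C insubF ?hcontrib0// ltnNge Ii.
rewrite big_mkord; apply: (@le_trans _ _ (\sum_(i < #|I|) b%:E)%E).
  by apply: lee_sum => i _; rewrite /C; case: insubP => // ; rewrite ltn_ord.
by rewrite sumEFin sumr_const card_ord mulr_natl.
Qed.

(** Coordinate [j] is controlled by the other [n], as on a Lipschitz graph. Cutting these into [N]
    intervals of width [w = 2 r / N] gives [N^n] pieces of diameter at most [L w], and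
    [N^n (L w / 2)^n = (L r)^n] does not depend on the mesh. *)
Lemma hausdorff_finite (A : set V) (p : V) (r L : R) (j : 'I_n.+1) :
  0 < r -> 0 < L -> A `<=` [set x | `|x - p| <= r] ->
  (forall x y t, A x -> A y -> 0 <= t -> (forall i, i != j -> `|x 0 i - y 0 i| <= t) ->
     enorm (x - y) <= L * t) ->
  (H A < +oo)%E.
Proof.
move=> r0 L0 Ar hL.
apply: (@le_lt_trans _ _ ((omega R n * (L * r) ^+ n)%:E)); last exact: ltey.
apply: ge_ereal_sup => _ [d d0 <-].
have [N N0 Nd] : exists2 N : nat, (0 < N)%N & L * ((2 * r) / N%:R) <= d.
  have [k hk] := ltr_add_invr (divr_gt0 d0 (mulr_gt0 L0 (mulr_gt0 (ltr0Sn R 1) r0))).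
  exists k.+1 => //; rewrite add0r in hk.
  by rewrite mulrA -ler_pdivlMl ?mulr_gt0 ?mulr_gt0// mulrC ltW.
pose w := (2 * r) / N%:R.
have w0 : 0 < w by rewrite divr_gt0 ?mulr_gt0// ltr0n.
have Nw : N%:R * w = (2 * r) by rewrite mulrC divfK// pnatr_eq0 -lt0n.
pose D (f : {ffun 'I_n -> 'I_N}) := A `&` [set x | forall k,
   (f k)%:R * w <= x 0 (lift j k) - p 0 (lift j k) + r <= (f k).+1%:R * w].
have Ddiam f : (diamE (D f) <= (L * w)%:E)%E.
  apply: diamE_le => x y [Ax /= Dx] [Ay /= Dy]; apply: hL => // [|i ij]; first exact: ltW.
  case: (unliftP j i) ij => [k ->|->]; last by rewrite eqxx.
  move=> _; have := Dx k; have := Dy k; rewrite -!natr1 !mulrDl mul1r.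
  by rewrite ler_norml; lra.
apply: (@le_trans _ _ ((#|{ffun 'I_n -> 'I_N}|%:R * (omega R n * (L * w / 2) ^+ n))%:E)).
  apply: hausdorff_pre_finite_cover => [x Ax|f|f]; last 2 first.
  - by apply: le_trans (Ddiam f) _; rewrite lee_fin.
  - by apply: hcontrib_le => //; rewrite mulr_ge0// ltW.
  have cell k : exists l : 'I_N, l%:R * w <= x 0 (lift j k) - p 0 (lift j k) + r <= l.+1%:R * w.
    apply: exists_cell => //; rewrite Nw.
    have := le_trans (coord_le_norm (x - p) (lift j k)) (Ar _ Ax).
    by rewrite !mxE ler_norml; lra.
  have [f hf] := choice cell; exists (finfun f) => //; split => // k.
  by rewrite ffunE.
rewrite card_ffun !card_ord lee_fin natrX mulrCA -exprMn.
have -> : N%:R * (L * w / 2) = L * r.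
  have -> : N%:R * (L * w / 2) = L * (N%:R * w) / 2 by ring.
  by rewrite Nw; field.
by [].
Qed.

End FiniteArea.

Section LocalPatch.
Context {R : realType} {n : nat}.
Local Notation V := 'rV[R]_n.+1.
Local Notation H := (@hausdorff R n).
Variables (M : set V) (nu : V -> V).
Hypotheses (hM : is_hypersurface M) (hnu : unit_normal_field M nu).
Local Notation cball z r := [set x : V | `|x - z| <= r].

(** [j] is a coordinate where the gradient of [F] at [p] is largest. Along a chord of [M] the mean
    value theorem gives a linear relation whose [j] coefficient stays at least [mu / 2] in absolute
    value, so the [j] difference is bounded by the others. *)
Lemma finite_local p : M p -> exists2 r : R, 0 < r & (H (M `&` cball p r) < +oo)%E.
Proof.
move=> Mp; have [F [r0 [C [m [[r00 C0 m0] [hF gL hz _ _]]]]]] := local_chart hM hnu Mp.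
have pp : `|p - p| < r0 by rewrite subrr normr0.
have [gp mp] := hz p Mp pp.
have g0 : `|grad F p| != 0.
  rewrite normr_eq0; apply/eqP => g0; move: mp; rewrite g0 -(scale0r (0 : V)) dotZl mul0r normr0.
  by rewrite leNgt m0.
have [[i0 j] /= jE] := mx_norm_neq0 g0.
have mu0 : 0 < `|grad F p 0 j|.
  have : 0 < `|grad F p| by rewrite lt_neqAle eq_sym g0 normr_ge0.
  by rewrite [X in _ < X -> _]jE (ord1 i0).
set mu := `|grad F p 0 j| in mu0.
pose r := Num.min (r0 / 2) (mu / (2 * C)).
have rp : 0 < r by rewrite lt_min !divr_gt0// mulr_gt0.
have rr0 : r < r0 by rewrite gt_min ltr_pdivrMr// ltr_pMr// ltr1n.
have Cr : C * r <= mu / 2.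
  rewrite -ler_pdivlMl//; apply: (@le_trans _ _ (mu / (2 * C))); first by rewrite ge_min lexx orbT.
  by rewrite invfM mulrA mulrC.
exists r => //.
pose L := n.+1%:R * (1 + 2 * n.+1%:R * C / mu).
have L0 : 0 < L by rewrite mulr_gt0// ltr_pwDl// divr_ge0 ?(ltW mu0)// !mulr_ge0// ltW.
apply: (@hausdorff_finite _ _ _ p r L j rp L0); first exact: subIsetr.
move=> x y t [Mx /= xp] [My /= yp] t0 hxy.
have inb z : `|z - p| <= r -> `|z - p| < r0 by move=> /le_lt_trans; exact.
have Fx : F x = 0 by have [[h _] _ _] := hF x (inb _ xp); exact: h.
have Fy : F y = 0 by have [[h _] _ _] := hF y (inb _ yp); exact: h.
have seg (s : R) : 0 <= s <= 1 -> `|x + s *: (y - x) - p| <= r.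
  by move=> s01; rewrite (le_trans (segment_le_max _ _ _ s01))// ge_max xp.
have [|s s01] := @mvt_segment _ _ F x y.
  by move=> s /seg sp; have [] := hF _ (inb _ sp).
rewrite Fx Fy subrr; set xi := x + _ => E.
have xip : `|xi - p| <= r by exact: seg.
have [_ _ gC] := hF _ (inb _ xip).
have gj : mu / 2 <= `|grad F xi 0 j|.
  have := le_trans (coord_le_norm (grad F p - grad F xi) j) (gL _ _ pp (inb _ xip)).
  have -> : (grad F p - grad F xi) 0 j = grad F p 0 j - grad F xi 0 j by rewrite !mxE.
  rewrite distrC => h; have h1 : C * `|p - xi| <= mu / 2.
    by apply: le_trans Cr; rewrite ler_wpM2l ?(ltW C0)// distrC.
  have := lerB_dist (grad F p 0 j) (grad F xi 0 j); rewrite -/mu distrC; lra.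
have rest : `|grad F xi 0 j * (y - x) 0 j| <= n.+1%:R * C * t.
  move: E; rewrite /dot (bigD1 j)//= => /esym/eqP; rewrite addr_eq0 => /eqP ->.
  rewrite normrN; apply: le_trans (ler_norm_sum _ _ _) _.
  apply: (@le_trans _ _ (\sum_(i < n.+1) C * t)); last first.
    by rewrite sumr_const card_ord -mulrA mulr_natl.
  rewrite [leRHS](bigD1 j)//= -[leLHS]add0r lerD ?mulr_ge0 ?(ltW C0)//.
  apply: ler_sum => i ij; rewrite normrM ler_pM//.
    exact: le_trans (coord_le_norm _ _) gC.
  by rewrite !mxE distrC hxy.
have xyj : `|x 0 j - y 0 j| <= 2 * n.+1%:R * C / mu * t.
  rewrite distrC -(ler_pM2l mu0).
  have -> : mu * (2 * n.+1%:R * C / mu * t) = 2 * (n.+1%:R * C * t) by field; rewrite gt_eqF.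
  rewrite normrM !mxE in rest.
  have : mu / 2 * `|y 0 j - x 0 j| <= `|grad F xi 0 j| * `|y 0 j - x 0 j| by rewrite ler_wpM2r.
  by move: rest; rewrite !mxE; lra.
apply: le_trans (enorm_le_norm _) _; rewrite /L -mulrA ler_wpM2l//.
have Ct : 0 <= 2 * n.+1%:R * C / mu * t.
  by rewrite mulr_ge0// divr_ge0 ?mulr_ge0// ltW.
rewrite mulrDl mul1r; apply: norm_leP => [|i]; first by rewrite addr_ge0.
rewrite !mxE; have [->|ij] := eqVneq i j.
  by apply: le_trans xyj _; rewrite lerDr.
by apply: le_trans (hxy i ij) _; rewrite lerDl.
Qed.

End LocalPatch.

(** * Regular patches with uniform constants *)

Section UniformPatch.
Context {R : realType} {n : nat}.
Local Notation V := 'rV[R]_n.+1.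
Local Notation H := (@hausdorff R n).
Variables (M : set V) (nu : V -> V).
Hypotheses (hM : is_hypersurface M) (hnu : unit_normal_field M nu).
Local Notation cball z r := [set x : V | `|x - z| <= r].

(** The chart constants at [p] serve every [z] of [M] near [p], the uniformity that compactness
    needs. The correction comes from the intermediate value theorem along [nu z], its Lipschitz
    bound from [second_difference]. *)
Lemma local_patch p : M p -> exists r C : R, [/\ 0 < r, 0 < C &
  forall z, M z -> `|z - p| < r -> regular_patch M nu z r C].
Proof.
move=> Mp; have [r1 r10 fin] := finite_local hM hnu Mp.
have [F [r0 [C [m [[r00 C0 m0] [hF gL hz hn nuL]]]]]] := local_chart hM hnu Mp.
pose D : R := n.+1%:R.
have D0 : 0 < D by [].
(* [C1] bounds [|c x| / |h|]: moving by [C1 |h|] along the normal changes [F] at least as much as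
   moving by [|h|] along an axis can. *)
pose C1 := 4 * D * C / m.
have C10 : 0 < C1 by rewrite divr_gt0// !mulr_gt0.
(* Three constraints: finite area ([r1]), shifted points stay in the chart ([r0]), and the normal
   derivative of [F] keeps half of its size at [z] (the term in [m]). *)
pose r := Num.min (r1 / 2) (Num.min (r0 / (4 + C1)) (m / (2 * D * C * (2 + C1)))).
have C14 : 0 < 4 + C1 by rewrite addr_gt0.
have C12 : 0 < 2 + C1 by rewrite addr_gt0.
have r_gt0 : 0 < r by rewrite !lt_min !divr_gt0// !mulr_gt0.
have rr1 : r + r <= r1.
  have : r <= r1 / 2 by rewrite ge_min lexx.
  lra.
have rr0 : (4 + C1) * r <= r0.
  by rewrite mulrC -ler_pdivlMr// !ge_min lexx !orbT.
have rm : D * C * ((2 + C1) * r) <= m / 2.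
  have : r <= m / (2 * D * C * (2 + C1)) by rewrite !ge_min lexx !orbT.
  rewrite ler_pdivlMr ?mulr_gt0//; lra.
pose C2 := 2 / m * D * C * (1 + C1).
have C20 : 0 < C2 by rewrite !mulr_gt0 ?invr_gt0// addr_gt0.
exists r, (C1 + C2 + C + 2 / m * D * C); split => //.
  by rewrite !addr_gt0// !mulr_gt0 ?invr_gt0.
have Dm0 : 0 < 2 / m * D * C by rewrite !mulr_gt0 ?invr_gt0.
move=> z Mz zp; set N := nu z.
have inb y (t : R) : `|y - z| <= t -> t <= (2 + C1) * r -> `|y - p| < r0.
  move=> yz tr; have -> : y - p = (y - z) + (z - p) by rewrite subrKA.
  apply: le_lt_trans (ler_normD _ _) _; apply: lt_le_trans rr0.
  have := mulr_gt0 C10 r_gt0; move: yz tr zp; lra.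
have zz0 : `|z - z| <= 0 by rewrite subrr normr0.
have C1r0 : 0 <= (2 + C1) * r by rewrite mulr_ge0// ltW.
have zr0 := inb _ _ zz0 C1r0.
have [gz mk] := hz z Mz zr0; set k := dot (grad F z) N in gz mk.
have N1 : `|N| <= 1 by exact: (norm_nu_le1 hnu Mz).
have MF y (t : R) : `|y - z| <= t -> t <= (2 + C1) * r -> M y <-> F y = 0.
  by move=> yz tr; have [] := hF y (inb _ _ yz tr).
have dF y (t : R) : `|y - z| <= t -> t <= (2 + C1) * r -> differentiable F y.
  by move=> yz tr; have [] := hF y (inb _ _ yz tr).
have gF y (t : R) : `|y - z| <= t -> t <= (2 + C1) * r -> `|grad F y| <= C.
  by move=> yz tr; have [] := hF y (inb _ _ yz tr).
have rC : r <= (2 + C1) * r by rewrite ler_peMl ?(ltW r_gt0)//; move: C10; lra.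
have r2C : 2 * r <= (2 + C1) * r by rewrite ler_wpM2r ?(ltW r_gt0)//; move: C10; lra.
have segz x y (t s : R) : `|x - z| <= t -> `|y - z| <= t -> 0 <= s <= 1 -> `|x + s *: (y - x) - z| <= t.
  by move=> xz yz s01; rewrite (le_trans (segment_le_max _ _ _ s01))// ge_max xz.
have lin y (t : R) v : `|y - z| <= t -> t <= (2 + C1) * r ->
    `|dot (grad F y) v - k * dot N v| <= D * C * t * `|v|.
  move=> yz tr; rewrite -dotZl -gz -dotBl; apply: le_trans (dot_le_norm _ _) _.
  rewrite ler_wpM2r// -mulrA ler_wpM2l//.
  apply: le_trans (gL _ _ (inb _ _ yz tr) zr0) _.
  by rewrite ler_wpM2l// ltW.
(* Multiplying by [k] treats both possible signs of the normal derivative at once. *)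
have low y (t : R) : `|y - z| <= t -> t <= (2 + C1) * r ->
    k ^+ 2 / 2 <= k * dot (grad F y) N.
  move=> yz tr; have := lin y t N yz tr; rewrite (dot_nu hnu Mz) mulr1 => h.
  have h2 : `|dot (grad F y) N - k| <= `|k| / 2.
    apply: le_trans h _; apply: (@le_trans _ _ (D * C * ((2 + C1) * r) * 1)).
      rewrite ler_pM// ?mulr_ge0 ?(ltW C0)// ?(le_trans _ yz)//.
      by rewrite ler_wpM2l// mulr_ge0// ltW.
    by rewrite mulr1; apply: le_trans rm _; rewrite ler_pM2r.
  have : `|k * (dot (grad F y) N - k)| <= `|k| * (`|k| / 2).
    by rewrite normrM ler_wpM2l.
  rewrite mulrA -expr2 real_normK ?num_real// ler_norml mulrBr -expr2; lra.
have k0 : 0 < `|k| by apply: lt_le_trans mk.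
split.
- move=> x cx.
  have xz : `|x - z| <= r.
    apply: (@closed_cball R n z r) => U nU; have [y [[_ yz] Uy]] := cx U nU.
    by exists y.
  split => //; apply/(MF x r xz rC); apply/eqP/negPn/negP; rewrite -normr_gt0 => Fx0.
  have /cvgrPdist_lt/(_ _ Fx0) nb := differentiable_continuous (dF x r xz rC).
  have [y [[My yz] /=]] := cx _ nb.
  by rewrite ((MF y r yz rC).1 My) subr0 ltxx.
- apply: le_lt_trans fin; apply: le_hausdorff => x [Mx /= xz]; split => //=.
  have -> : x - p = (x - z) + (z - p) by rewrite subrKA.
  apply: le_trans (ler_normD _ _) _; move: rr1 zp xz; lra.
(* [F] vanishes at [x] and [y], so the gradient at some point of the chord is orthogonal to [x - y];
   by [lin], replacing it by [k N] costs at most [D C rho |x - y|]. *)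
- move=> rho x y rhor Mx My xz yz.
  have rhoC := le_trans rhor rC.
  have [|s s01] := @mvt_segment _ _ F y x.
    by move=> s s01; apply: (dF _ rho) => //; exact: segz.
  rewrite (MF x rho xz rhoC).1// (MF y rho yz rhoC).1// subrr => E.
  have := lin _ _ (x - y) (segz _ _ _ _ yz xz s01) rhoC.
  rewrite -E sub0r normrN normrM dotC => h.
  have h2 : m * `|dot (x - y) N| <= D * C * rho * `|x - y|.
    by apply: le_trans h; rewrite ler_wpM2r.
  apply: (@le_trans _ _ (2 / m * D * C * rho * `|x - y|)); last first.
    rewrite ler_wpM2r// ler_wpM2r ?(le_trans _ xz)// lerDr.
    by rewrite !addr_ge0// ltW.
  rewrite -(ler_pM2l m0).
  have -> : m * (2 / m * D * C * rho * `|x - y|) = 2 * (D * C * rho * `|x - y|).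
    by field; rewrite gt_eqF.
  have : 0 <= D * C * rho * `|x - y| by rewrite !mulr_ge0 ?(ltW C0)// (le_trans _ xz).
  move: h2; lra.
- move=> i h hr; pose e : V := delta_mx 0 i.
  have e1 : `|e| <= 1.
    by apply: norm_leP => // j; rewrite mxE eqxx /=; case: eqP; rewrite ?normr1 ?normr0.
  pose W x (c : R) := x + (h *: e + c *: N).
  have Wz x c (_ : R) : `|x - z| <= r -> `|c| <= C1 * `|h| -> `|W x c - z| <= (2 + C1) * r.
    move=> xz ch; have -> : W x c - z = (x - z) + (h *: e + c *: N).
      by rewrite /W addrAC.
    apply: le_trans (ler_normD _ _) _.
    apply: (@le_trans _ _ (r + (`|h| * 1 + C1 * `|h| * 1))).
      rewrite lerD// (le_trans (ler_normD _ _))// !normrZ lerD// ler_pM//.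
    have : C1 * `|h| <= C1 * r by rewrite ler_pM2l.
    move: hr; lra.
  have ex x : exists c : R, M x -> `|x - z| <= r -> `|c| <= C1 * `|h| /\ M (W x c).
    have [[Mx xz]|nMx] := pselect (M x /\ `|x - z| <= r); last first.
      by exists 0 => Mx xz; case: nMx.
    have [h00|h0] := eqVneq h 0.
      by exists 0 => _ _; rewrite /W h00 normr0 mulr0 !scale0r !addr0.
    have c00 : 0 < C1 * `|h| by rewrite mulr_gt0// normr_gt0.
    have Chh0 : 0 <= C1 * `|h| * `|h| by rewrite mulr_ge0// ltW.
    pose phi c := k * F (W x c).
    (* At the ends [|c| = C1 |h|] the normal term of [F (W x c)] is at least as large as the term in
       [e]; this yields the sign change for [IVT]. *)
    have sgn c : `|c| = C1 * `|h| -> 0 <= c * phi c.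
      move=> ch; have cz : `|W x c - z| <= (2 + C1) * r by apply: Wz; rewrite ?ch.
      have xz' := le_trans xz rC.
      have [|s s01] := @mvt_segment _ _ F x (W x c).
        by move=> s s01; apply: (dF _ ((2 + C1) * r)) => //; exact: segz.
      have := segz _ _ _ _ xz' cz s01; set xi := x + _ => xiz.
      rewrite (MF x r xz rC).1// subr0 => E.
      have -> : c * phi c = c * h * (k * dot (grad F xi) e) + c ^+ 2 * (k * dot (grad F xi) N).
        rewrite /phi E (_ : W x c - x = h *: e + c *: N); last by rewrite /W addrC addKr.
        by rewrite dotDr !dotZr; ring.
      have ge : `|dot (grad F xi) e| <= C.
        rewrite dot_delta; apply: le_trans (coord_le_norm _ _) _.
        by apply: gF xiz _.
      have t1 : `|c * h * (k * dot (grad F xi) e)| <= C1 * `|h| * `|h| * (`|k| * C).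
        by rewrite !normrM ch ler_wpM2l// ler_wpM2l.
      have t2 : (C1 * `|h|) ^+ 2 * (k ^+ 2 / 2) <= c ^+ 2 * (k * dot (grad F xi) N).
        rewrite -ch real_normK ?num_real// ler_wpM2l ?sqr_ge0//.
        exact: low xiz _.
      have t3 : C1 * `|h| * `|h| * (`|k| * C) <= (C1 * `|h|) ^+ 2 * (k ^+ 2 / 2).
        have -> : (C1 * `|h|) ^+ 2 * (k ^+ 2 / 2) = C1 * `|h| * `|h| * (`|k| * (C1 * `|k| / 2)).
          by rewrite -(real_normK (num_real k)); ring.
        rewrite ler_wpM2l// ler_wpM2l//.
        rewrite /C1; apply: (@le_trans _ _ (4 * D * C / m * m / 2)); last first.
          by rewrite ler_pM2r// ler_wpM2l// divr_ge0 ?(ltW m0)// !mulr_ge0// ltW.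
        rewrite divfK ?gt_eqF//; have : C <= D * C by rewrite ler_peMl ?(ltW C0)// ler1n.
        by move: C0; lra.
      by move: t1; rewrite ler_norml; move: t2 t3; lra.
    have phi_cont : {within `[- (C1 * `|h|), C1 * `|h|], continuous phi}.
      apply: derivable_within_continuous => c; rewrite in_itv /= -ler_norml => ch.
      apply: derivableM; first exact: derivable_cst.
      have E : (fun c => F (W x c)) = (fun c => F (x + h *: e + c *: N)).
        by apply/funext => c'; rewrite /W addrA.
      rewrite E; have [] // := @line_is_derive _ _ F (x + h *: e) N c _.
      apply: diff_derivable; rewrite -addrA; apply: dF (Wz x c r xz ch) _.
      exact: lexx.
    have [||c] := @IVT _ phi (- (C1 * `|h|)) (C1 * `|h|) 0 _ phi_cont.
    - by rewrite ge0_cp// ltW.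
    - have := sgn (C1 * `|h|); have := sgn (- (C1 * `|h|)).
      rewrite normrN ger0_norm ?(ltW c00)// => /(_ erefl) s1 /(_ erefl).
      rewrite pmulr_rge0// => s2; rewrite mulNr oppr_ge0 pmulr_rle0// in s1.
      by rewrite ge_min s1 le_max s2 orbT.
    rewrite in_itv /= -ler_norml => ch /eqP; rewrite mulf_eq0 -normr_eq0 gt_eqF//= => /eqP Fc.
    by exists c => _ _; split => //; apply/(MF (W x c) _ (Wz x c r xz ch) (lexx _)).
  have [c hc] := choice ex; exists c; split.
    move=> x Mx xz; have [cx Mc] := hc x Mx xz; split => //.
    apply: le_trans cx _; rewrite ler_wpM2r// -!addrA lerDl.
    by rewrite !addr_ge0// ltW.
  move=> x y Mx My xz yz.
  have [cx Mcx] := hc x Mx xz; have [cy Mcy] := hc y My yz.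
  have Wxx := Wz x (c x) r xz cx; have Wyx := Wz y (c x) r yz cx.
  have Wyy := Wz y (c y) r yz cy.
  have F0 w : M w -> `|w - z| <= (2 + C1) * r -> F w = 0.
    by move=> Mw wz; apply/(MF w _ wz (lexx _)).
  (* Three of the four values of [F] vanish. The fourth, at [y] moved by the correction of [x],
     measures [c x - c y], since the normal derivative of [F] is at least [m / 2] in absolute
     value. *)
  have := @second_difference _ _ F p r0 C x y (h *: e + c x *: N).
  rewrite -/(W x (c x)) -/(W y (c x)) !(F0 x) ?(F0 y) ?(F0 (W x (c x)))//; last 2 first.
  - exact: le_trans yz rC.
  - exact: le_trans xz rC.
  have dF' w : `|w - p| < r0 -> differentiable F w by move=> /hF[].
  rewrite !subr0 => /(_ dF' gL (inb _ _ xz rC) (inb _ _ yz rC) (inb _ _ Wxx (lexx _)) (inb _ _ Wyx (lexx _))).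
  have [|s s01] := @mvt_segment _ _ F (W y (c y)) (W y (c x)).
    by move=> s s01; apply: (dF _ ((2 + C1) * r)) => //; exact: segz.
  have := segz _ _ _ _ Wyy Wyx s01; set xi := W y (c y) + _ => xiz.
  rewrite (F0 (W y (c y)))// subr0 => ->.
  have -> : W y (c x) - W y (c y) = (c x - c y) *: N.
    by apply/rowP => j; rewrite !mxE; ring.
  rewrite dotZr normrM => le1.
  have lowN : m / 2 <= `|dot (grad F xi) N|.
    apply: (@le_trans _ _ (`|k| / 2)); first by rewrite ler_pM2r.
    rewrite -(ler_pM2l k0) mulrA -expr2 real_normK ?num_real// -normrM.
    by apply: le_trans (ler_norm _); exact: low xiz (lexx _).
  have u1 : `|h *: e + c x *: N| <= (1 + C1) * `|h|.
    rewrite mulrDl mul1r (le_trans (ler_normD _ _))// lerD// normrZ.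
      by rewrite ler_piMr.
    by apply: le_trans cx; rewrite ler_piMr.
  have : `|c x - c y| <= C2 * `|h| * `|x - y|.
    rewrite -(@ler_pM2r _ (m / 2)) ?divr_gt0//.
    apply: (@le_trans _ _ (`|c x - c y| * `|dot (grad F xi) N|)); first by rewrite ler_wpM2l.
    apply: le_trans le1 _.
    have -> : C2 * `|h| * `|x - y| * (m / 2) = D * C * ((1 + C1) * `|h|) * `|y - x|.
      by rewrite /C2 (distrC x); field; rewrite gt_eqF.
    by rewrite ler_wpM2r// ler_wpM2l// mulr_ge0// ltW.
  move/le_trans; apply; rewrite ler_wpM2r// ler_wpM2r// -!addrA addrCA lerDl.
  by rewrite !addr_ge0// ltW.
- move=> x xz; split.
    apply: le_trans (nuL _ _ (inb _ _ xz rC) zr0) _.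
    rewrite ler_wpM2r// -(addrA (C1 + C2)) addrCA lerDl.
    by rewrite !addr_ge0// ltW.
  move=> i; have [_ h] := hn i x (inb _ _ xz rC); apply: le_trans h _.
  rewrite -(addrA (C1 + C2)) addrCA lerDl.
  by rewrite !addr_ge0// ltW.
Qed.

End UniformPatch.

Section CompactPatch.
Context {R : realType} {n : nat}.
Local Notation V := 'rV[R]_n.+1.
(** Radius and constant are tied to one integer, as [1 / (i + 1)] and [i + 1]. Uniformity over [K]
    is then a statement about all large [i], to which the near-covering form of compactness
    applies. *)
Lemma compact_uniform (K : set V) (P : V -> R -> R -> Prop) : compact K ->
  (forall z r r' C C', 0 < r' -> r' <= r -> C <= C' -> P z r C -> P z r' C') ->
  (forall p, K p -> exists r C : R, [/\ 0 < r, 0 < C &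
     forall z, K z -> `|z - p| < r -> P z r C]) ->
  exists r C : R, [/\ 0 < r, 0 < C & forall z, K z -> P z r C].
Proof.
move=> cK mono loc.
pose Q (i : nat) z := K z -> P z i.+1%:R^-1 i.+1%:R.
have /compact_near_coveringP/(_ nat \oo Q _) cov := cK.
have [|i _ hi] := cov.
  move=> p /loc[r [C [r0 C0 h]]].
  have [k hk] := ltr_add_invr r0; rewrite add0r in hk.
  have [N hN] : exists N, forall i, (N <= i)%N -> C <= i.+1%:R /\ i.+1%:R^-1 <= r.
    exists (maxn (Num.bound C) k) => i; rewrite geq_max => /andP[iC ik]; split.
      by apply: le_trans (ltW (archi_boundP (ltW C0))) _; rewrite ler_nat leqW.
    apply: le_trans (ltW hk); by rewrite lef_pV2 ?posrE// ler_nat.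
  exists (ball p r, [set i | (N <= i)%N]) => /=.
    by split; [exact: nbhsx_ballx|exists N].
  move=> [z i] /= [zp /hN[Ci ir]] Kz.
  apply: (mono _ _ _ _ _ _ ir Ci); first by rewrite invr_gt0.
  by apply: h => //; move: zp; rewrite -ball_normE /ball_/= distrC.
exists i.+1%:R^-1, i.+1%:R; split; rewrite ?invr_gt0// => z Kz.
by apply: (hi i) => //=.
Qed.

Variables (M : set V) (nu : V -> V).
Hypotheses (hM : is_hypersurface M) (hnu : unit_normal_field M nu).

Lemma compact_patch (K : set V) : compact K -> K `<=` M ->
  exists r C : R, [/\ 0 < r, 0 < C & forall z, K z -> regular_patch M nu z r C].
Proof.
move=> cK KM; apply: (@compact_uniform K (regular_patch M nu) cK).
  by move=> z r r' C C'; exact: regular_patchS.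
move=> p /KM Mp; have [r [C [r0 C0 h]]] := local_patch hM hnu Mp.
by exists r, C; split => // z /KM Mz; exact: h.
Qed.

End CompactPatch.

(** * Integration of bounded functions over compact pieces *)

Section BoundedMeasurable.
Context {R : realType} {n : nat}.
Local Notation V := 'rV[R]_n.+1.
Local Notation H := (@hausdorff R n).
Local Notation T := (caratheodory_type H).
Local Notation mu := (@hmeasure R n).
Implicit Types (f g : V -> R) (A : set V).

(** Boundedness is kept along with measurability because this class is closed under products and, on
    sets of finite area, consists of integrable functions. *)
Definition bmfun A f := measurable_fun (A : set T) (f : T -> R) /\
  exists B : R, forall x, A x -> `|f x| <= B.

Lemma bmfun_cst A (c : R) : bmfun A (fun=> c).
Proof. by split; [exact: measurable_cst|exists `|c|]. Qed.

Lemma bmfunD A f g : bmfun A f -> bmfun A g -> bmfun A (fun x => f x + g x).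
Proof.
move=> [mf [B hB]] [mg [B' hB']]; split; first exact: measurable_funD.
by exists (B + B') => x Ax; rewrite (le_trans (ler_normD _ _))// lerD ?hB ?hB'.
Qed.

Lemma bmfunM A f g : bmfun A f -> bmfun A g -> bmfun A (fun x => f x * g x).
Proof.
move=> [mf [B hB]] [mg [B' hB']]; split; first exact: measurable_funM.
by exists (B * B') => x Ax; rewrite normrM ler_pM ?hB ?hB'.
Qed.

Lemma bmfunN A f : bmfun A f -> bmfun A (fun x => - f x).
Proof.
move=> [mf [B hB]]; split; last by exists B => x Ax; rewrite normrN hB.
by apply: (@measurableT_comp _ _ _ _ _ _ (@GRing.opp R)) => //; exact: oppr_measurable.
Qed.

Lemma bmfunB A f g : bmfun A f -> bmfun A g -> bmfun A (fun x => f x - g x).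
Proof. by move=> mf mg; exact: (bmfunD mf (bmfunN mg)). Qed.

Lemma bmfun_norm A f : bmfun A f -> bmfun A (fun x => `|f x|).
Proof.
move=> [mf [B hB]]; split; last by exists B => x Ax; rewrite normr_id hB.
exact: measurableT_comp.
Qed.

Lemma bmfun_max A f g : bmfun A f -> bmfun A g -> bmfun A (fun x => Num.max (f x) (g x)).
Proof.
move=> [mf [B hB]] [mg [B' hB']]; split; first exact: measurable_maxr.
exists (Num.max B B') => x Ax; rewrite le_max.
by case: (leP (f x) (g x)) => _; rewrite ?hB ?hB' ?orbT.
Qed.

Lemma bmfun_sum A (I : Type) (s : seq I) (P : pred I) (F : I -> V -> R) :
  (forall i, bmfun A (F i)) -> bmfun A (fun x => \sum_(i <- s | P i) F i x).
Proof.
move=> hF; elim: s => [|i s IH].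
  by rewrite (_ : (fun _ => _) = fun=> 0); [exact: bmfun_cst|apply/funext => x; rewrite big_nil].
case Pi : (P i); last first.
  by rewrite (_ : (fun _ => _) = (fun x => \sum_(i <- s | P i) F i x))//;
     apply/funext => x; rewrite big_cons Pi.
rewrite (_ : (fun _ => _) = (fun x => F i x + \sum_(i <- s | P i) F i x)).
  exact: (bmfunD (hF i) IH).
by apply/funext => x; rewrite big_cons Pi.
Qed.

Lemma bmfunS A A' f : measurable (A' : set T) -> A `<=` A' -> bmfun A' f -> bmfun A f.
Proof.
move=> mA AA' [mf [B hB]]; split; last by exists B => x /AA'; exact: hB.
exact: measurable_funS mf.
Qed.

Lemma bmfun_eq A f g : (forall x, A x -> f x = g x) -> bmfun A f -> bmfun A g.
Proof.
move=> fg [mf [B hB]]; split; last by exists B => x Ax; rewrite -fg// hB.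
by move: mf; apply: eq_measurable_fun => x; rewrite inE; exact: fg.
Qed.

Lemma bmfun_integrable A f : measurable (A : set T) -> (H A < +oo)%E ->
  bmfun A f -> mu.-integrable (A : set T) (EFin \o f).
Proof.
move=> mA Aoo [mf [B hB]]; apply: measurable_bounded_integrable => //.
exists B; split; first exact: num_real.
by move=> M BM x /hB; move=> /le_trans; apply; exact: ltW.
Qed.

Lemma Rintegral_lipschitz (A B I : set V) (p q : V -> V) (g k : V -> R) (l : R) :
  measurable (A : set T) -> measurable (B : set T) ->
  (H A < +oo)%E -> (H B < +oo)%E -> bmfun A g -> bmfun B k ->
  (forall x, 0 <= g x) -> (forall x, 0 <= k x) -> 0 < l ->
  (forall x y, I x -> I y -> enorm (p x - p y) <= l * enorm (q x - q y)) ->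
  (forall y, A y -> 0 < g y -> exists2 x, I x & p x = y) ->
  (forall x, I x -> A (p x) -> 0 < g (p x) -> B (q x) /\ k (q x) = g (p x)) ->
  \int[mu]_(x in A) g x <= l ^+ n * \int[mu]_(x in B) k x.
Proof.
move=> mA mB Aoo Boo bg bk g0 k0 l0 h1 h2 h3.
have := integral_lipschitz_le mA mB Aoo Boo bg.1 bk.1 g0 k0 l0 h1 h2 h3.
rewrite -[X in (X <= _)%E]fineK; last first.
  by apply: integrable_fin_num => //; exact: bmfun_integrable.
rewrite -[X in (_ <= _ * X)%E]fineK; last first.
  by apply: integrable_fin_num => //; exact: bmfun_integrable.
by rewrite -EFinM lee_fin.
Qed.

Lemma lipschitz_within A f (B : R) :
  (forall x y, A x -> A y -> `|f x - f y| <= B * `|x - y|) ->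
  {within A, continuous f}.
Proof.
move=> lip; apply/subspace_continuousP => x Ax.
apply/(@cvgrPdist_lt _ _ _ (within A (nbhs x))) => e e0.
have B0 : 0 < `|B| + 1 by rewrite ltr_wpDl.
have xB : \forall y \near x, `|x - y| < e / (`|B| + 1).
  by apply/nbhs_ballP; exists (e / (`|B| + 1)); [exact: divr_gt0|rewrite -ball_normE].
have h : \forall y \near x, A y -> `|f x - f y| < e.
  near=> y => Ay; apply: le_lt_trans (lip _ _ Ax Ay) _.
  apply: (@le_lt_trans _ _ ((`|B| + 1) * `|x - y|)).
    by rewrite ler_wpM2r// (le_trans (ler_norm _))// lerDl.
  by rewrite mulrC -ltr_pdivlMr//; near: y.
exact: h.
Unshelve. all: by end_near. Qed.

Lemma lipschitz_bmfun A f (B b : R) : closed A ->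
  (forall x y, A x -> A y -> `|f x - f y| <= B * `|x - y|) ->
  (forall x, A x -> `|f x| <= b) -> bmfun A f.
Proof.
move=> cA lip fb; split; last by exists b.
by apply: within_measurable => //; exact: lipschitz_within lip.
Qed.

Lemma continuous_bmfun A f : compact A -> (forall x, A x -> {for x, continuous f}) ->
  bmfun A f.
Proof.
move=> cA cf.
have wc : {within A, continuous f}.
  by apply: continuous_in_subspaceT => x; rewrite inE => /cf.
split.
  apply: within_measurable => //; apply: compact_closed => //; exact: norm_hausdorff.
have := continuous_compact wc cA.
move=> /compact_bounded[B [_ hB]]; exists (B + 1) => x Ax.
by apply: (hB (B + 1)); [rewrite ltrDl|exists x].
Qed.

End BoundedMeasurable.

(** * Integration by parts in a patch *)

(** Turns the factor [l ^+ n] of a Lipschitz comparison into [1 + O(u)]. The base 3 is what the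
    induction consumes: [(1 + u) (1 + 3^n u)] is at most [1 + 3 * 3^n u]. *)
Lemma exprn_le_affine {R : realType} (u : R) n : 0 <= u -> u <= 1 ->
  (1 + u) ^+ n <= 1 + 3 ^+ n * u.
Proof.
move=> u0 u1; elim: n => [|n IH]; first by rewrite !expr0 mul1r lerDl.
have p1 : 1 <= 3 ^+ n :> R by rewrite exprn_ege1// ler1n.
rewrite !exprS; apply: (@le_trans _ _ ((1 + u) * (1 + 3 ^+ n * u))).
  by rewrite ler_wpM2l// addr_ge0.
have : u * (3 ^+ n * u) <= 3 ^+ n * u.
  by rewrite ler_piMl// mulr_ge0// (le_trans _ p1).
have : u <= 3 ^+ n * u by rewrite ler_peMl.
by rewrite mulrDl mul1r mulrDr mulr1 -mulrA; lra.
Qed.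

Section Shift.
Context {R : realType} {n : nat}.
Local Notation V := 'rV[R]_n.+1.
Local Notation H := (@hausdorff R n).
Local Notation T := (caratheodory_type H).
Local Notation mu := (@hmeasure R n).
Variables (M : set V) (nu : V -> V).
Hypotheses (hM : is_hypersurface M) (hnu : unit_normal_field M nu).
Local Notation cball z r := [set x : V | `|x - z| <= r].

Variables (z : V) (r C rho : R).
Hypotheses (Mz : M z) (patch : regular_patch M nu z r C) (C0 : 0 < C)
  (rho0 : 0 < rho) (rho3 : 3 * rho <= r) (Crho : 4 * n.+1%:R * C * rho <= 1).
(** Functions will be supported within [rho] of [z] and shifts move points by at most [rho]: radius
    [2 rho] contains the preimages of the support, and images of [A] stay within [3 rho <= r]. *)
Let A := M `&` cball z (2 * rho).
Let N := nu z.

Let Crho4 : C * rho <= 1 / 4.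
Proof.
have : C * rho <= n.+1%:R * (C * rho) by rewrite ler_peMl ?ler1n// mulr_ge0// ltW.
by move: Crho; rewrite -!mulrA; lra.
Qed.

Let rho2r : 2 * rho <= r. Proof. by move: rho3 rho0; lra. Qed.

(* The first-order effect of the correction [c] on [|x - y|] is a product of two
   factors [C rho] (chords are almost orthogonal to [N]) and [C h], hence the
   constant [1 + O(rho h)] instead of [1 + O(h)]. *)
Lemma shift_distortion (h : R) (u : V) (c : V -> R) : 0 < h -> h <= rho ->
  (forall x y, M x -> M y -> `|x - z| <= r -> `|y - z| <= r ->
       `|c x - c y| <= C * `|h| * `|x - y|) ->
  forall x y, A x -> A y -> let S x := x + (u + c x *: N) in
  let l := 1 + 10 * C ^+ 2 * rho * h in
  enorm (S x - S y) <= l * enorm (x - y) /\ enorm (x - y) <= l * enorm (S x - S y).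
Proof.
move=> h0 hrho hc x y [Mx xz] [My yz] S l; rewrite /= in xz yz.
have xr := le_trans xz rho2r; have yr := le_trans yz rho2r.
have Sxy : S x - S y = (x - y) + (c x - c y) *: N.
  by apply/rowP => j; rewrite !mxE; ring.
set d := c x - c y in Sxy *; set e := enorm (x - y).
have e0 : 0 <= e by exact: enorm_ge0.
have xye : `|x - y| <= e by exact: norm_le_enorm.
have dle : `|d| <= C * h * e.
  apply: le_trans (hc _ _ Mx My xr yr) _; rewrite gtr0_norm//.
  by rewrite ler_wpM2l// mulr_ge0// ltW.
have tle : `|dot (x - y) N| <= C * (2 * rho) * e.
  apply: le_trans (patch_flat patch rho2r Mx My xz yz) _.
  by rewrite ler_wpM2l// !mulr_ge0// ltW.
have E : enorm (S x - S y) ^+ 2 = e ^+ 2 + (2 * (d * dot (x - y) N) + d ^+ 2).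
  rewrite /e !sqr_enorm Sxy; move: (x - y) => w.
  rewrite dotDl !dotDr !dotZl !dotZr (dotC N) (dot_nu hnu Mz); ring.
(* Twice the cross term contributes 4 to the coefficient 5, and [d ^+ 2] contributes 1 because
   [h <= rho]. As [eta <= 1/2], the factor [1 + 2 eta] serves both directions:
   [(1 + 2 eta)^2 (1 - eta) >= 1]. *)
set eta := 5 * C ^+ 2 * rho * h.
have eta0 : 0 <= eta by rewrite /eta !mulr_ge0// ltW// exprn_gt0.
have eta1 : eta <= 1 / 2.
  apply: (@le_trans _ _ (5 * C ^+ 2 * rho * rho)).
    by rewrite /eta ler_wpM2l// !mulr_ge0// ltW// exprn_gt0.
  have -> : 5 * C ^+ 2 * rho * rho = 5 * (C * rho) ^+ 2 by ring.
  have : (C * rho) ^+ 2 <= (1 / 4) ^+ 2 by rewrite lerXn2r ?nnegrE ?mulr_ge0 ?(ltW C0) ?(ltW rho0).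
  rewrite [(1 / 4) ^+ 2]expr2; lra.
have t1 : `|d * dot (x - y) N| <= 2 * C ^+ 2 * rho * h * e ^+ 2.
  rewrite normrM; have -> : 2 * C ^+ 2 * rho * h * e ^+ 2 = (C * h * e) * (C * (2 * rho) * e) by ring.
  by rewrite ler_pM.
have t2 : d ^+ 2 <= C ^+ 2 * rho * h * e ^+ 2.
  rewrite -(real_normK (num_real d)).
  apply: (@le_trans _ _ ((C * h * e) ^+ 2)); first by rewrite lerXn2r ?nnegrE// (le_trans _ dle).
  have -> : (C * h * e) ^+ 2 = C ^+ 2 * h * h * e ^+ 2 by ring.
  rewrite ler_wpM2r ?sqr_ge0// ler_wpM2r ?(ltW h0)// ler_wpM2l ?sqr_ge0//.
have dev : `|enorm (S x - S y) ^+ 2 - e ^+ 2| <= eta * e ^+ 2.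
  rewrite E addrAC subrr add0r (le_trans (ler_normD _ _))//.
  rewrite normrM (ger0_norm (sqr_ge0 d)) ger0_norm//.
  have -> : eta * e ^+ 2 = 2 * (2 * C ^+ 2 * rho * h * e ^+ 2) + C ^+ 2 * rho * h * e ^+ 2.
    by rewrite /eta; ring.
  by rewrite lerD// ler_pM2l.
have lE : l = 1 + 2 * eta by rewrite /l /eta; ring.
have l0 : 0 <= l by rewrite lE addr_ge0// mulr_ge0.
set e' := enorm (S x - S y) in dev *.
have e'0 : 0 <= e' by exact: enorm_ge0.
move: dev; rewrite ler_norml => /andP[dev1 dev2].
have s0 : 0 <= e ^+ 2 by exact: sqr_ge0.
split; rewrite -(@ler_pXn2r _ 2)// ?nnegrE ?mulr_ge0// exprMn lE.
  apply: (@le_trans _ _ ((1 + eta) * e ^+ 2)); first by move: dev2; lra.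
  rewrite ler_wpM2r//; nra.
apply: (@le_trans _ _ ((1 + 2 * eta) ^+ 2 * ((1 - eta) * e ^+ 2))).
  rewrite mulrA ler_peMl//; nra.
by rewrite ler_wpM2l ?sqr_ge0//; move: dev1; lra.
Qed.

Lemma norm_delta_le1 (i : 'I_n.+1) : `|delta_mx 0 i : V| <= 1.
Proof.
by apply: norm_leP => // j; rewrite mxE eqxx /=; case: eqP; rewrite ?normr1 ?normr0.
Qed.

Let N1 : `|N| <= 1. Proof. exact: (norm_nu_le1 hnu Mz). Qed.

Lemma shift_close (i : 'I_n.+1) (h t : R) x : `|h| * (1 + C) <= rho -> `|t| <= C * `|h| ->
  `|(x + (h *: delta_mx 0 i + t *: N)) - x| <= rho.
Proof.
move=> hrho th; rewrite addrC addKr (le_trans (ler_normD _ _))// !normrZ.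
apply: le_trans hrho; rewrite mulrDr mulr1 (mulrC _ C) lerD//.
  by rewrite ler_piMr// norm_delta_le1.
by apply: le_trans th; rewrite ler_piMr.
Qed.

Section ShiftIntegral.
Variables (i : 'I_n.+1) (h : R) (c c' : V -> R).
Hypotheses (h0 : 0 < h) (hrho : h * (1 + C) <= rho).
Hypotheses (cM : forall x, M x -> `|x - z| <= r ->
       `|c x| <= C * `|h| /\ M (x + (h *: delta_mx 0 i + c x *: N)))
  (cL : forall x y, M x -> M y -> `|x - z| <= r -> `|y - z| <= r ->
       `|c x - c y| <= C * `|h| * `|x - y|)
  (c'M : forall x, M x -> `|x - z| <= r ->
       `|c' x| <= C * `|- h| /\ M (x + (- h *: delta_mx 0 i + c' x *: N))).
Let S x := x + (h *: delta_mx 0 i + c x *: N).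

Lemma shift_in x : A x -> M (S x) /\ `|S x - z| <= 3 * rho.
Proof.
move=> [Mx /= xz]; have [cx MS] := cM Mx (le_trans xz rho2r); split => //.
have -> : S x - z = (S x - x) + (x - z) by rewrite subrKA.
rewrite (le_trans (ler_normD _ _))//.
have -> : 3 * rho = rho + 2 * rho by ring.
by rewrite lerD// shift_close// gtr0_norm.
Qed.

(** Shift [y] back by [- h] with the correction [c']. Shifting forward again gives a point of [M]
    that differs from [y] by a multiple [d] of [N], and flatness yields [|d| <= 3/4 |d|], so
    [d = 0]. *)
Lemma shift_surj y : M y -> `|y - z| <= rho -> exists2 x, A x & S x = y.
Proof.
move=> My yz; have yr : `|y - z| <= r by move: rho2r rho0 yz; lra.
have [cy Mx] := c'M My yr; set x := y + _ in Mx.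
have Ax : A x.
  split => //=; have -> : x - z = (x - y) + (y - z) by rewrite subrKA.
  rewrite (le_trans (ler_normD _ _))//.
  have -> : 2 * rho = rho + rho by ring.
  by rewrite lerD// shift_close// normrN gtr0_norm.
exists x => //; have [MS Sz] := shift_in Ax.
pose d := c' y + c x.
have Sy : S x - y = d *: N.
  by apply/rowP => j; rewrite !mxE /d; ring.
apply/eqP; rewrite -subr_eq0 Sy scaler_eq0; apply/orP; left.
have y3 : `|y - z| <= 3 * rho by move: rho0 yz; lra.
have := patch_flat patch rho3 MS My Sz y3.
rewrite Sy dotZl (dot_nu hnu Mz) mulr1 => h1.
have : `|d| <= 3 / 4 * `|d|.
  apply: le_trans h1 _; rewrite normrZ.
  apply: (@le_trans _ _ (C * (3 * rho) * `|d|)).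
    by rewrite ler_wpM2l ?ler_piMr// !mulr_ge0// ltW.
  by rewrite ler_wpM2r//; move: Crho4; lra.
rewrite -normr_eq0 -[_ == 0]orFb => h2; apply/eqP; have := normr_ge0 d; lra.
Qed.

(** [Rintegral_lipschitz] for the pair [(id, S)] and then for [(S, id)]: each integral is at most
    [l^n] times the other. Surjectivity of [S] is needed only onto the support of [G]. *)
Lemma shift_integral (G : V -> R) : (forall x, 0 <= G x) ->
  (forall x, M x -> rho < `|x - z| -> G x = 0) ->
  bmfun A G -> bmfun A (G \o S) ->
  `|\int[mu]_(x in (A : set T)) (G \o S) x - \int[mu]_(x in (A : set T)) G x| <=
    3 ^+ n * (10 * C ^+ 2 * rho * h) * \int[mu]_(x in (A : set T)) G x.
Proof.
move=> G0 Gout bG bGS.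
have h_rho : h <= rho by apply: le_trans hrho; rewrite ler_peMr ?(ltW h0)// lerDl ltW.
have dist := @shift_distortion h (h *: delta_mx 0 i) c h0 h_rho cL.
set l := 1 + 10 * C ^+ 2 * rho * h in dist.
have cA : closed A.
  rewrite (_ : A = (M `&` cball z r) `&` cball z (2 * rho)).
    by apply: closedI; [exact: patch_closed patch|exact: closed_cball].
  by rewrite /A -setIA; congr (_ `&` _); rewrite setIidr// => x /= /le_trans; exact.
have mA : measurable (A : set T) by exact: closed_hausdorff_measurable.
have Aoo : (H A < +oo)%E.
  apply: le_lt_trans (patch_finite patch); apply: le_hausdorff => x [Mx /= xz].
  by split => //=; exact: le_trans rho2r.
have u0 : 0 <= 10 * C ^+ 2 * rho * h by rewrite !mulr_ge0// ltW// exprn_gt0.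
have l0 : 0 < l by rewrite /l ltr_pwDl.
have supp x : M x -> 0 < G x -> `|x - z| <= rho.
  by move=> Mx Gx; rewrite leNgt; apply/negP => /(Gout _ Mx) G0'; rewrite G0' ltxx in Gx.
have A_of y : M y -> `|y - z| <= rho -> A y.
  by move=> My yz; split => //=; move: rho0 yz; lra.
have b1 : \int[mu]_(x in (A : set T)) (G \o S) x <= l ^+ n * \int[mu]_(x in (A : set T)) G x.
  apply: (@Rintegral_lipschitz _ _ A A A id S) => //.
  - by move=> x /=; exact: G0.
  - by move=> x y Ax Ay; have [] := dist x y Ax Ay.
  - by move=> y Ay _; exists y.
  - move=> x Ax _ /= Gx; have [MS _] := shift_in Ax; split => //.
    by apply: A_of => //; exact: supp.
have b2 : \int[mu]_(x in (A : set T)) G x <= l ^+ n * \int[mu]_(x in (A : set T)) (G \o S) x.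
  apply: (@Rintegral_lipschitz _ _ A A A S id) => //.
  - by move=> x /=; exact: G0.
  - by move=> x y Ax Ay; have [] := dist x y Ax Ay.
  - by move=> y [My _] Gy; apply: shift_surj => //; exact: supp.
set a := \int[mu]_(x in _) G x in b1 b2 *; set b := \int[mu]_(x in _) (G \o S) x in b1 b2 *.
have a0 : 0 <= a by apply: Rintegral_ge0.
have b0 : 0 <= b by apply: Rintegral_ge0 => x _ /=; exact: G0.
have u1 : 10 * C ^+ 2 * rho * h <= 1.
  apply: (@le_trans _ _ (10 * (C * rho) ^+ 2)).
    have -> : 10 * (C * rho) ^+ 2 = 10 * C ^+ 2 * rho * rho by ring.
    by rewrite ler_wpM2l// !mulr_ge0// ltW// exprn_gt0.
  have : (C * rho) ^+ 2 <= (1 / 4) ^+ 2 by rewrite lerXn2r ?nnegrE ?mulr_ge0 ?(ltW C0) ?(ltW rho0).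
  rewrite [(1 / 4) ^+ 2]expr2; lra.
have := exprn_le_affine n u0 u1; rewrite -/l; set eps := 3 ^+ n * _ => leps.
have eps0 : 0 <= eps by rewrite mulr_ge0// exprn_ge0.
have b1' : b <= (1 + eps) * a by apply: le_trans b1 _; rewrite ler_wpM2r.
have b2' : a <= (1 + eps) * b by apply: le_trans b2 _; rewrite ler_wpM2r.
rewrite ler_norml; apply/andP; split; last by move: b1'; lra.
have [ba|ab] := leP b a; last by have := mulr_ge0 eps0 a0; move: ab; lra.
have : eps * b <= eps * a by rewrite ler_wpM2l.
by move: b2'; lra.
Qed.

End ShiftIntegral.
End Shift.

Section PatchDerivative.
Context {R : realType} {n : nat}.
Local Notation V := 'rV[R]_n.+1.
Local Notation H := (@hausdorff R n).
Local Notation T := (caratheodory_type H).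
Local Notation mu := (@hmeasure R n).
Variables (M : set V) (nu : V -> V).
Hypotheses (hM : is_hypersurface M) (hnu : unit_normal_field M nu).
Local Notation cball z r := [set x : V | `|x - z| <= r].

(* The projection of [e_i] along [N] onto the tangent space at [x]; for [N = nu x]
   it is the orthogonal projection. *)
Definition oblique (N : V) (x : V) (i : 'I_n.+1) : V :=
  delta_mx 0 i - (nu x 0 i / dot (nu x) N) *: N.

(** No convergence of [t] is assumed. The points stay on [M], so by [tangent_limit] the direction
    [e_i + t k N] becomes orthogonal to [nu x], which determines the limit of [t]. *)
Lemma shift_quotient_cvg (N : V) (x : V) (i : 'I_n.+1) (g : V -> R)
    (h t : nat -> R) (C : R) : M x -> differentiable g x -> dot (nu x) N != 0 ->
  (forall k, h k != 0) -> h @ \oo --> (0 : R) ->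
  `|N| <= 1 -> (forall k, `|t k| <= C) ->
  (forall k, M (x + (h k *: delta_mx 0 i + (h k * t k) *: N))) ->
  (fun k => (g (x + (h k *: delta_mx 0 i + (h k * t k) *: N)) - g x) / h k) @ \oo
    --> dot (grad g x) (oblique N x i).
Proof.
move=> Mx dg k0 h0 hcvg N1 tC MS.
pose u k : V := delta_mx 0 i + t k *: N.
have SE k : x + (h k *: delta_mx 0 i + (h k * t k) *: N) = x + h k *: u k.
  by rewrite /u scalerDr scalerA.
have uC k : `|u k| <= 1 + C.
  rewrite (le_trans (ler_normD _ _))// lerD ?norm_delta_le1// normrZ.
  by apply: le_trans (tC k); rewrite ler_piMr.
have C0 : 0 <= C by apply: le_trans (tC 0%N).
have Mu k : M (x + h k *: u k) by rewrite -SE.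
have := tangent_limit hM hnu Mx h0 hcvg uC Mu.
set ka := dot (nu x) N in k0 *.
have -> : (fun k => dot (nu x) (u k)) = (fun k => nu x 0 i + t k * ka).
  by apply/funext => k; rewrite /u dotDr dot_delta dotZr.
move=> tl.
have tcvg : t @ \oo --> - (nu x 0 i / ka).
  have : (fun k => ka^-1 * (nu x 0 i + t k * ka) - nu x 0 i / ka) @ \oo --> ka^-1 * 0 - nu x 0 i / ka.
    by apply: cvgB; [apply: cvgM => //; exact: cvg_cst|exact: cvg_cst].
  rewrite mulr0 sub0r; apply: cvg_trans; apply: near_eq_cvg; near=> k.
  by field.
have dcvg : (fun k => dot (grad g x) (u k)) @ \oo --> dot (grad g x) (oblique N x i).
  have -> : dot (grad g x) (oblique N x i) = grad g x 0 i + - (nu x 0 i / ka) * dot (grad g x) N.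
    by rewrite /oblique dotBr dot_delta dotZr mulNr.
  have -> : (fun k => dot (grad g x) (u k)) = (fun k => grad g x 0 i + t k * dot (grad g x) N).
    by apply/funext => k; rewrite /u dotDr dot_delta dotZr.
  by apply: cvgD; [exact: cvg_cst|apply: cvgM => //; exact: cvg_cst].
rewrite -[X in _ --> X]addr0.
have -> : (fun k => (g (x + (h k *: delta_mx 0 i + (h k * t k) *: N)) - g x) / h k) =
  (fun k => dot (grad g x) (u k) + ((g (x + h k *: u k) - g x) / h k - dot (grad g x) (u k))).
  by apply/funext => k; rewrite SE [RHS]addrC subrK.
apply: cvgD => //; apply/cvgrPdist_lt => e e0.
have C10 : 0 < 1 + C by rewrite ltr_pwDl.
have [d d0 hd] := @diff_eps _ _ g x (e / (2 * (1 + C))) dg (divr_gt0 e0 (mulr_gt0 (ltr0Sn _ 1) C10)).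
have hk : \forall k \near \oo, `|h k| < d / (1 + C).
  have /cvgrPdist_lt/(_ _ (divr_gt0 d0 C10)) := hcvg.
  by apply: filterS => k; rewrite sub0r normrN.
near=> k; rewrite sub0r normrN.
have hpos : 0 < `|h k| by rewrite normr_gt0.
have wd : `|h k *: u k| < d.
  rewrite normrZ; apply: (@le_lt_trans _ _ (`|h k| * (1 + C))); first by rewrite ler_wpM2l.
  by rewrite -ltr_pdivlMr//; near: k.
have := hd _ wd; rewrite dotZr normrZ => le1.
rewrite -(ltr_pM2l hpos) -normrM mulrBr mulrCA mulfV// mulr1.
apply: le_lt_trans le1 _; rewrite mulrCA ltr_pM2l//.
apply: (@le_lt_trans _ _ (e / (2 * (1 + C)) * (1 + C))).
  by rewrite ler_wpM2l// divr_ge0 ?mulr_ge0// ltW.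
have -> : e / (2 * (1 + C)) * (1 + C) = e / 2 by field; rewrite gt_eqF.
by rewrite ltr_pdivrMr// ltr_pMr// ltr1n.
Unshelve. all: by end_near. Qed.

End PatchDerivative.

Lemma cvg_norm_le {R : realType} (u : nat -> R) (l b : R) :
  u @ \oo --> l -> (forall k, `|u k| <= b) -> `|l| <= b.
Proof.
move=> ul ub; apply/ler_addgt0Pr => e e0.
have /cvgrPdist_lt/(_ e e0)/filter_ex[k /ltW lk] := ul.
by rewrite -[l](subrK (u k)) addrC (le_trans (ler_normD _ _))// lerD.
Qed.

Section PatchIntegral.
Context {R : realType} {n : nat}.
Local Notation V := 'rV[R]_n.+1.
Local Notation H := (@hausdorff R n).
Local Notation T := (caratheodory_type H).
Local Notation mu := (@hmeasure R n).
Variables (M : set V) (nu : V -> V).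
Hypotheses (hM : is_hypersurface M) (hnu : unit_normal_field M nu).
Local Notation cball z r := [set x : V | `|x - z| <= r].

(** [D] is the limit of the shift quotients [q k]. In their integrals the factor [h] of
    [shift_integral] cancels the division by [h], and the Lipschitz bound on [g] dominates them. *)
Lemma patch_derivative (z : V) (r C rho B : R) (i : 'I_n.+1) (g : V -> R) :
  M z -> regular_patch M nu z r C -> 0 < C -> 0 < rho -> 3 * rho <= r ->
  4 * n.+1%:R * C * rho <= 1 -> 0 <= B ->
  (forall x, M x -> `|x - z| <= r -> differentiable g x) ->
  (forall x y, M x -> M y -> `|x - z| <= r -> `|y - z| <= r ->
     `|g x - g y| <= B * `|x - y|) ->
  (forall x, M x -> rho < `|x - z| -> g x = 0) ->
  let A := M `&` cball z (2 * rho) in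
  let D x := dot (grad g x) (oblique nu (nu z) x i) in
  bmfun A D /\
  `|\int[mu]_(x in (A : set T)) D x| <=
    3 ^+ n * (10 * C ^+ 2 * rho) * \int[mu]_(x in (A : set T)) `|g x|.
Proof.
move=> Mz patch C0 rho0 rho3 Crho B0 dg lipg gout A D; pose N := nu z.
have N1 : `|N| <= 1 by exact: norm_nu_le1 hnu _ Mz.
have rho2r : 2 * rho <= r by move: rho3 rho0; lra.
have rhor : rho <= r by move: rho3 rho0; lra.
have cA : closed A.
  rewrite (_ : A = (M `&` cball z r) `&` cball z (2 * rho)).
    by apply: closedI; [exact: patch_closed patch|exact: closed_cball].
  by rewrite /A -setIA; congr (_ `&` _); rewrite setIidr// => x /= /le_trans; exact.
have mA : measurable (A : set T) by exact: closed_hausdorff_measurable.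
have Aoo : (H A < +oo)%E.
  apply: le_lt_trans (patch_finite patch); apply: le_hausdorff => x [Mx /= xz].
  by split => //=; exact: le_trans rho2r.
have intA f : bmfun A f -> mu.-integrable (A : set T) (EFin \o f).
  by move=> bf; exact: bmfun_integrable.
have C10 : 0 < 1 + C by rewrite addr_gt0.
pose h k : R := rho / (1 + C) / k.+1%:R.
have h0 k : 0 < h k by rewrite !divr_gt0.
have hrho k : h k * (1 + C) <= rho.
  rewrite /h mulrAC divfK ?gt_eqF// ler_pdivrMr// ler_peMr ?(ltW rho0)// ler1n//.
have hr k : `|h k| <= r.
  rewrite gtr0_norm//; apply: le_trans rhor; apply: le_trans (hrho k).
  by rewrite ler_peMr ?(ltW (h0 k))// lerDl ltW.
have hr' k : `|- h k| <= r by rewrite normrN.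
have [c hc] := choice (fun k => patch_shift patch i (hr k)).
have [c' hc'] := choice (fun k => patch_shift patch i (hr' k)).
pose S k x := x + (h k *: delta_mx 0 i + c k x *: N).
have Sin k x : A x -> M (S k x) /\ `|S k x - z| <= 3 * rho.
  by move=> Ax; apply: (shift_in hnu Mz rho0 rho3 (h0 k) (hrho k) (hc k).1 Ax).
have SL k x y : A x -> A y -> `|S k x - S k y| <= (1 + C * r) * `|x - y|.
  move=> [Mx /= xz] [My /= yz].
  have -> : S k x - S k y = (x - y) + (c k x - c k y) *: N.
    by apply/rowP => j; rewrite !mxE; ring.
  rewrite mulrDl mul1r (le_trans (ler_normD _ _))// lerD// normrZ.
  apply: (@le_trans _ _ `|c k x - c k y|); first by rewrite ler_piMr.
  apply: le_trans ((hc k).2 x y Mx My (le_trans xz rho2r) (le_trans yz rho2r)) _.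
  by rewrite ler_wpM2r// ler_wpM2l// ltW.
have gb x : M x -> `|x - z| <= r -> `|g x| <= `|g z| + B * r.
  move=> Mx xz; rewrite -[g x](subrK (g z)) addrC (le_trans (ler_normD _ _))// lerD//.
  have zz : `|z - z| <= r by rewrite subrr normr0; exact: ltW (lt_le_trans rho0 rhor).
  by apply: le_trans (lipg _ _ Mx Mz xz zz) _; rewrite ler_wpM2l.
have bg : bmfun A g.
  apply: (@lipschitz_bmfun _ _ A g B (`|g z| + B * r)) => //.
    by move=> x y [Mx /= xz] [My /= yz]; apply: lipg => //; exact: le_trans rho2r.
  by move=> x [Mx /= xz]; apply: gb => //; exact: le_trans rho2r.
have bgS k : bmfun A (g \o S k).
  apply: (@lipschitz_bmfun _ _ A _ (B * (1 + C * r)) (`|g z| + B * r)) => //.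
    move=> x y Ax Ay /=; have [MSx Sx] := Sin k x Ax; have [MSy Sy] := Sin k y Ay.
    apply: le_trans (lipg _ _ MSx MSy (le_trans Sx rho3) (le_trans Sy rho3)) _.
    by rewrite -mulrA ler_wpM2l// SL.
  by move=> x Ax; have [MSx Sx] := Sin k x Ax; apply: gb => //; exact: le_trans Sx rho3.
(* [shift_integral] concerns nonnegative functions, so the two parts are shifted separately; only
   their values enter, so the kinks at zeros of [g] do no harm. *)
pose gp x := Num.max (g x) 0; pose gn x := Num.max (- g x) 0.
have gpn x : g x = gp x - gn x.
  rewrite /gp /gn; have [g0|/ltW g0] := lerP 0 (g x).
    by rewrite max_r ?oppr_le0// subr0.
  by rewrite max_l ?oppr_ge0// sub0r opprK.
have gabs x : `|g x| = gp x + gn x.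
  rewrite /gp /gn; have [g0|/ltW g0] := lerP 0 (g x).
    by rewrite max_r ?oppr_le0// addr0 ger0_norm.
  by rewrite max_l ?oppr_ge0// add0r ler0_norm.
have gp0 x : 0 <= gp x by rewrite le_max lexx orbT.
have gn0 x : 0 <= gn x by rewrite le_max lexx orbT.
have bgp : bmfun A gp by exact: bmfun_max bg (bmfun_cst _ 0).
have bgn : bmfun A gn by exact: bmfun_max (bmfunN bg) (bmfun_cst _ 0).
have bgpS k : bmfun A (gp \o S k) by exact: bmfun_max (bgS k) (bmfun_cst _ 0).
have bgnS k : bmfun A (gn \o S k) by exact: bmfun_max (bmfunN (bgS k)) (bmfun_cst _ 0).
have gpout x : M x -> rho < `|x - z| -> gp x = 0.
  by move=> Mx /(gout _ Mx); rewrite /gp => ->; rewrite maxxx.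
have gnout x : M x -> rho < `|x - z| -> gn x = 0.
  by move=> Mx /(gout _ Mx); rewrite /gn => ->; rewrite oppr0 maxxx.
pose K : R := 3 ^+ n * (10 * C ^+ 2 * rho).
have Sint k G : (forall x, 0 <= G x) -> (forall x, M x -> rho < `|x - z| -> G x = 0) ->
    bmfun A G -> bmfun A (G \o S k) ->
    `|\int[mu]_(x in (A : set T)) (G \o S k) x - \int[mu]_(x in (A : set T)) G x| <=
    K * h k * \int[mu]_(x in (A : set T)) G x.
  move=> G0 Gout bG bGS.
  have -> : K * h k = 3 ^+ n * (10 * C ^+ 2 * rho * h k) by rewrite /K !mulrA.
  exact: (shift_integral hnu Mz patch C0 rho0 rho3 Crho (h0 k) (hrho k) (hc k).1 (hc k).2 (hc' k).1 G0 Gout bG bGS).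
pose q k x := (g (S k x) - g x) / h k.
have bq k : bmfun A (q k) by exact: bmfunM (bmfunB (bgS k) bg) (bmfun_cst _ _).
have Iq k : `|\int[mu]_(x in (A : set T)) q k x| <= K * \int[mu]_(x in (A : set T)) `|g x|.
  have -> : \int[mu]_(x in (A : set T)) `|g x| =
     \int[mu]_(x in (A : set T)) gp x + \int[mu]_(x in (A : set T)) gn x.
    by rewrite -RintegralD//; [apply: eq_Rintegral => x _|exact: intA|exact: intA].
  have -> : \int[mu]_(x in (A : set T)) q k x =
     ((\int[mu]_(x in (A : set T)) (gp \o S k) x - \int[mu]_(x in (A : set T)) gp x) -
     (\int[mu]_(x in (A : set T)) (gn \o S k) x - \int[mu]_(x in (A : set T)) gn x)) / h k.
    have bp : bmfun A (fun x => (gp \o S k) x - gp x) by exact: (bmfunB (bgpS k) bgp).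
    have bn : bmfun A (fun x => (gn \o S k) x - gn x) by exact: (bmfunB (bgnS k) bgn).
    rewrite -(RintegralB mA (intA _ (bgpS k)) (intA _ bgp)).
    rewrite -(RintegralB mA (intA _ (bgnS k)) (intA _ bgn)).
    rewrite -(RintegralB mA (intA _ bp) (intA _ bn)).
    rewrite mulrC -(RintegralZl _ mA (intA _ (bmfunB bp bn))).
    by apply: eq_Rintegral => x _; rewrite /q !gpn /=; ring.
  rewrite normrM normfV (gtr0_norm (h0 k)) ler_pdivrMr//.
  apply: le_trans (ler_normB _ _) _.
  have := Sint k gp gp0 gpout bgp (bgpS k); have := Sint k gn gn0 gnout bgn (bgnS k).
  lra.
have qD x : A x -> (fun k => q k x) @ \oo --> D x.
  move=> Ax; have [Mx /= xz] := Ax.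
  have xr := le_trans xz rho2r.
  have ka0 : dot (nu x) N != 0.
    have : `|dot (nu x - N) N| <= 1 / 2.
      apply: le_trans (dot_le_norm _ _) _.
      apply: (@le_trans _ _ (n.+1%:R * (C * (2 * rho)) * 1)).
        rewrite ler_pM// ?mulr_ge0// ler_wpM2l//.
        apply: le_trans (patch_normal patch xr).1 _.
        by rewrite ler_wpM2l// ltW.
      by move: Crho; rewrite -!mulrA; lra.
    rewrite dotBl (dot_nu hnu Mz) ler_norml => /andP[h1 _].
    by rewrite gt_eqF//; move: h1; lra.
  pose t k := c k x / h k.
  have ct k : c k x = h k * t k by rewrite /t mulrC divfK// gt_eqF.
  have -> : (fun k => q k x) = (fun k => (g (x + (h k *: delta_mx 0 i + (h k * t k) *: N)) - g x) / h k).
    by apply/funext => k; rewrite -ct.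
  apply: (@shift_quotient_cvg _ _ M nu hM hnu N x i g h t C) => //.
  - exact: dg.
  - by move=> k; rewrite gt_eqF.
  - have -> : h = (fun k => rho / (1 + C) * harmonic k) by [].
    rewrite -[X in _ --> X](mulr0 (rho / (1 + C))).
    by apply: cvgM; [exact: cvg_cst|exact: cvg_harmonic].
  - move=> k; rewrite /t normrM normfV ler_pdivrMr ?normr_gt0 ?gt_eqF//.
    by have [] := (hc k).1 x Mx xr.
  - by move=> k; rewrite -ct; have [] := (hc k).1 x Mx xr.
have qb k x : A x -> `|q k x| <= B * (1 + C).
  move=> Ax; have [Mx /= xz] := Ax; have xr := le_trans xz rho2r.
  have [MSx Sx] := Sin k x Ax.
  rewrite /q normrM normfV (gtr0_norm (h0 k)) ler_pdivrMr//.
  apply: le_trans (lipg _ _ MSx Mx (le_trans Sx rho3) xr) _.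
  rewrite -mulrA ler_wpM2l// /S (addrC x) addrK (le_trans (ler_normD _ _))// (normrZ (h k)) (normrZ (c k x)).
  have [cx _] := (hc k).1 x Mx xr.
  rewrite mulrDl mul1r (gtr0_norm (h0 k)) lerD//.
    by rewrite ler_piMr ?norm_delta_le1// ltW.
  by rewrite (gtr0_norm (h0 k)) in cx; apply: le_trans cx; rewrite ler_piMr.
(* [g] is only assumed differentiable, so measurability of [D] comes from the pointwise limit. *)
have bD : bmfun A D.
  split.
    apply: (@measurable_fun_cvg _ T R A (fun k => q k)) => [k|x Ax].
      exact: (bq k).1.
    exact: qD.
  exists (B * (1 + C)) => x Ax.
  by apply: cvg_norm_le (qD x Ax) _ => k; exact: qb.
split => //.
have [] := @dominated_convergence _ T R mu A mA (fun k => EFin \o q k) (EFin \o D) (cst (B * (1 + C))%:E).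
- by move=> k; apply/measurable_EFinP; exact: (bq k).1.
- by apply/measurable_EFinP; exact: bD.1.
- by apply: aeW => x Ax; apply: cvg_EFin; [exact: nearW|exact: qD].
- exact: (intA _ (bmfun_cst _ _)).
- by apply: aeW => x k Ax; rewrite lee_fin qb.
move=> intD _ qcvg; apply: (@cvg_norm_le _ (fun k => \int[mu]_(x in (A : set T)) q k x)) => //.
apply: fine_cvg; rewrite fineK; last exact: integrable_fin_num.
exact: qcvg.
Qed.

End PatchIntegral.

(** * The divergence theorem *)

Section Tangential.
Context {R : realType} {n : nat}.
Local Notation V := 'rV[R]_n.+1.
Local Notation H := (@hausdorff R n).
Local Notation T := (caratheodory_type H).
Local Notation mu := (@hmeasure R n).
Local Notation cball z r := [set x : V | `|x - z| <= r].

Lemma cball_compact (z : V) (r : R) : compact (cball z r).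
Proof.
apply: bounded_closed_compact; last exact: closed_cball.
exists (`|z| + r); split; first exact: num_real.
move=> m hm x /= xz; apply: ltW; apply: le_lt_trans hm.
by rewrite -[x](subrK z) addrC (le_trans (ler_normD _ _))// lerD.
Qed.

Lemma C1at_lipschitz_cball (f : V -> R) (z : V) (r : R) :
  (forall x, `|x - z| <= r -> C1at f x) ->
  exists2 B : R, 0 <= B & forall x y, `|x - z| <= r -> `|y - z| <= r ->
    `|f x - f y| <= B * `|x - y|.
Proof.
move=> cf; have bd i : exists B : R, forall x, `|x - z| <= r -> `|partial f i x| <= B.
  have [_ [B hB]] : bmfun (cball z r) (partial f i).
    by apply: continuous_bmfun => [|x /cf[_]]; [exact: cball_compact|exact].
  by exists B.
have [B hB] := choice bd; exists (n.+1%:R * \sum_i `|B i|).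
  by rewrite mulr_ge0// sumr_ge0.
move=> x y xz yz.
have seg (s : R) : 0 <= s <= 1 -> `|y + s *: (x - y) - z| <= r.
  by move=> s01; rewrite (le_trans (segment_le_max _ _ _ s01))// ge_max yz.
have [|s s01 ->] := @mvt_segment _ _ f y x.
  by move=> s /seg/cf/C1at_differentiable.
apply: le_trans (dot_le_norm _ _) _; rewrite ler_wpM2r// ler_wpM2l//.
apply: norm_leP => [|i]; first exact: sumr_ge0.
rewrite mxE (bigD1 i)//= -[leLHS]addr0 lerD ?sumr_ge0//.
by apply: le_trans (hB i _ (seg _ s01)) _; exact: ler_norm.
Qed.

Variables (M : set V) (nu : V -> V).
Hypotheses (hM : is_hypersurface M) (hnu : unit_normal_field M nu).

(** [g] vanishes on [M] only, so its gradient may have a normal part. The shift quotients at [x]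
    compare points of [M] and are eventually 0, while [shift_quotient_cvg] identifies their
    limit. *)
Lemma vanishing_oblique (g : V -> R) (x : V) (e : R) i : M x -> 0 < e ->
  (forall y, M y -> `|y - x| < e -> g y = 0) -> differentiable g x ->
  dot (grad g x) (oblique nu (nu x) x i) = 0.
Proof.
move=> Mx e0 gz dg; have [r [C [r0 C0 hp]]] := local_patch hM hnu Mx.
have xx : `|x - x| < r by rewrite subrr normr0.
have patch := hp x Mx xx.
pose h k : R := r * harmonic k.
have hk0 k : 0 < h k by rewrite mulr_gt0// harmonic_gt0.
have hr k : `|h k| <= r.
  by rewrite gtr0_norm// ler_piMr ?(ltW r0)// /harmonic invf_le1 ?ler1n.
have [c hc] := choice (fun k => patch_shift patch i (hr k)).
have cM k := (hc k).1 x Mx (ltW xx).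
pose t k := c k x / h k.
have ct k : h k * t k = c k x by rewrite /t mulrC divfK// gt_eqF.
have hcvg : h @ \oo --> (0 : R).
  rewrite -[X in _ --> X](mulr0 r).
  by apply: cvgM; [exact: cvg_cst|exact: cvg_harmonic].
have ka : dot (nu x) (nu x) != 0 by rewrite (dot_nu hnu Mx) oner_eq0.
have tC k : `|t k| <= C.
  by rewrite /t normrM normfV ler_pdivrMr ?normr_gt0 ?gt_eqF//; have [] := cM k.
have MS k : M (x + (h k *: delta_mx 0 i + (h k * t k) *: nu x)).
  by rewrite ct; have [] := cM k.
have hk0' k : h k != 0 by rewrite gt_eqF.
have := @shift_quotient_cvg _ _ M nu hM hnu (nu x) x i g h t C Mx dg ka hk0' hcvg (norm_nu_le1 hnu Mx) tC MS.
move=> lim1; have lim0 : (fun k => (g (x + (h k *: delta_mx 0 i + (h k * t k) *: nu x)) - g x) / h k) @ \oo --> (0 : R).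
  have : cst (0 : R) @ \oo --> (0 : R) by exact: cvg_cst.
  apply: cvg_trans; apply: near_eq_cvg.
  have C10 : 0 < 1 + C by rewrite addr_gt0.
  have hsmall : \forall k \near \oo, `|h k| < e / (1 + C).
    have /cvgrPdist_lt/(_ _ (divr_gt0 e0 C10)) := hcvg.
    by apply: filterS => k; rewrite sub0r normrN.
  near=> k; rewrite (gz x Mx) ?subrr ?normr0// (gz _ (MS k)) ?subrr ?mul0r//.
  rewrite addrC addKr (le_lt_trans (ler_normD _ _))// (normrZ (h k)) (normrZ (h k * t k)) (normrM (h k) (t k)) -mulrA.
  apply: (@le_lt_trans _ _ (`|h k| * (1 + C))).
    rewrite mulrDr mulr1 lerD// ?ler_piMr ?norm_delta_le1// ler_wpM2l//.
    by apply: le_trans (tC k); rewrite ler_piMr ?(norm_nu_le1 hnu Mx).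
  by rewrite -ltr_pdivlMr//; near: k.
exact: (cvg_unique _ lim1 lim0).
Unshelve. all: by end_near. Qed.

(** By [vanishing_oblique] for all [i], the gradient is a multiple of [nu x]. *)
Lemma vanishing_tangent (g : V -> R) (x t : V) (e : R) : M x -> 0 < e ->
  (forall y, M y -> `|y - x| < e -> g y = 0) -> differentiable g x ->
  dot (nu x) t = 0 -> dot (grad g x) t = 0.
Proof.
move=> Mx e0 gz dg nt.
have h i := @vanishing_oblique g x e i Mx e0 gz dg.
have hi i : grad g x 0 i = nu x 0 i * dot (grad g x) (nu x).
  have := h i; rewrite /oblique (dot_nu hnu Mx) divr1 dotBr dot_delta dotZr.
  by move/eqP; rewrite subr_eq0 => /eqP.
have -> : dot (grad g x) t = dot (grad g x) (nu x) * dot (nu x) t.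
  by rewrite {1}/dot [dot (nu x) t]/dot mulr_sumr; apply: eq_bigr => i _; rewrite hi; ring.
by rewrite nt mulr0.
Qed.

(** On [M] this is the sum of the [delta_i Y^i], as in the definition of [H]. Writing it with
    [oblique] prepares the comparison with a fixed direction [N] in a patch. *)
Definition tdiv (Y : V -> V) (x : V) : R :=
  \sum_i dot (grad (fun y => Y y 0 i) x) (oblique nu (nu x) x i).

Lemma tdivE Y x : M x -> tdiv Y x = \sum_i \sum_j partial (fun y => Y y 0 i) j x *
   ((j == i)%:R - nu x 0 i * nu x 0 j).
Proof.
move=> Mx; apply: eq_bigr => i _; apply: eq_bigr => j _; rewrite !mxE eqxx /=.
by rewrite (dot_nu hnu Mx) divr1.
Qed.

Lemma nu_C1at : exists W, [/\ open W, M `<=` W &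
  forall i x, W x -> C1at (fun y => nu y 0 i) x].
Proof.
have [[W [oW [MW h]]] _] := hnu; exists W; split => // i x Wx.
exact: (Ck_C1at oW (h i 1%N)).
Qed.

Lemma nu_bmfun (K : set V) i : compact K -> K `<=` M -> bmfun K (fun x => nu x 0 i).
Proof.
move=> cK KM; have [W [_ MW h]] := nu_C1at.
by apply: continuous_bmfun => // x /KM/MW Wx; exact: C1at_continuous (h i x Wx).
Qed.

Lemma tdiv_bmfun (K : set V) (Y : V -> V) : compact K -> K `<=` M ->
  (forall i x, K x -> C1at (fun y => Y y 0 i) x) -> bmfun K (tdiv Y).
Proof.
move=> cK KM CY.
apply: (@bmfun_eq _ _ K (fun x => \sum_i \sum_j partial (fun y => Y y 0 i) j x *
   ((j == i)%:R - nu x 0 i * nu x 0 j))) => [x /KM Mx|]; first by rewrite tdivE.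
apply: bmfun_sum => i; apply: bmfun_sum => j; apply: bmfunM.
  by apply: continuous_bmfun => // x /(CY i)[_]; exact.
apply: bmfunB; first exact: bmfun_cst.
by apply: bmfunM; exact: nu_bmfun.
Qed.

End Tangential.

Section FiniteSums.
Context {R : realType} {n : nat}.
Local Notation V := 'rV[R]_n.+1.
Local Notation H := (@hausdorff R n).
Local Notation T := (caratheodory_type H).
Local Notation mu := (@hmeasure R n).
Variables (I : Type) (s : seq I) (F : I -> V -> R).

Lemma derive_sumf (x v : V) : (forall i, differentiable (F i) x) ->
  differentiable (fun y => \sum_(i <- s) F i y) x /\
  'D_v (fun y => \sum_(i <- s) F i y) x = \sum_(i <- s) 'D_v (F i) x.
Proof.
move=> dF; elim: s => [|i l [IH1 IH2]].
  rewrite (_ : (fun y => _) = cst 0); last by apply/funext => y; rewrite big_nil.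
  by rewrite big_nil derive_cst; split => //; exact: differentiable_cst.
rewrite (_ : (fun y => _) = F i + (fun y => \sum_(i <- l) F i y)); last first.
  by apply/funext => y; rewrite big_cons.
split; first exact: differentiableD.
by rewrite deriveD ?IH2 ?big_cons//; exact: diff_derivable.
Qed.

Lemma C1at_sum (x : V) : (forall i, C1at (F i) x) ->
  C1at (fun y => \sum_(i <- s) F i y) x.
Proof.
move=> dF; elim: s => [|i l IH].
  rewrite (_ : (fun y => _) = fun=> 0); last by apply/funext => y; rewrite big_nil.
  exact: C1at_cst.
rewrite (_ : (fun y => _) = fun y => F i y + \sum_(i <- l) F i y); last first.
  by apply/funext => y; rewrite big_cons.
exact: (C1atD (dF i) IH).
Qed.

Lemma C1at_prod (x : V) : (forall i, C1at (F i) x) ->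
  C1at (fun y => \prod_(i <- s) F i y) x.
Proof.
move=> dF; elim: s => [|i l IH].
  rewrite (_ : (fun y => _) = fun=> 1); last by apply/funext => y; rewrite big_nil.
  exact: C1at_cst.
rewrite (_ : (fun y => _) = fun y => F i y * \prod_(i <- l) F i y); last first.
  by apply/funext => y; rewrite big_cons.
exact: (C1atM (dF i) IH).
Qed.

Lemma Rintegral_sum (A : set V) : measurable (A : set T) -> (H A < +oo)%E ->
  (forall i, bmfun A (F i)) ->
  \int[mu]_(x in (A : set T)) (\sum_(i <- s) F i x) =
  \sum_(i <- s) \int[mu]_(x in (A : set T)) F i x.
Proof.
move=> mA Aoo bF; elim: s => [|i l IH].
  rewrite big_nil (_ : (fun y => _) = fun=> 0); last by apply/funext => y; rewrite big_nil.
  by rewrite Rintegral_cst// mul0r.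
rewrite big_cons -IH -RintegralD//.
- by apply: eq_Rintegral => x _; rewrite big_cons.
- exact: (bmfun_integrable mA Aoo (bF i)).
- exact: (bmfun_integrable mA Aoo (bmfun_sum l xpredT bF)).
Qed.

End FiniteSums.

Section PatchDivergence.
Context {R : realType} {n : nat}.
Local Notation V := 'rV[R]_n.+1.
Local Notation H := (@hausdorff R n).
Local Notation T := (caratheodory_type H).
Local Notation mu := (@hmeasure R n).
Local Notation cball z r := [set x : V | `|x - z| <= r].
Variables (M : set V) (nu : V -> V).
Hypotheses (hM : is_hypersurface M) (hnu : unit_normal_field M nu).

(* The oblique projections of the two normals differ by [nu_i] times the tangent
   vector [t = nu - N / (nu . N)]; since [nu . G = 0] on [M], the derivative along
   [t] falls on [nu] instead of on [G]. *)
Lemma tdiv_oblique (N : V) (G : V -> V) (x : V) : M x -> dot (nu x) N != 0 ->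
  (forall i, differentiable (fun y => G y 0 i) x) ->
  (forall y, M y -> dot (nu y) (G y) = 0) ->
  let t := nu x - (dot (nu x) N)^-1 *: N in
  tdiv nu G x - \sum_i dot (grad (fun y => G y 0 i) x) (oblique nu N x i) =
  \sum_i G x 0 i * dot (grad (fun y => nu y 0 i) x) t.
Proof.
move=> Mx; set ka := dot (nu x) N => ka0 dG nG t.
have nt : dot (nu x) t = 0.
  by rewrite dotBr dotZr (dot_nu hnu Mx) mulVf// subrr.
have [W [_ MW Cnu]] := nu_C1at hnu.
have dn i : differentiable (fun y => nu y 0 i) x.
  exact: C1at_differentiable (Cnu i x (MW _ Mx)).
have dnG i : differentiable (fun y => nu y 0 i * G y 0 i) x by exact: differentiableM.
have [dP DP] := derive_sumf (index_enum 'I_n.+1) t dnG.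
have := vanishing_tangent hM hnu Mx (e := 1) ltr01 _ dP nt.
move=> /(_ (fun y My _ => nG y My)); rewrite -derive_dot// DP => sum0.
have E i : 'D_t (fun y => nu y 0 i * G y 0 i) x =
   nu x 0 i * dot (grad (fun y => G y 0 i) x) t + G x 0 i * dot (grad (fun y => nu y 0 i) x) t.
  by rewrite -!derive_dot//; apply: deriveM; exact: diff_derivable.
have {}sum0 : \sum_i 'D_t (fun y => nu y 0 i * G y 0 i) x = 0 := sum0.
rewrite /tdiv -sumrB -[RHS]subr0 -[X in _ = _ - X]sum0 -[RHS]sumrB; apply: eq_bigr => i _.
rewrite E -dotBr /oblique (dot_nu hnu Mx) divr1 -/ka.
have -> : delta_mx 0 i - nu x 0 i *: nu x - (delta_mx 0 i - (nu x 0 i / ka) *: N) =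
   - (nu x 0 i *: t).
  by rewrite /t; apply/rowP => j; rewrite !mxE; ring.
by rewrite -scaleNr dotZr; ring.
Qed.

(** The sum of the oblique derivatives for fixed [N] is bounded componentwise by [patch_derivative].
    By [tdiv_oblique] the rest contains no derivative of [G], and its vector [t] is [O(rho)]. *)
Lemma patch_divergence (z : V) (r C rho : R) (G : V -> V) :
  M z -> regular_patch M nu z r C -> 0 < C -> 0 < rho -> 3 * rho <= r ->
  4 * n.+1%:R * C * rho <= 1 ->
  (forall i x, `|x - z| <= r -> C1at (fun y => G y 0 i) x) ->
  (forall x, M x -> dot (nu x) (G x) = 0) ->
  (forall x, M x -> rho < `|x - z| -> G x = 0) ->
  let A := M `&` cball z (2 * rho) in
  is_true (`|\int[mu]_(x in (A : set T)) tdiv nu G x| <=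
    (3 ^+ n * 10 + 6 * n.+1%:R ^+ 2) * C ^+ 2 * rho *
    \int[mu]_(x in (A : set T)) \sum_i `|G x 0 i|).
Proof.
move=> Mz patch C0 rho0 rho3 Crho CG nG Gout A; pose N := nu z.
have N1 : `|N| <= 1 by exact: (norm_nu_le1 hnu Mz).
have rho2r : 2 * rho <= r by move: rho3 rho0; lra.
have cA : closed A.
  rewrite (_ : A = (M `&` cball z r) `&` cball z (2 * rho)).
    by apply: closedI; [exact: patch_closed patch|exact: closed_cball].
  by rewrite /A -setIA; congr (_ `&` _); rewrite setIidr// => x /= /le_trans; exact.
have kA : compact A.
  apply: (@subclosed_compact _ _ (cball z (2 * rho))) => //; first exact: cball_compact.
  exact: subIsetr.
have mA : measurable (A : set T) by exact: closed_hausdorff_measurable.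
have Aoo : (H A < +oo)%E.
  apply: le_lt_trans (patch_finite patch); apply: le_hausdorff => x [Mx /= xz].
  by split => //=; exact: le_trans rho2r.
have intA f : bmfun A f -> mu.-integrable (A : set T) (EFin \o f).
  by move=> bf; exact: bmfun_integrable.
pose D i x := dot (grad (fun y => G y 0 i) x) (oblique nu N x i).
have hD i : bmfun A (D i) /\ `|\int[mu]_(x in (A : set T)) D i x| <=
    3 ^+ n * (10 * C ^+ 2 * rho) * \int[mu]_(x in (A : set T)) `|G x 0 i|.
  have [B B0 lipB] := C1at_lipschitz_cball (CG i).
  apply: (patch_derivative hM hnu i Mz patch C0 rho0 rho3 Crho B0) => [x _ xr|x y _ _|x Mx xz].
  - exact: C1at_differentiable (CG i x xr).
  - exact: lipB.
  - by rewrite (Gout x Mx xz) mxE.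
have bG i : bmfun A (fun x => G x 0 i).
  apply: continuous_bmfun => // x [_ /= xz]; apply: C1at_continuous.
  by apply: CG; exact: le_trans rho2r.
have bGa i : bmfun A (fun x => `|G x 0 i|) by exact: bmfun_norm.
have bS : bmfun A (fun x => \sum_i `|G x 0 i|) by exact: bmfun_sum.
have bT : bmfun A (tdiv nu G).
  apply: (tdiv_bmfun hnu) => //; first exact: subIsetl.
  by move=> i x [_ /= xz]; apply: CG; exact: le_trans rho2r.
have bsD : bmfun A (fun x => \sum_i D i x) by apply: bmfun_sum => i; exact: (hD i).1.
have -> : \int[mu]_(x in (A : set T)) tdiv nu G x =
   \sum_i \int[mu]_(x in (A : set T)) D i x +
   \int[mu]_(x in (A : set T)) (tdiv nu G x - \sum_i D i x).
  rewrite -Rintegral_sum//; last by move=> i; exact: (hD i).1.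
  rewrite -(RintegralD mA (intA _ bsD) (intA _ (bmfunB bT bsD))).
  by apply: eq_Rintegral => x _; rewrite addrC subrK.
set J := \int[mu]_(x in (A : set T)) (\sum_i `|G x 0 i|).
have -> : (3 ^+ n * 10 + 6 * n.+1%:R ^+ 2) * C ^+ 2 * rho * J =
   3 ^+ n * (10 * C ^+ 2 * rho) * J + 6 * n.+1%:R ^+ 2 * C ^+ 2 * rho * J by ring.
apply: le_trans (ler_normD _ _) _; apply: lerD.
  apply: le_trans (ler_norm_sum _ _ _) _.
  rewrite /J (Rintegral_sum _ mA Aoo bGa) mulr_sumr; apply: ler_sum => i _.
  exact: (hD i).2.
apply: le_trans (le_normr_Rintegral mA (intA _ (bmfunB bT bsD))) _.
rewrite -(RintegralZl _ mA (intA _ bS)).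
apply: le_Rintegral => //; first exact: intA (bmfun_norm (bmfunB bT bsD)).
  exact: intA (bmfunM (bmfun_cst _ _) bS).
move=> x [Mx /= xz]; have xr := le_trans xz rho2r.
have [nuN gnu] := patch_normal patch xr.
have nuN' : `|nu x - N| <= 2 * C * rho.
  by apply: le_trans nuN _; rewrite (mulrC 2) -mulrA ler_wpM2l ?(ltW C0).
set ka := dot (nu x) N.
have ka1 : `|ka - 1| <= 2 * n.+1%:R * C * rho.
  have -> : ka - 1 = dot (nu x - N) N by rewrite dotBl (dot_nu hnu Mz).
  apply: le_trans (dot_le_norm _ _) _.
  rewrite (_ : 2 * n.+1%:R * C * rho = n.+1%:R * (2 * C * rho) * 1); last by ring.
  by rewrite ler_pM// ?mulr_ge0// ler_wpM2l.
have kah : 1 / 2 <= ka.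
  by move: ka1 Crho; rewrite ler_norml -!mulrA => /andP[]; lra.
have ka0 : 0 < ka by move: kah; lra.
pose t := nu x - ka^-1 *: N.
(* The 6 is 2 + 4: [nu x - N] gives [2 C rho], and [|1 - 1/ka| <= 2 |ka - 1|] gives
   [4 (n + 1) C rho]. *)
have tle : `|t| <= 6 * n.+1%:R * C * rho.
  have -> : t = (nu x - N) + (1 - ka^-1) *: N.
    by rewrite /t scalerBl scale1r addrA subrK.
  have kai : `|1 - ka^-1| <= 2 * `|ka - 1|.
    have -> : 1 - ka^-1 = (ka - 1) / ka by rewrite mulrBl mulfV ?gt_eqF// mul1r.
    rewrite normrM normfV (gtr0_norm ka0) mulrC ler_wpM2r//.
    by rewrite invf_ple ?posrE//; move: kah; lra.
  apply: le_trans (ler_normD _ _) _; rewrite normrZ.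
  apply: (@le_trans _ _ (2 * C * rho + 2 * (2 * n.+1%:R * C * rho))).
    rewrite lerD//; apply: (@le_trans _ _ `|1 - ka^-1|); first by rewrite ler_piMr.
    by apply: le_trans kai _; rewrite ler_pM2l.
  have : C * rho <= n.+1%:R * (C * rho) by rewrite ler_peMl ?ler1n// mulr_ge0// ltW.
  by rewrite -!mulrA; lra.
have dG i : differentiable (fun y => G y 0 i) x.
  by apply: C1at_differentiable; exact: CG.
rewrite (tdiv_oblique Mx _ dG nG) ?gt_eqF// -/ka -/t.
apply: le_trans (ler_norm_sum _ _ _) _; rewrite mulr_sumr; apply: ler_sum => i _.
rewrite normrM mulrC ler_wpM2r//; apply: le_trans (dot_le_norm _ _) _.
have -> : 6 * n.+1%:R ^+ 2 * C ^+ 2 * rho = n.+1%:R * C * (6 * n.+1%:R * C * rho) by ring.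
rewrite -!(mulrA n.+1%:R) ler_wpM2l// ler_pM//.
Qed.

End PatchDivergence.

(** * A partition of unity of class C1 on a grid *)

Section Bump.
Context {R : realType}.
Implicit Types s t u h e b : R.

(* [sqpos s] is [max(s, 0)^2]. *)
Definition sqpos s : R := s * (s + `|s|) / 2.
(** The step equals [2 s^2] up to [1/2], then [1 - 2 (1 - s)^2] up to 1, and is constant outside.
    Differences of consecutive translates telescope, which is how the bumps get sum 1. *)
Definition smoothstep s : R := 2 * sqpos s - 4 * sqpos (s - 1 / 2) + 2 * sqpos (s - 1).
Definition spline s : R := smoothstep s - smoothstep (s - 1).

Lemma sqpos_pos s : 0 <= s -> sqpos s = s ^+ 2.
Proof. by move=> s0; rewrite /sqpos ger0_norm//; field. Qed.

Lemma sqpos_neg s : s <= 0 -> sqpos s = 0.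
Proof. by move=> s0; rewrite /sqpos ler0_norm// subrr mulr0 mul0r. Qed.

Lemma smoothstep0 s : s <= 0 -> smoothstep s = 0.
Proof. by move=> s0; rewrite /smoothstep !sqpos_neg; lra. Qed.

Lemma smoothstep1 s : 1 <= s -> smoothstep s = 1.
Proof. by move=> s0; rewrite /smoothstep !sqpos_pos; lra. Qed.

Lemma smoothstep_itv s : 0 <= smoothstep s <= 1.
Proof.
have [s0|s0] := leP s 0; first by rewrite smoothstep0// lexx ler01.
have [s1|s1] := leP 1 s; first by rewrite smoothstep1// lexx ler01.
rewrite /smoothstep (sqpos_pos (ltW s0)).
have h1 : s - 1 <= 0 by lra.
rewrite (sqpos_neg h1).
have [s2|s2] := leP s (1 / 2).
  have h : s - 1 / 2 <= 0 by lra.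
  by rewrite (sqpos_neg h); apply/andP; split; nra.
have h : 0 <= s - 1 / 2 by lra.
by rewrite (sqpos_pos h); apply/andP; split; nra.
Qed.

Lemma spline_ge0 s : 0 <= spline s.
Proof.
rewrite /spline subr_ge0; have [/andP[s0 s1] /andP[t0 t1]] := (smoothstep_itv s, smoothstep_itv (s - 1)).
have [s2|s2] := leP 1 s; first by rewrite [leRHS]smoothstep1.
by rewrite smoothstep0//; lra.
Qed.

Lemma spline_support s : spline s != 0 -> 0 < s < 2.
Proof.
apply: contraNT; rewrite negb_and -!leNgt => /orP[s0|s2]; rewrite /spline.
  by rewrite !smoothstep0 ?subrr//; lra.
by rewrite !smoothstep1 ?subrr//; lra.
Qed.

Lemma sum_spline (N : nat) s : 1 <= s <= N%:R -> \sum_(k < N) spline (s - k%:R) = 1.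
Proof.
move=> /andP[s1 sN]; have -> : \sum_(k < N) spline (s - k%:R) = smoothstep s - smoothstep (s - N%:R).
  elim: N {sN} => [|N IH]; first by rewrite big_ord0 subr0 subrr.
  rewrite big_ord_recr/= IH /spline subrKA (_ : s - N%:R - 1 = s - N.+1%:R)//.
  by rewrite -natr1; ring.
by rewrite smoothstep1// smoothstep0 ?subr0// subr_le0.
Qed.

(** A quadratic remainder bound gives the derivative at every point alike, including the knots of a
    piecewise quadratic function. *)
Lemma derive_quadratic (f : R -> R) (x d C : R) :
  (forall h, `|f (x + h) - f x - d * h| <= C * h ^+ 2) ->
  derivable f x 1 /\ derive1 f x = d.
Proof.
move=> hf; have lim : (fun h : R => h^-1 *: ((f \o shift x) (h *: (1 : R)) - f x)) @ 0^' --> d.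
  apply/cvgrPdist_le => e e0.
  have C0 : 0 < 1 + `|C| by rewrite ltr_pwDl.
  near=> h.
  have h0 : h != 0 by near: h; exact: nbhs_dnbhs_neq.
  have hn : 0 < `|h| by rewrite normr_gt0.
  have -> : d - h^-1 *: ((f \o shift x) (h *: (1 : R)) - f x) =
      - (h^-1 * (f (x + h) - f x - d * h)).
    rewrite -[LHS]/(d - h^-1 * (f (h * 1 + x) - f x)) mulr1 (addrC h).
    by field.
  rewrite normrN normrM normfV ler_pdivrMl//; apply: le_trans (hf h) _.
  rewrite -[h ^+ 2]ger0_norm ?sqr_ge0// normrX expr2 mulrCA ler_wpM2l//.
  have : `|h| <= e / (1 + `|C|).
    near: h; apply: dnbhs0_le; by rewrite divr_gt0.
  rewrite ler_pdivlMr// mulrDr mulr1 => he; apply: le_trans he.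
  by rewrite -[leLHS]add0r lerD// mulrC ler_wpM2l// ler_norm.
split; first by apply/cvg_ex; exists d.
by rewrite derive1E; exact: cvg_lim.
Unshelve. all: by end_near. Qed.

Lemma sqpos_quadratic s h : `|sqpos (s + h) - sqpos s - (s + `|s|) * h| <= h ^+ 2.
Proof.
rewrite ler_norml; have [s0|s0] := leP 0 s; have [t0|t0] := leP 0 (s + h).
- by rewrite !sqpos_pos// ger0_norm//; apply/andP; split; nra.
- by rewrite (sqpos_neg (ltW t0)) sqpos_pos// ger0_norm//; apply/andP; split; nra.
- by rewrite (sqpos_neg (ltW s0)) sqpos_pos// ltr0_norm//; apply/andP; split; nra.
- by rewrite (sqpos_neg (ltW s0)) (sqpos_neg (ltW t0)) ltr0_norm//; apply/andP; split; nra.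
Qed.

Definition dsmoothstep s : R := 2 * (s + `|s|) - 4 * (s - 1 / 2 + `|s - 1 / 2|) + 2 * (s - 1 + `|s - 1|).

Lemma smoothstep_quadratic s h :
  `|smoothstep (s + h) - smoothstep s - dsmoothstep s * h| <= 8 * h ^+ 2.
Proof.
have := (sqpos_quadratic s h, sqpos_quadratic (s - 1 / 2) h, sqpos_quadratic (s - 1) h).
rewrite (addrAC s (- (1 / 2)) h) (addrAC s (- 1) h) /smoothstep /dsmoothstep !ler_norml.
case=> [[]].
by move=> /andP[a1 a2] /andP[b1 b2] /andP[c1 c2]; apply/andP; split; lra.
Qed.

Lemma spline_affine e b : let f t := spline (e * t + b) in
  (forall t, derivable f t 1) /\ continuous (derive1 f).
Proof.
move=> f; pose d t : R := e * (dsmoothstep (e * t + b) - dsmoothstep (e * t + b - 1)).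
have hf t : derivable f t 1 /\ derive1 f t = d t.
  apply: (@derive_quadratic _ _ _ (16 * e ^+ 2)) => h; rewrite /f /spline /d.
  rewrite mulrDr (addrAC (e * t)); set u := e * t + b; rewrite (addrAC u (e * h) (- 1)).
  have [] := (smoothstep_quadratic u (e * h), smoothstep_quadratic (u - 1) (e * h)).
  by rewrite !ler_norml exprMn => /andP[a1 a2] /andP[b1 b2]; apply/andP; split; lra.
split => [t|]; first exact: (hf t).1.
rewrite (_ : derive1 f = d); last by apply/funext => t; exact: (hf t).2.
have cd : continuous dsmoothstep.
  move=> t; have cB (c : R) : (fun s => s - c + `|s - c|) @ t --> t - c + `|t - c|.
    have h : (fun s => s - c) @ t --> t - c by apply: cvgB; [exact: cvg_id|exact: cvg_cst].
    by apply: cvgD => //; exact: cvg_norm.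
  apply: cvgD; first apply: cvgB.
  - apply: cvgMr; apply: cvgD; [exact: cvg_id|exact: cvg_norm].
  - by apply: cvgMr; exact: cB.
  - by apply: cvgMr; exact: cB.
have ca (c : R) : continuous (fun t => e * t + b - c).
  move=> t; apply: cvgB; last exact: cvg_cst.
  by apply: cvgD; [apply: cvgMr; exact: cvg_id|exact: cvg_cst].
move=> t; apply: cvgMr; apply: cvgB.
  have := @continuous_comp _ _ _ (fun t => e * t + b - 0) dsmoothstep t (ca 0 t) (cd _).
  by rewrite /comp (_ : (fun x => dsmoothstep (e * x + b - 0)) = (fun x => dsmoothstep (e * x + b))) ?subr0//; apply/funext => x; rewrite subr0.
exact: (@continuous_comp _ _ _ (fun t => e * t + b - 1) dsmoothstep t (ca 1 t) (cd _)).
Qed.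

End Bump.

Section CellBump.
Context {R : realType} {n : nat}.
Local Notation V := 'rV[R]_n.+1.

Lemma C1at_coord j (x : V) : C1at (fun y : V => y 0 j) x.
Proof.
split; first by near=> y; exact: differentiable_coord.
move=> i; rewrite (_ : partial _ i = cst (i == j)%:R); first exact: (@cst_continuous V R _ x).
by apply/funext => y; exact: partial_coord.
Unshelve. all: by end_near. Qed.

(** A tensor product of splines: [f] indexes a cell of a grid of mesh [1 / e], and [L] translates
    the coordinates so that natural numbers suffice as indices. *)
Definition cell_bump {N : nat} (e L : R) (f : {ffun 'I_n.+1 -> 'I_N}) (x : V) : R :=
  \prod_j spline (e * x 0 j + L - (f j)%:R).

Variables (N : nat) (e L : R).
Implicit Types (f : {ffun 'I_n.+1 -> 'I_N}) (x y : V).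

Lemma cell_bump_ge0 f x : 0 <= cell_bump e L f x.
Proof. by apply: prodr_ge0 => j _; exact: spline_ge0. Qed.

Lemma cell_bump_C1at f x : C1at (cell_bump e L f) x.
Proof.
apply: C1at_prod => j; have [h1 h2] := spline_affine e (L - (f j)%:R).
rewrite (_ : (fun y : V => _) = (fun t => spline (e * t + (L - (f j)%:R))) \o (fun y : V => y 0 j)).
  apply: C1at_comp; [exact: C1at_coord| |exact: h2].
  by near=> t; exact: h1.
by apply/funext => y /=; rewrite addrA.
Unshelve. all: by end_near. Qed.

Lemma cell_bump_near f x y : 0 < e -> cell_bump e L f x != 0 -> cell_bump e L f y != 0 ->
  `|x - y| <= 2 / e.
Proof.
move=> e0 /prodf_neq0 hx /prodf_neq0 hy; apply: norm_leP => [|j]; first by rewrite divr_ge0// ltW.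
rewrite !mxE ler_pdivlMr// -[X in _ * X](gtr0_norm e0) -normrM ler_norml.
have /andP[x0 x2] := spline_support (hx j isT); have /andP[y0 y2] := spline_support (hy j isT).
by apply/andP; split; lra.
Qed.

Lemma sum_cell_bump x : (forall j, 1 <= e * x 0 j + L <= N%:R) ->
  \sum_(f : {ffun 'I_n.+1 -> 'I_N}) cell_bump e L f x = 1.
Proof.
move=> h; rewrite /cell_bump -(bigA_distr_bigA (fun j (k : 'I_N) => spline (e * x 0 j + L - k%:R))).
by apply: big1 => j _; exact: sum_spline.
Qed.

End CellBump.

(** * Compact pieces and the global divergence theorem *)

Section Divergence.
Context {R : realType} {n : nat}.
Local Notation V := 'rV[R]_n.+1.
Local Notation H := (@hausdorff R n).
Local Notation T := (caratheodory_type H).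
Local Notation mu := (@hmeasure R n).
Local Notation cball z r := [set x : V | `|x - z| <= r].
Variables (M : set V) (nu : V -> V).
Hypotheses (hM : is_hypersurface M) (hnu : unit_normal_field M nu).

Lemma compact_hausdorff_measurable (K : set V) : compact K -> measurable (K : set T).
Proof.
by move=> cK; apply: closed_hausdorff_measurable; exact: compact_closed cK.
Qed.

Lemma compact_hausdorff_finite (K : set V) : compact K -> K `<=` M -> (H K < +oo)%E.
Proof.
move=> cK KM.
have hr (p : V) : exists r : R, 0 < r /\ (K p -> (H (M `&` cball p r) < +oo)%E).
  have [Kp|nKp] := pselect (K p); last by exists 1.
  by have [r r0 hr] := finite_local hM hnu (KM _ Kp); exists r.
have [r {}hr] := choice hr.
move: cK; rewrite compact_cover => /(_ _ K (fun p => ball p (r p))).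
case => [p _|p Kp|s sK Ks].
- by apply: ball_open; exact: (hr p).1.
- by exists p => //; apply: ballxx; exact: (hr p).1.
have fin (l : seq V) : (forall p, p \in l -> K p) ->
    (H (K `&` [set x | exists2 p, p \in l & ball p (r p) x]) < +oo)%E.
  elim: l => [_|p l IH hl].
    rewrite (_ : _ `&` _ = set0) ?hausdorff0//; apply/seteqP; split => // x [_ [p]].
    by rewrite in_nil.
  apply: (@le_lt_trans _ _ (H (M `&` cball p (r p)) +
     H (K `&` [set x | exists2 p, p \in l & ball p (r p) x]))%E).
    apply: le_trans (outer_measureU2 _ _ _); apply: le_hausdorff => x [Kx [q]].
    rewrite inE => /orP[/eqP->|ql qx]; last by right; split => //; exists q.
    rewrite -ball_normE /ball_/= => px; left; split; first exact: KM.
    by rewrite /= distrC ltW.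
  apply: lte_add_pinfty; last by apply: IH => q ql; apply: hl; rewrite inE ql orbT.
  by apply: (hr p).2; apply: hl; rewrite mem_head.
have sK' p : p \in finmap.enum_fset s -> K p by move=> ps; have := sK p ps; rewrite inE.
apply: le_lt_trans (fin _ sK'); apply: le_hausdorff => x Kx; split => //.
by have [p ps px] := Ks x Kx; exists p.
Qed.

Lemma Rintegral_agree (A B : set V) (f : V -> R) :
  (forall x, A x -> ~ B x -> f x = 0) -> (forall x, B x -> ~ A x -> f x = 0) ->
  \int[mu]_(x in (A : set T)) f x = \int[mu]_(x in (B : set T)) f x.
Proof.
move=> AB BA; rewrite Rintegral_mkcond [RHS]Rintegral_mkcond.
apply: eq_Rintegral => x _; rewrite /patch; case: ifPn; case: ifPn => //.
- by move=> /negP nB; rewrite inE => Ax; rewrite AB// => Bx; apply: nB; rewrite inE.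
- by rewrite inE => Bx /negP nA; rewrite BA// => Ax; apply: nA; rewrite inE.
Qed.

End Divergence.

Lemma linear_bound_eq0 (R : realType) (I k d : R) : 0 < d -> 0 <= k ->
  (forall rho, 0 < rho -> rho <= d -> `|I| <= k * rho) -> I = 0.
Proof.
move=> d0 k0 h; apply/eqP; rewrite -normr_le0; apply/ler_addgt0Pr => e e0; rewrite add0r.
have k1 : 0 < k + 1 by rewrite ltr_wpDl.
have m0 : 0 < Num.min d (e / (k + 1)) by rewrite lt_min d0 divr_gt0.
apply: le_trans (h _ m0 _) _; first by rewrite ge_min lexx.
apply: (@le_trans _ _ (k * (e / (k + 1)))); first by rewrite ler_wpM2l// ge_min lexx orbT.
by rewrite mulrA ler_pdivrMr// mulrC ler_wpM2l ?(ltW e0)// lerDl.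
Qed.

Section Divergence.
Context {R : realType} {n : nat}.
Local Notation V := 'rV[R]_n.+1.
Local Notation H := (@hausdorff R n).
Local Notation T := (caratheodory_type H).
Local Notation mu := (@hmeasure R n).
Local Notation cball z r := [set x : V | `|x - z| <= r].
Variables (M : set V) (nu : V -> V).
Hypotheses (hM : is_hypersurface M) (hnu : unit_normal_field M nu).

(** Tangential derivatives see only the values on [M], so supports relative to [M] are enough for
    localisation. *)
Lemma tdiv_vanish (G : V -> V) (x : V) (e : R) : M x -> 0 < e ->
  (forall y, M y -> `|y - x| < e -> G y = 0) ->
  (forall i, differentiable (fun y => G y 0 i) x) -> tdiv nu G x = 0.
Proof.
move=> Mx e0 Gz dG; apply: big1 => i _; apply: (vanishing_oblique hM hnu i Mx e0 _ (dG i)).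
by move=> y My yx; rewrite Gz// mxE.
Qed.

Lemma tdiv_sum (I : finType) (G : I -> V -> V) (Y : V -> V) (x : V) :
  (forall i, differentiable (fun y => Y y 0 i) x) ->
  (forall k i, differentiable (fun y => G k y 0 i) x) ->
  (\forall y \near x, Y y = \sum_k G k y) ->
  tdiv nu Y x = \sum_k tdiv nu (G k) x.
Proof.
move=> dY dG YG; rewrite /tdiv [RHS]exchange_big/=; apply: eq_bigr => i _.
set o := oblique _ _ _ _.
have [dS DS] := @derive_sumf _ _ _ (index_enum I) (fun k y => G k y 0 i) x o (fun k => dG k i).
have near_i : \forall y \near x, \sum_k G k y 0 i = Y y 0 i.
  by near=> y; rewrite (_ : Y y = \sum_k G k y) ?summxE//; near: y.
have E : 'D_o (fun y => Y y 0 i) x = \sum_k 'D_o (fun y => G k y 0 i) x.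
  by rewrite -DS; apply/esym; exact: near_eq_derive.
rewrite -(derive_dot _ (dY i)) E; apply: eq_bigr => k _.
by rewrite derive_dot.
Unshelve. all: by end_near. Qed.

(** Each [G f] obeys the patch bound: [c rho] times the integral of its own absolute coordinates.
    The bumps being nonnegative with sum 1, these integrals add up to [J] however many bumps there
    are. *)
Lemma divergence_theorem (K W : set V) (Y : V -> V) : compact K -> K `<=` M ->
  open W -> M `<=` W ->
  (forall i x, W x -> C1at (fun y => Y y 0 i) x) ->
  (forall x, M x -> dot (nu x) (Y x) = 0) ->
  (forall x, M x -> ~ K x -> Y x = 0) ->
  \int[mu]_(x in (K : set T)) tdiv nu Y x = 0.
Proof.
move=> cK KM oW MW CY nY Yout.
have mK := compact_hausdorff_measurable cK.
have Koo := compact_hausdorff_finite hM hnu cK KM.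
have clK : closed K by exact: compact_closed cK.
have intK f : bmfun K f -> mu.-integrable (K : set T) (EFin \o f).
  by move=> bf; exact: (bmfun_integrable mK Koo bf).
have [r1 [C [r10 C0 patch1]]] := compact_patch hM hnu cK KM.
(* Here the constant of [compact_uniform] is ignored: only a common radius of balls inside [W] is
   wanted. *)
have [|p /KM/MW Wp|r2 [_ [r20 _ ballW]]] :=
    @compact_uniform _ _ K (fun z r _ => cball z r `<=` W) cK.
- by move=> z r r' _ _ _ r'r _ h x /= xz; apply: h; exact: le_trans r'r.
- have [r /= r0 hr] := (nbhs_ballP _ _).1 (open_nbhs_nbhs (conj oW Wp)).
  exists (r / 2), 1; split => //; first by rewrite divr_gt0.
  move=> z _ zp x /= xz; apply: hr; rewrite -ball_normE /ball_/= distrC.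
  rewrite (_ : x - p = (x - z) + (z - p)); last by rewrite subrKA.
  by rewrite [ltRHS]splitr (le_lt_trans (ler_normD _ _))// ler_ltD.
pose r := Num.min r1 r2.
have r0 : 0 < r by rewrite lt_min r10.
have patch z : K z -> regular_patch M nu z r C.
  by move=> /patch1; apply: regular_patchS => //; rewrite ge_min lexx.
have rW z : K z -> cball z r `<=` W.
  by move=> Kz x /= xz; apply: (ballW z Kz); rewrite /= (le_trans xz)// ge_min lexx orbT.
have [_ [B hB]] : bmfun K (fun x => `|x|).
  by apply: continuous_bmfun => // x _; exact: norm_continuous.
have {}hB x : K x -> `|x| <= B by move=> /hB; rewrite normr_id.
pose J := \int[mu]_(x in (K : set T)) \sum_i `|Y x 0 i|.
pose c : R := (3 ^+ n * 10 + 6 * n.+1%:R ^+ 2) * C ^+ 2.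
have c0 : 0 <= c by rewrite mulr_ge0// ?sqr_ge0// addr_ge0// mulr_ge0// exprn_ge0.
have J0 : 0 <= J by apply: Rintegral_ge0 => x _; exact: sumr_ge0.
pose d := Num.min (r / 3) (4 * n.+1%:R * C)^-1.
have nC0 : 0 < 4 * n.+1%:R * C by rewrite !mulr_gt0.
have d0 : 0 < d by rewrite lt_min divr_gt0// invr_gt0.
apply: (linear_bound_eq0 d0 (mulr_ge0 c0 J0)) => rho rho0.
rewrite le_min ler_pdivlMr// [rho * 3]mulrC -[_^-1]mul1r ler_pdivlMr// [rho * _]mulrC => /andP[rho3 Crho].
(* Two points where the same bump is nonzero are at distance at most [2 / e = rho]. [L] and [N] put
   [e y_j + L] between 1 and [N] for every [y] within 1 of [K]. *)
pose e := 2 / rho; have e0 : 0 < e by rewrite divr_gt0.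
pose L := e * (B + 1) + 1.
pose N := Num.bound (2 * L).
pose chi (f : {ffun 'I_n.+1 -> 'I_N}) := cell_bump e L f.
pose G f x := chi f x *: Y x.
have GE f i : (fun y => G f y 0 i) = (fun y => chi f y * Y y 0 i).
  by apply/funext => y; rewrite mxE.
have CG f i x : W x -> C1at (fun y => G f y 0 i) x.
  by move=> Wx; rewrite GE; exact: (C1atM (cell_bump_C1at e L f x) (CY i x Wx)).
have dG f i x : W x -> differentiable (fun y => G f y 0 i) x.
  by move=> Wx; exact: C1at_differentiable (CG f i x Wx).
(* The sum must be 1 on a neighbourhood of [K], since the decomposition of [Y] is going to be
   differentiated. *)
have sum1 x y : K x -> `|y - x| < 1 -> \sum_f chi f y = 1.
  move=> Kx yx; apply: sum_cell_bump => j.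
  have yB : `|y 0 j| <= B + 1.
    apply: le_trans (coord_le_norm _ _) _; rewrite (_ : y = x + (y - x)); last by rewrite addrC subrK.
    by apply: le_trans (ler_normD _ _) _; apply: lerD; [exact: hB|exact: ltW].
  have : `|e * y 0 j| <= e * (B + 1) by rewrite normrM (gtr0_norm e0) ler_wpM2l// ltW.
  have LN : 2 * L <= N%:R.
    apply: ltW; apply: archi_boundP; rewrite /L.
    have B1 : 0 <= B + 1 by exact: le_trans yB.
    have eB : 0 <= e * (B + 1) by exact: mulr_ge0 (ltW e0) B1.
    by rewrite mulr_ge0// addr_ge0.
  by rewrite ler_norml => /andP[y1 y2]; move: LN; rewrite /L => LN; apply/andP; split; lra.
have near1 x : K x -> \forall y \near x, Y y = \sum_f G f y.
  move=> Kx; near=> y; have yx : `|y - x| < 1.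
    have : ball x 1 y by near: y; exact: (nbhsx_ballx x 1 ltr01).
    by rewrite -ball_normE /ball_/= distrC.
  by rewrite -scaler_suml (sum1 x y Kx yx) scale1r.
have tdivK x : K x -> tdiv nu Y x = \sum_f tdiv nu (G f) x.
  move=> Kx; apply: tdiv_sum (near1 x Kx) => [i|f i]; last by apply: dG; exact: MW (KM _ Kx).
  by apply: C1at_differentiable; apply: CY; exact: MW (KM _ Kx).
have bG f : bmfun K (tdiv nu (G f)).
  by apply: (tdiv_bmfun hnu cK KM) => i x Kx; apply: CG; exact: MW (KM _ Kx).
have Gout f x : M x -> ~ K x -> G f x = 0.
  by move=> Mx nKx; rewrite /G (Yout x)// scaler0.
have tout f x : M x -> ~ K x -> tdiv nu (G f) x = 0.
  move=> Mx nKx; have oK : open (~` K) by exact: closed_openC.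
  have [s /= s0 hs] := (nbhs_ballP _ _).1 (open_nbhs_nbhs (conj oK nKx)).
  apply: (tdiv_vanish Mx s0) => [y My yx|i]; last by apply: dG; exact: MW.
  by apply: Gout => //; apply: hs; rewrite -ball_normE /ball_/= distrC.
have bound f : `|\int[mu]_(x in (K : set T)) tdiv nu (G f) x| <=
    c * rho * \int[mu]_(x in (K : set T)) \sum_i `|G f x 0 i|.
  (* The patch is centred at a point of [K] where the bump is nonzero. If there is none, [G f]
     vanishes on [M], and so does its tangential divergence. *)
  have [[z [Kz /eqP zf]]|nz] := pselect (exists z, K z /\ chi f z <> 0); last first.
    have Gz x : M x -> G f x = 0.
      move=> Mx; have [Kx|nKx] := pselect (K x); last exact: Gout.
      rewrite /G; have [->|/eqP fx] := eqVneq (chi f x) 0; first by rewrite scale0r.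
      by case: nz; exists x.
    rewrite (_ : \int[mu]_(x in (K : set T)) _ = \int[mu]_(x in (K : set T)) 0).
      rewrite Rintegral_cst// mul0r normr0 mulr_ge0//; first by rewrite mulr_ge0// ltW.
      by apply: Rintegral_ge0 => x _; exact: sumr_ge0.
    apply: eq_Rintegral => x; rewrite inE => Kx.
    apply: (tdiv_vanish (KM _ Kx) ltr01) => [y My _|i]; first exact: Gz.
    by apply: dG; exact: MW (KM _ Kx).
  have Gfar x : M x -> rho < `|x - z| -> G f x = 0.
    move=> Mx xz; rewrite /G; have [->|fx] := eqVneq (chi f x) 0; first by rewrite scale0r.
    have := cell_bump_near e0 fx zf; rewrite leNgt /e invfM invrK mulrA mulfV// mul1r.
    by rewrite xz.
  have := @patch_divergence _ _ M nu hM hnu z r C rho (G f) (KM _ Kz) (patch z Kz) C0 rho0 rho3 Crho.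
  move=> /(_ _ _ Gfar); rewrite /=.
  (* Both integrands vanish on the difference of [K] and the patch, in either direction, so the two
     domains give the same integrals. *)
  rewrite -!(@Rintegral_agree _ _ K (M `&` cball z (2 * rho))).
  - apply.
      by move=> i x xz; apply: CG; exact: (rW z Kz).
    by move=> x Mx; rewrite /G dotZr nY// mulr0.
  - move=> x Kx nA; apply: big1 => i _; rewrite Gfar ?mxE ?normr0//; first exact: KM.
    rewrite ltNge; apply/negP => xz; apply: nA; split; first exact: KM.
    by rewrite /= (le_trans xz)// ler_peMl ?ler1n// ltW.
  - by move=> x [Mx _] nKx; apply: big1 => i _; rewrite Gout// mxE normr0.
  - move=> x Kx nA; have Mx := KM _ Kx.
    have xz : 2 * rho < `|x - z|.
      by rewrite ltNge; apply/negP => xz; apply: nA.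
    apply: (tdiv_vanish Mx rho0) => [y My yx|i]; last by apply: dG; exact: MW.
    apply: Gfar => //; rewrite ltNge; apply/negP => yz.
    move: xz; rewrite ltNge => /negP; apply.
    rewrite (_ : x - z = - (y - x) + (y - z)); last by rewrite opprB subrKA.
    by rewrite (le_trans (ler_normD _ _))// normrN mulr2n mulrDl mul1r lerD// ltW.
  - by move=> x [Mx _] nKx; exact: tout.
rewrite (_ : \int[mu]_(x in (K : set T)) tdiv nu Y x =
   \sum_f \int[mu]_(x in (K : set T)) tdiv nu (G f) x); last first.
  rewrite -(Rintegral_sum (index_enum {ffun 'I_n.+1 -> 'I_N}) mK Koo bG).
  by apply: eq_Rintegral => x; rewrite inE => Kx; exact: tdivK.
apply: le_trans (ler_norm_sum _ _ _) _; rewrite mulrAC.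
have -> : J = \sum_f \int[mu]_(x in (K : set T)) \sum_i `|G f x 0 i|.
  have bGi f : bmfun K (fun x => \sum_i `|G f x 0 i|).
    apply: bmfun_sum => i; apply: bmfun_norm; apply: continuous_bmfun => // x Kx.
    by apply: C1at_continuous; apply: CG; exact: MW (KM _ Kx).
  rewrite -(Rintegral_sum (index_enum {ffun 'I_n.+1 -> 'I_N}) mK Koo bGi).
  apply: eq_Rintegral => x; rewrite inE => Kx.
  rewrite exchange_big/=; apply: eq_bigr => i _.
  rewrite -[LHS]mul1r -(sum1 x x Kx) ?subrr ?normr0// mulr_suml; apply: eq_bigr => f _.
  by rewrite mxE normrM ger0_norm// cell_bump_ge0.
by rewrite mulr_sumr; apply: ler_sum => f _; exact: bound.
Unshelve. all: by end_near. Qed.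

End Divergence.

(** * The weighted radial field *)

Section Radial.
Context {R : realType} {n : nat}.
Local Notation V := 'rV[R]_n.+1.
Variables (M : set V) (nu : V -> V).
Hypotheses (hM : is_hypersurface M) (hnu : unit_normal_field M nu).

Lemma dot_gradM (f g : V -> R) (x v : V) : differentiable f x -> differentiable g x ->
  dot (grad (fun y => f y * g y) x) v = f x * dot (grad g x) v + g x * dot (grad f x) v.
Proof.
move=> df dg; have dfg : differentiable (fun y => f y * g y) x by exact: differentiableM.
by rewrite -!derive_dot//; apply: deriveM; exact: diff_derivable.
Qed.

Lemma dot_gradB (f g : V -> R) (x v : V) : differentiable f x -> differentiable g x ->
  dot (grad (fun y => f y - g y) x) v = dot (grad f x) v - dot (grad g x) v.
Proof.
move=> df dg; have dfg : differentiable (fun y => f y - g y) x by exact: differentiableB.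
by rewrite -!derive_dot//; apply: deriveB; exact: diff_derivable.
Qed.

Lemma dot_grad_coord (x v : V) i : dot (grad (fun y => y 0 i) x) v = v 0 i.
Proof.
rewrite /dot (bigD1 i)//= big1 => [|j ji]; rewrite mxE partial_coord ?eqxx ?mul1r ?addr0//.
by rewrite (negPf ji) mul0r.
Qed.

Lemma obliqueE x i : M x -> oblique nu (nu x) x i = delta_mx 0 i - nu x 0 i *: nu x.
Proof. by move=> Mx; rewrite /oblique (dot_nu hnu Mx) divr1. Qed.

Lemma sum_dot_oblique (c g x : V) : M x ->
  \sum_i c 0 i * dot g (oblique nu (nu x) x i) = dot g c - dot c (nu x) * dot g (nu x).
Proof.
move=> Mx; rewrite /dot [in RHS]mulr_suml -sumrB; apply: eq_bigr => i _.
rewrite -/(dot _ _) -[X in _ - X]/(_ * dot g (nu x)) obliqueE// dotBr dot_delta dotZr.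
by rewrite mulrBr !mulrA [c 0 i * g 0 i]mulrC.
Qed.

Lemma meancurvE x : M x ->
  meancurv nu x = \sum_i dot (grad (fun y => nu y 0 i) x) (oblique nu (nu x) x i).
Proof.
move=> Mx; apply: eq_bigr => i _; rewrite obliqueE// dotBr dot_delta dotZr mxE.
by congr (_ - _ * _); apply: eq_bigr => j _; rewrite mxE.
Qed.

Lemma nu_differentiable x i : M x -> differentiable (fun y => nu y 0 i) x.
Proof. by move=> Mx; have [W [_ MW h]] := nu_C1at hnu; exact: C1at_differentiable (h i x (MW _ Mx)). Qed.

(** The field [x] has tangential divergence [n], the trace of the projection, and [nu] has [H]. The
    derivative of [s] drops out, as it is taken along the tangential part of [nu], which is 0. *)
Lemma tdiv_radial (psi : V -> R) (x : V) : M x -> differentiable psi x ->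
  let s y := dot y (nu y) in
  tdiv nu (fun y => psi y *: (y - s y *: nu y)) x =
  n%:R * psi x + dot (grad psi x) (x - s x *: nu x) - psi x * s x * meancurv nu x.
Proof.
move=> Mx dpsi s.
have dn i : differentiable (fun y => nu y 0 i) x by exact: nu_differentiable.
have dc i : differentiable (fun y : V => y 0 i) x by exact: differentiable_coord.
have ds : differentiable s x.
  have := (@derive_sumf _ _ _ (index_enum 'I_n.+1) (fun i (y : V) => y 0 i * nu y 0 i) x 0 _).1.
  by apply => i; exact: differentiableM.
have E i v : dot (grad (fun y => (psi y *: (y - s y *: nu y)) 0 i) x) v =
    psi x * (v 0 i - (s x * dot (grad (fun y => nu y 0 i) x) v + nu x 0 i * dot (grad s x) v)) +
    (x - s x *: nu x) 0 i * dot (grad psi x) v.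
  have dsn : differentiable (fun y => s y * nu y 0 i) x by exact: differentiableM.
  have dB : differentiable (fun y : V => y 0 i - s y * nu y 0 i) x by exact: differentiableB.
  rewrite (_ : (fun y => _) = fun y : V => psi y * (y 0 i - s y * nu y 0 i)); last first.
    by apply/funext => y; rewrite !mxE.
  by rewrite dot_gradM// dot_gradB// dot_gradM// dot_grad_coord !mxE.
rewrite /tdiv (eq_bigr _ (fun i _ => E i _)) big_split/= sum_dot_oblique//.
rewrite dotBl dotZl (dot_nu hnu Mx) mulr1 subrr mul0r subr0 -mulr_sumr sumrB big_split/=.
rewrite -mulr_sumr -meancurvE// sum_dot_oblique// (dot_nu hnu Mx) mul1r subrr addr0.
have -> : \sum_i oblique nu (nu x) x i 0 i = n%:R.
  rewrite (eq_bigr (fun i => 1 - nu x 0 i * nu x 0 i)) => [|i _]; last first.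
    by rewrite obliqueE// !mxE !eqxx.
  by rewrite sumrB -[X in _ - X]/(dot (nu x) (nu x)) (dot_nu hnu Mx) sumr_const card_ord -natr1 addrK.
by ring.
Qed.

End Radial.

(** * The regularised weight and the pointwise inequality *)

Section Weight.
Context {R : realType} {n : nat}.
Local Notation V := 'rV[R]_n.+1.
Implicit Types (x y v : V).

Lemma dot_eq0 v : dot v v = 0 -> v = 0.
Proof. by move=> vv; apply/eqP; apply: contraTT isT => /dot_gt0; rewrite vv ltxx. Qed.

Lemma cauchy_schwarz u v : dot u v ^+ 2 <= dot u u * dot v v.
Proof.
have [v0|v0] := eqVneq (dot v v) 0.
  have -> : dot u v = 0 by rewrite (dot_eq0 v0) dotC -(scale0r (0 : V)) dotZl mul0r.
  by rewrite v0 mulr0 expr0n.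
have vp : 0 < dot v v by rewrite lt_def v0 dot_ge0.
have := dot_ge0 (dot v v *: u - dot u v *: v).
rewrite dotBl !dotBr !dotZl !dotZr (dotC v u).
rewrite (_ : _ - _ = dot v v * (dot u u * dot v v - dot u v ^+ 2)); last by ring.
by rewrite pmulr_rge0// subr_ge0.
Qed.

Lemma continuous_powR (p t : R) : 0 < t -> {for t, continuous (fun s => s `^ p)}.
Proof.
move=> t0; apply: differentiable_continuous; apply/derivable1_diffP.
by apply: derivable_powR; rewrite in_itv/= t0.
Qed.

Lemma C1at_powR (f : V -> R) x (p : R) : C1at f x -> 0 < f x ->
  C1at (fun y => f y `^ p) x.
Proof.
move=> cf f0; apply: (@C1at_comp _ _ (fun t => t `^ p) f x cf).
  near=> t; apply: derivable_powR; rewrite in_itv/= andbT.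
  by near: t; exact: lt_nbhsr.
have E t : 0 < t -> derive1 (fun s : R => s `^ p) t = p * t `^ (p - 1).
  by move=> t0; rewrite powR_derive1// in_itv/= t0.
change (derive1 (fun s : R => s `^ p) @ f x --> derive1 (fun s : R => s `^ p) (f x)).
have : (fun t => p * t `^ (p - 1)) @ f x --> p * f x `^ (p - 1).
  by apply: cvgM; [exact: cvg_cst|exact: continuous_powR].
rewrite (E _ f0); apply: cvg_trans.
apply: near_eq_cvg; near=> t; rewrite E//.
by near: t; exact: lt_nbhsr.
Unshelve. all: by end_near. Qed.

Lemma dot_grad_powR (f : V -> R) x v (p : R) : differentiable f x -> 0 < f x ->
  dot (grad (fun y => f y `^ p) x) v = p * f x `^ (p - 1) * dot (grad f x) v.
Proof.
move=> df f0; rewrite /dot mulr_sumr; apply: eq_bigr => i _; rewrite !mxE mulrA.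
rewrite (@partial_comp _ _ (fun t => t `^ p) f x i df).
  by rewrite powR_derive1// in_itv/= f0.
by apply: derivable_powR; rewrite in_itv/= f0.
Qed.

Lemma C1at_dot x : C1at (fun y => dot y y) x.
Proof. by apply: C1at_sum => i; exact: (C1atM (C1at_coord i x) (C1at_coord i x)). Qed.

Lemma dot_grad_dot x v : dot (grad (fun y => dot y y) x) v = 2 * dot x v.
Proof.
have dd := C1at_differentiable (C1at_dot x).
have di i : differentiable (fun y : V => y 0 i * y 0 i) x.
  exact: C1at_differentiable (C1atM (C1at_coord i x) (C1at_coord i x)).
rewrite -(derive_dot _ dd) (derive_sumf (index_enum 'I_n.+1) v di).2 mulr_sumr.
apply: eq_bigr => i _; rewrite (derive_dot _ (di i)) dot_gradM ?dot_grad_coord.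
- by rewrite -mulr2n mulr_natl.
- exact: differentiable_coord.
- exact: differentiable_coord.
Qed.

Variables (M : set V) (nu : V -> V).
Hypotheses (hM : is_hypersurface M) (hnu : unit_normal_field M nu).
Variables (a d : R) (phi : V -> R).
Hypotheses (d0 : 0 < d) (cphi : C1 phi).

Definition weight x : R := (dot x x + d) `^ (- (a / 2)).
Definition psi x : R := phi x * phi x * weight x.
Definition radial x : V := psi x *: (x - dot x (nu x) *: nu x).

Lemma weight_base x : 0 < dot x x + d.
Proof. by rewrite ltr_wpDl// dot_ge0. Qed.

Lemma weight_C1at x : C1at weight x.
Proof.
apply: C1at_powR; last exact: weight_base.
exact: (C1atD (C1at_dot x) (C1at_cst d x)).
Qed.

Lemma psi_C1at x : C1at psi x.
Proof.
have cx := C1_C1at x cphi.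
exact: (C1atM (C1atM cx cx) (weight_C1at x)).
Qed.

Lemma radial_C1at : exists W, [/\ open W, M `<=` W &
  forall i x, W x -> C1at (fun y => radial y 0 i) x].
Proof.
have [W [oW MW h]] := nu_C1at hnu; exists W; split=> [||i x Wx]; [exact: oW|exact: MW|].
have cs : C1at (fun y => dot y (nu y)) x.
  by apply: C1at_sum => j; exact: (C1atM (C1at_coord j x) (h j x Wx)).
rewrite (_ : (fun y => _) = fun y : V => psi y * (y 0 i + (-1) * (dot y (nu y) * nu y 0 i))).
  by apply: (C1atM (psi_C1at x)); apply: (C1atD (C1at_coord i x)); apply: (C1atM (C1at_cst _ x)); exact: (C1atM cs (h i x Wx)).
by apply/funext => y; rewrite !mxE mulN1r.
Qed.

Lemma radial_tangent x : M x -> dot (nu x) (radial x) = 0.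
Proof.
by move=> Mx; rewrite /radial dotZr dotBr dotZr (dot_nu hnu Mx) mulr1 dotC subrr mulr0.
Qed.

(** In [tdiv_radial] the gradient of the weight produces the term with [a], and the gradient of
    [phi^2] joins the [H] term: each pairs a vector with [x], and these two vectors are orthogonal
    to each other. *)
Lemma tdiv_weight x : M x -> let s := dot x (nu x) in
  tdiv nu radial x = weight x * (phi x ^+ 2 * (n%:R - a * (dot x x - s ^+ 2) / (dot x x + d)))
    - weight x * phi x * dot ((meancurv nu x * phi x) *: nu x - 2 *: gradT nu phi x) x.
Proof.
move=> Mx s; have dpsi := C1at_differentiable (psi_C1at x).
have dphi := C1at_differentiable (C1_C1at x cphi).
have dw := C1at_differentiable (weight_C1at x).
have dq : differentiable (fun y => dot y y + d) x.
  exact: C1at_differentiable (C1atD (C1at_dot x) (C1at_cst d x)).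
rewrite /radial (tdiv_radial hnu Mx dpsi) -/s.
set xT := x - s *: nu x.
have gq v : dot (grad (fun y => dot y y + d) x) v = 2 * dot x v.
  rewrite -dot_grad_dot; congr dot; apply/rowP => i; rewrite !mxE.
  rewrite (partialD i (C1at_differentiable (C1at_dot x)) (C1at_differentiable (C1at_cst d x))).
  rewrite [X in _ + X](_ : _ = 0) ?addr0//; exact: derive_cst.
have gw v : dot (grad weight x) v = - (a / (dot x x + d)) * weight x * dot x v.
  rewrite (dot_grad_powR _ _ dq (weight_base x)) gq powRB ?(lt0r_neq0 (weight_base x)) ?implybT//.
  rewrite powRr1 ?(ltW (weight_base x))// -/(weight x).
  by field; rewrite gt_eqF ?weight_base.
have xxT : dot x xT = dot x x - s ^+ 2 by rewrite dotBr dotZr expr2.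
have gphi : dot (grad phi x) xT = dot (gradT nu phi x) x.
  by rewrite dotBr dotZr dotBl dotZl (dotC (nu x)) -/s; ring.
have dpp : differentiable (fun y => phi y * phi y) x by exact: differentiableM.
have gpp := dot_gradM xT dphi dphi; have := dot_gradM xT dpp dw; rewrite gpp gw xxT gphi.
rewrite -/psi => ->; rewrite /psi.
move: (gradT nu phi x) => g; rewrite dotBl !dotZl (dotC (nu x)) -/s.
by field; rewrite gt_eqF ?weight_base.
Qed.

Lemma enorm_oblique_field x : M x ->
  let B := (meancurv nu x * phi x) *: nu x - 2 *: gradT nu phi x in
  dot B B = 4 * enorm (gradT nu phi x) ^+ 2 + (meancurv nu x * phi x) ^+ 2.
Proof.
move=> Mx B; rewrite /B dotBl !dotBr !dotZl !dotZr (dot_nu hnu Mx) sqr_enorm.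
have g0 : dot (gradT nu phi x) (nu x) = 0.
  by rewrite dotBl dotZl (dot_nu hnu Mx) mulr1 subrr.
by rewrite (dotC (nu x)) g0; ring.
Qed.

(** Young's inequality [2 phi b <= l phi^2 + b^2 / l] with [b = B . x], then Cauchy-Schwarz at the
    point. A constant [l] keeps the bound linear in the two integrands of the right-hand side. *)
Lemma weight_young (l : R) x : M x -> 0 < l ->
  2 * (weight x * (phi x ^+ 2 * (n%:R - a * (dot x x - dot x (nu x) ^+ 2) / (dot x x + d)))) <=
  2 * tdiv nu radial x + (l * (phi x ^+ 2 * weight x) + l^-1 *
    ((4 * enorm (gradT nu phi x) ^+ 2 + (meancurv nu x * phi x) ^+ 2) * (dot x x * weight x))).
Proof.
move=> Mx l0; rewrite tdiv_weight// -enorm_oblique_field//.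
set B := (meancurv nu x * phi x) *: nu x - _; set A := weight x * (phi x ^+ 2 * _).
have := cauchy_schwarz B x; set b := dot B x => CS.
have w0 : 0 <= weight x by exact: powR_ge0.
rewrite mulrBr -addrA lerDl addrC subr_ge0.
have -> : l * (phi x ^+ 2 * weight x) + l^-1 * (dot B B * (dot x x * weight x)) =
  weight x * (l * phi x ^+ 2 + l^-1 * (dot B B * dot x x)) by ring.
rewrite -mulrA mulrCA ler_wpM2l//.
have : l^-1 * b ^+ 2 <= l^-1 * (dot B B * dot x x) by rewrite ler_wpM2l// invr_ge0 ltW.
have : 0 <= l * (phi x - l^-1 * b) ^+ 2 by rewrite mulr_ge0 ?sqr_ge0// ltW.
rewrite (_ : l * _ = l * phi x ^+ 2 - 2 * (phi x * b) + l^-1 * b ^+ 2); last first.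
  by field; rewrite gt_eqF.
by lra.
Qed.

End Weight.

(** The optimal [l] is [sqrt Q / sqrt P]. If [P = 0] or [Q = 0] this choice degenerates, and
    arbitrarily large or small [l] give [L <= 0] instead. *)
Lemma young_le_sqrtM (R : realType) (L P Q : R) : 0 <= P -> 0 <= Q ->
  (forall l, 0 < l -> 2 * L <= l * P + l^-1 * Q) -> L <= Num.sqrt P * Num.sqrt Q.
Proof.
move=> P0 Q0 h.
have [PE|Pn] := eqVneq P 0.
  rewrite PE sqrtr0 mul0r; apply/ler_addgt0Pr => e e0; rewrite add0r.
  have Q1 : 0 < Q + 1 by rewrite ltr_wpDl.
  have := h _ (divr_gt0 Q1 e0); rewrite PE mulr0 add0r invf_div => h1.
  have : e / (Q + 1) * Q <= e by rewrite mulrAC ler_pdivrMr// ler_wpM2l ?lerDl// ltW.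
  by lra.
have [QE|Qn] := eqVneq Q 0.
  rewrite QE sqrtr0 mulr0; apply/ler_addgt0Pr => e e0; rewrite add0r.
  have P1 : 0 < P + 1 by rewrite ltr_wpDl.
  have := h _ (divr_gt0 e0 P1); rewrite QE mulr0 addr0 => h1.
  have : e / (P + 1) * P <= e by rewrite mulrAC ler_pdivrMr// ler_wpM2l ?lerDl// ltW.
  by lra.
have p0 : 0 < Num.sqrt P by rewrite sqrtr_gt0 lt_def Pn.
have q0 : 0 < Num.sqrt Q by rewrite sqrtr_gt0 lt_def Qn.
have E (p q : R) : 0 < p -> 0 < q -> q / p * p ^+ 2 + p / q * q ^+ 2 = 2 * (p * q).
  by move=> p1 q1; field; rewrite !gt_eqF.
have := E _ _ p0 q0; rewrite !sqr_sqrtr// => {}E.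
have := h _ (divr_gt0 q0 p0); rewrite invf_div E.
by rewrite ler_pM2l.
Qed.

(** * The integrated inequality for the regularised weight *)

Section WeightedBound.
Context {R : realType} {n : nat}.
Local Notation V := 'rV[R]_n.+1.
Local Notation H := (@hausdorff R n).
Local Notation T := (caratheodory_type H).
Local Notation mu := (@hmeasure R n).

(** A point has diameter 0 and [0 ^+ n = 0] for positive [n]; for [n = 0] the measure counts
    points. *)
Lemma hausdorff_set1 (x : V) : (0 < n)%N -> H [set x] = 0%E.
Proof.
move=> n0; apply/eqP; rewrite eq_le hausdorff_ge0 andbT.
apply: ge_ereal_sup => _ [d d0 <-].
have dx : (diamE [set x] <= 0%:E)%E.
  by apply: diamE_le => _ _ -> ->; rewrite subrr enorm0.
apply: le_trans (@hausdorff_pre_finite_cover _ _ 'I_1 (fun=> [set x]) _ d 0 _ _ _) _.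
- by move=> y ->; exists ord0.
- by move=> _; apply: le_trans dx _; rewrite lee_fin ltW.
- move=> _; apply: le_trans (hcontrib_le _ dx) _ => //.
  by rewrite mul0r expr0n gtn_eqF// mulr0.
- by rewrite mulr0.
Qed.

Lemma bmfun_dot (A : set V) (u v : V -> V) :
  (forall i, bmfun A (fun x => u x 0 i)) -> (forall i, bmfun A (fun x => v x 0 i)) ->
  bmfun A (fun x => dot (u x) (v x)).
Proof. by move=> bu bv; apply: bmfun_sum => i; exact: (bmfunM (bu i) (bv i)). Qed.

Variables (M : set V) (nu : V -> V).
Hypotheses (hM : is_hypersurface M) (hnu : unit_normal_field M nu).
Variables (K : set V) (phi : V -> R).
Hypotheses (cK : compact K) (KM : K `<=` M) (cphi : C1 phi).

Lemma C1at_bmfun (f : V -> R) : (forall x, K x -> C1at f x) -> bmfun K f.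
Proof. by move=> cf; apply: continuous_bmfun => // x Kx; exact: C1at_continuous (cf x Kx). Qed.

Lemma partial_bmfun (f : V -> R) i : (forall x, K x -> C1at f x) -> bmfun K (partial f i).
Proof. by move=> cf; apply: continuous_bmfun => // x Kx; have [_] := cf x Kx; exact. Qed.

Lemma phi_bmfun : bmfun K phi.
Proof. by apply: C1at_bmfun => x _; exact: C1_C1at. Qed.

Lemma dot_nu_bmfun : bmfun K (fun x => dot x (nu x)).
Proof.
apply: bmfun_dot => i; last exact: (nu_bmfun hnu i cK KM).
by apply: C1at_bmfun => x _; exact: C1at_coord.
Qed.

Lemma energy_bmfun : bmfun K (fun x =>
  4 * enorm (gradT nu phi x) ^+ 2 + (meancurv nu x * phi x) ^+ 2).
Proof.
have bn i := nu_bmfun hnu i cK KM.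
have bp i : bmfun K (partial phi i) by apply: partial_bmfun => x _; exact: C1_C1at.
have bg i : bmfun K (fun x => grad phi x 0 i).
  by apply: (bmfun_eq _ (bp i)) => x _; rewrite mxE.
have bgn := bmfun_dot bg bn.
have bgT i : bmfun K (fun x => gradT nu phi x 0 i).
  by apply: (bmfun_eq _ (bmfunB (bg i) (bmfunM bgn (bn i)))) => x _; rewrite !mxE.
have bE := bmfun_dot bgT bgT.
have [W [_ MW hW]] := nu_C1at hnu.
have bpn i j : bmfun K (partial (fun y => nu y 0 i) j).
  by apply: partial_bmfun => x /KM/MW; exact: hW.
have bH : bmfun K (meancurv nu).
  apply: bmfun_sum => i; apply: (bmfunB (bpn i i)); apply: (bmfunM (bn i)).
  by apply: bmfun_sum => j; exact: (bmfunM (bpn i j) (bn j)).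
have bHp := bmfunM bH phi_bmfun.
apply: (bmfun_eq _ (bmfunD (bmfunM (bmfun_cst K 4) bE) (bmfunM bHp bHp))) => x _.
by rewrite -sqr_enorm -expr2.
Qed.

Lemma weight_bmfun (a d : R) : 0 < d -> bmfun K (weight a d).
Proof. by move=> d0; apply: C1at_bmfun => x _; exact: weight_C1at. Qed.

Lemma base_inv_bmfun (d : R) : 0 < d -> bmfun K (fun x => (dot x x + d)^-1).
Proof.
move=> d0; apply: (bmfun_eq _ (weight_bmfun 2 d0)) => x _.
by rewrite /weight divff ?pnatr_eq0// powR_inv1// ltW// weight_base.
Qed.

Lemma phi2_bmfun : bmfun K (fun x => phi x ^+ 2).
Proof. by apply: (bmfun_eq _ (bmfunM phi_bmfun phi_bmfun)) => x _; rewrite expr2. Qed.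

Lemma lower_bmfun (a d : R) : 0 < d -> bmfun K (fun x => weight a d x * (phi x ^+ 2 *
     (n%:R - a * (dot x x - dot x (nu x) ^+ 2) / (dot x x + d)))).
Proof.
move=> d0; have bu : bmfun K (fun x => dot x x) by apply: C1at_bmfun => x _; exact: C1at_dot.
apply: (bmfunM (weight_bmfun a d0)); apply: (bmfunM phi2_bmfun).
apply: (bmfunB (bmfun_cst K n%:R)).
refine (bmfunM (bmfunM (bmfun_cst K a) (bmfunB bu _)) (base_inv_bmfun d0)).
by apply: (bmfun_eq _ (bmfunM dot_nu_bmfun dot_nu_bmfun)) => x _; rewrite expr2.
Qed.

Hypotheses (n0 : (0 < n)%N) (phi0 : forall x, M x -> ~ K x -> phi x = 0).
Local Notation D := (K `\` [set 0]).

Lemma punctured_measurable : measurable (D : set T).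
Proof.
apply: measurableD; first exact: compact_hausdorff_measurable cK.
by apply: closed_hausdorff_measurable; apply: compact_closed; [exact: norm_hausdorff|exact: compact_set1].
Qed.

(** [weight_young] is integrated, its divergence term gives 0, and [young_le_sqrtM] optimises [l].
    The domain omits the null point 0 because the comparison with the singular weights is made where
    [|x| > 0]. *)
Lemma weighted_bound (a d : R) : 0 < d ->
  \int[mu]_(x in (D : set T)) (weight a d x * (phi x ^+ 2 *
     (n%:R - a * (dot x x - dot x (nu x) ^+ 2) / (dot x x + d)))) <=
  Num.sqrt (\int[mu]_(x in (D : set T)) (phi x ^+ 2 * weight a d x)) *
  Num.sqrt (\int[mu]_(x in (D : set T))
    ((4 * enorm (gradT nu phi x) ^+ 2 + (meancurv nu x * phi x) ^+ 2) * (dot x x * weight a d x))).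
Proof.
move=> d0; have mK := compact_hausdorff_measurable cK.
have Koo := compact_hausdorff_finite hM hnu cK KM.
have mD := punctured_measurable.
have DK : D `<=` K by move=> x [].
have Doo : (H D < +oo)%E by apply: le_lt_trans Koo; exact: le_hausdorff.
have [W [oW MW CW]] := radial_C1at hnu a d0 cphi.
pose Y := radial nu a d phi.
have div0 : \int[mu]_(x in (K : set T)) tdiv nu Y x = 0.
  apply: (divergence_theorem hM hnu cK KM oW MW CW) => [x Mx|x Mx nKx].
    exact: (radial_tangent hnu _ _ _ Mx).
  by rewrite /Y /radial /psi phi0// mulr0 mul0r scale0r.
have bY : bmfun K (tdiv nu Y).
  by apply: (tdiv_bmfun hnu cK KM) => i x Kx; exact: CW _ _ (MW _ (KM Kx)).
have m0 : measurable ([set 0] : set T).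
  by apply: closed_hausdorff_measurable; apply: compact_closed; [exact: norm_hausdorff|exact: compact_set1].
have div0D : \int[mu]_(x in (D : set T)) tdiv nu Y x = 0.
  rewrite -div0 /Rintegral.
  by rewrite (negligible_integral m0 mK (bmfun_integrable mK Koo bY) (hausdorff_set1 0 n0)).
have bw := weight_bmfun a d0.
have bu : bmfun K (fun x => dot x x) by apply: C1at_bmfun => x _; exact: C1at_dot.
have bphi2 := phi2_bmfun.
have bF := lower_bmfun a d0.
have bP := bmfunM bphi2 bw.
have bQ := bmfunM energy_bmfun (bmfunM bu bw).
have intD f : bmfun K f -> mu.-integrable (D : set T) (EFin \o f).
  by move=> bf; exact: (bmfun_integrable mD Doo (bmfunS mK DK bf)).
apply: young_le_sqrtM => [||l l0].
- by apply: Rintegral_ge0 => x _; rewrite mulr_ge0 ?sqr_ge0// powR_ge0.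
- apply: Rintegral_ge0 => x _; rewrite mulr_ge0 ?mulr_ge0 ?dot_ge0 ?powR_ge0//.
  by rewrite addr_ge0 ?sqr_ge0// mulr_ge0 ?sqr_ge0.
rewrite -(RintegralZl 2 mD (intD _ bF)) -(RintegralZl l mD (intD _ bP)) -(RintegralZl l^-1 mD (intD _ bQ)).
have blP := bmfunM (bmfun_cst K l) bP.
have blQ := bmfunM (bmfun_cst K l^-1) bQ.
have b2F := bmfunM (bmfun_cst K 2) bF.
have b2Y := bmfunM (bmfun_cst K 2) bY.
rewrite -(RintegralD mD (intD _ blP) (intD _ blQ)).
have div0D2 : \int[mu]_(x in (D : set T)) (2 * tdiv nu Y x) = 0.
  by rewrite (RintegralZl 2 mD (intD _ bY)) div0D mulr0.
rewrite -[leRHS]add0r -[X in _ <= X + _]div0D2.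
rewrite -(RintegralD mD (intD _ b2Y) (intD _ (bmfunD blP blQ))).
apply: (le_Rintegral mD (intD _ b2F) (intD _ (bmfunD b2Y (bmfunD blP blQ)))) => x [Kx _].
exact: (weight_young hnu a d0 cphi (KM Kx) l0).
Qed.

End WeightedBound.

Lemma limn_einf_le (R : realType) (u : (\bar R)^nat) (B : \bar R) :
  (forall k, (u k <= B)%E) -> (limn_einf u <= B)%E.
Proof.
move=> uB; rewrite limn_einf_lim; apply: lime_le; first exact: is_cvg_einfs.
near=> k; apply: le_trans (uB k); apply: ereal_inf_lbound; exists k => //=.
Unshelve. all: by end_near. Qed.

(** * Removing the regularisation *)

Section Main.
Context {R : realType} {n : nat}.
Local Notation V := 'rV[R]_n.+1.
Local Notation H := (@hausdorff R n).
Local Notation T := (caratheodory_type H).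
Local Notation mu := (@hmeasure R n).

Lemma enorm_powR (x : V) (p : R) : enorm x `^ p = dot x x `^ (p / 2).
Proof. by rewrite /enorm -powR12_sqrt ?dot_ge0// -powRrM mulrC. Qed.

(** A superlevel of [g] at [t >= 0] has no point outside [K], and the origin is null. The value of
    [g] at 0, which rests on conventions for division and powers, is thereby immaterial. *)
Lemma intM_le_null (M K : set V) (g : V -> R) : (0 < n)%N -> K `<=` M ->
  (forall x, M x -> ~ K x -> g x = 0) -> (intM M g <= intM (K `\` [set 0%R]) g)%E.
Proof.
move=> n0 KM g0; rewrite /intM integral_mkcond [leRHS]integral_mkcond.
apply: ge0_le_integralT => t; rewrite !patchE; case: ifPn => //.
  by move=> _; exact: hausdorff_ge0.
rewrite inE/= => t0; set A := _ `&` _; set B := _ `&` _.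
apply: (@le_trans _ _ (H (B `|` [set 0]))).
  apply: le_hausdorff => x [Mx /= tg]; have [->|/eqP x0] := eqVneq x 0; first by right.
  left; split => //; split => //; apply: contrapT => nKx.
  by move: tg; rewrite g0// ltNge t0.
apply: le_trans (outer_measureU2 _ _ _) _.
by rewrite -[leRHS]adde0; apply: leeD => //; rewrite le_eqVlt (_ : _ == _)//; apply/eqP; exact: hausdorff_set1.
Qed.

Variables (M : set V) (nu : V -> V).
Hypotheses (hM : is_hypersurface M) (hnu : unit_normal_field M nu).
Variables (K : set V) (phi : V -> R) (a : R).
Hypotheses (cK : compact K) (KM : K `<=` M) (cphi : C1 phi).
Hypotheses (phi0 : forall x, M x -> ~ K x -> phi x = 0) (a0 : 0 <= a) (an : a < n%:R).

Local Notation D := (K `\` [set 0]).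

Lemma D_dot_gt0 x : D x -> 0 < dot x x.
Proof.
move=> [_ x0]; rewrite lt_def dot_ge0 andbT; apply/eqP => xx; apply: x0.
exact: dot_eq0.
Qed.

Lemma powR_D_measurable (p : R) : measurable_fun (D : set T) (fun x => dot x x `^ p).
Proof.
apply: (@measurableT_comp _ _ _ _ _ _ (fun t => powR t p)); first exact: measurable_powR.
have mK := compact_hausdorff_measurable cK.
have bu : bmfun K (fun x => dot x x) by apply: (C1at_bmfun cK) => x _; exact: C1at_dot.
by apply: (bmfunS mK _ bu).1 => x [].
Qed.

Lemma Rintegral_le_intM (f g : V -> R) : bmfun K f ->
  measurable_fun (D : set T) (g : T -> R) ->
  (forall x, D x -> 0 <= f x <= g x) ->
  ((\int[mu]_(x in (D : set T)) f x)%:E <= intM M g)%E.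
Proof.
move=> bf mg fg; have mD := punctured_measurable cK.
have mK := compact_hausdorff_measurable cK.
have Koo := compact_hausdorff_finite hM hnu cK KM.
have DK : D `<=` K by move=> x [].
have Doo : (H D < +oo)%E by apply: le_lt_trans Koo; exact: le_hausdorff.
have bfD := bmfunS mK DK bf.
have g0 x : D x -> 0 <= g x by move=> /fg/andP[f0 /(le_trans f0)].
apply: (@le_trans _ _ (intM D g)); last by apply: le_intM => x [/KM].
rewrite -intME// fineK; last exact: integrable_fin_num (bmfun_integrable mD Doo bfD).
have mf := (measurable_EFinP (D : set T) (f : T -> R)).2 bfD.1.
have mg' := (measurable_EFinP (D : set T) (g : T -> R)).2 mg.
have f0 x : D x -> (0 <= (f x)%:E)%E by move=> /fg/andP[f0 _]; rewrite lee_fin.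
have fg' x : D x -> ((f x)%:E <= (g x)%:E)%E by move=> /fg/andP[_ h]; rewrite lee_fin.
exact: (ge0_le_integral mu mD f0 mf mg' fg').
Qed.

Lemma weight_le (d : R) x : 0 < d -> D x -> weight a d x <= dot x x `^ (- (a / 2)).
Proof.
move=> d0 Dx; have u0 := D_dot_gt0 Dx; rewrite /weight !powRN.
rewrite lef_pV2 ?posrE ?powR_gt0 ?addr_gt0//.
have ud : dot x x <= dot x x + d by rewrite lerDl ltW.
by apply: ge0_ler_powR; rewrite ?nnegrE ?divr_ge0// ?dot_ge0// (le_trans _ ud) ?dot_ge0.
Qed.

Let gA x : R := phi x ^+ 2 / enorm x `^ a.
Let gB x : R := (dot x (nu x) / enorm x) ^+ 2 * (phi x ^+ 2 / enorm x `^ a).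
Let gC x : R := (4 * enorm (gradT nu phi x) ^+ 2 + (meancurv nu x * phi x) ^+ 2)
  / enorm x `^ (a - 2).
Let energy x : R := 4 * enorm (gradT nu phi x) ^+ 2 + (meancurv nu x * phi x) ^+ 2.
Let F (d : R) x : R := weight a d x * (phi x ^+ 2 *
     (n%:R - a * (dot x x - dot x (nu x) ^+ 2) / (dot x x + d))).

Lemma bmfun_punctured f : bmfun K f -> measurable_fun (D : set T) (f : T -> R).
Proof.
move=> bf; have mK := compact_hausdorff_measurable cK.
by apply: (bmfunS mK _ bf).1 => x [].
Qed.

Lemma gA_measurable : measurable_fun (D : set T) (gA : T -> R).
Proof.
rewrite (_ : gA = fun x => phi x ^+ 2 * dot x x `^ (- (a / 2))).
  exact: measurable_funM (bmfun_punctured (phi2_bmfun cK cphi)) (powR_D_measurable _).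
by apply/funext => x; rewrite /gA enorm_powR powRN.
Qed.

Lemma gB_measurable : measurable_fun (D : set T) (gB : T -> R).
Proof.
have bn := dot_nu_bmfun hnu cK KM.
rewrite (_ : gB = fun x => (dot x (nu x) * dot x (nu x)) * dot x x `^ (-1) * gA x).
  apply: measurable_funM gA_measurable; apply: measurable_funM (powR_D_measurable _).
  exact: bmfun_punctured (bmfunM bn bn).
by apply/funext => x; rewrite /gB powR_inv1 ?dot_ge0// exprMn exprVn sqr_enorm expr2.
Qed.

Lemma gC_measurable : measurable_fun (D : set T) (gC : T -> R).
Proof.
rewrite (_ : gC = fun x => energy x * dot x x `^ (- ((a - 2) / 2))).
  exact: measurable_funM (bmfun_punctured (energy_bmfun hnu cK KM cphi)) (powR_D_measurable _).
by apply/funext => x; rewrite /gC enorm_powR powRN.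
Qed.

(** Since [|x^T|^2 <= |x|^2 + d] and [a < n], the bracket is nonnegative; Fatou's lemma asks for
    this sign. *)
Lemma F_ge0 d x : 0 < d -> D x -> 0 <= F d x.
Proof.
move=> d0 [Kx _]; rewrite /F mulr_ge0 ?powR_ge0// mulr_ge0 ?sqr_ge0//.
have q0 := weight_base d0 x.
rewrite subr_ge0 ler_pdivrMr//; apply: (@le_trans _ _ (a * (dot x x + d))).
  by rewrite ler_wpM2l//; have := sqr_ge0 (dot x (nu x)); lra.
by rewrite ler_wpM2r// ltW.
Qed.

(** In the limit the bracket is [n - a + a (x . nu)^2 / |x|^2], which splits into the two terms on
    the left of the inequality. *)
Lemma F_cvg x : D x -> (fun k : nat => F (harmonic k) x) @ \oo -->
  (n%:R - a) * gA x + a * gB x.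
Proof.
move=> Dx; have u0 := D_dot_gt0 Dx; have un0 : dot x x != 0 by rewrite gt_eqF.
have -> : (n%:R - a) * gA x + a * gB x = dot x x `^ (- (a / 2)) * (phi x ^+ 2 *
     (n%:R - a * (dot x x - dot x (nu x) ^+ 2) / dot x x)).
  rewrite /gA /gB enorm_powR powRN exprMn exprVn sqr_enorm.
  by field; rewrite un0 gt_eqF// powR_gt0.
have cq : (fun k : nat => dot x x + harmonic k) @ \oo --> dot x x.
  by rewrite -[X in _ --> X]addr0; apply: cvgD; [exact: cvg_cst|exact: cvg_harmonic].
have cw : (fun k : nat => weight a (harmonic k) x) @ \oo --> dot x x `^ (- (a / 2)).
  exact: (cvg_comp _ _ cq (continuous_powR (p := - (a / 2)) u0)).
apply: (cvgM cw); apply: cvgM; first exact: cvg_cst.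
apply: cvgB; first exact: cvg_cst.
by apply: cvgM; [exact: cvg_cst|exact: cvgV].
Qed.

(** As [a >= 0], on [D] the regularised weight is at most [|x|^(-a)], and [|x|^2] times it at most
    [|x|^(2 - a)]. The resulting bound is independent of [d]. *)
Lemma F_bound d : 0 < d -> ((\int[mu]_(x in (D : set T)) F d x)%:E <=
  sqrte (intM M gA) * sqrte (intM M gC))%E.
Proof.
move=> d0; have n0 : (0 < n)%N by rewrite -(ltr_nat R) (le_lt_trans a0).
have bw := weight_bmfun cK a d0.
have bu : bmfun K (fun x => dot x x) by apply: (C1at_bmfun cK) => x _; exact: C1at_dot.
apply: (@le_trans _ _ (sqrte (\int[mu]_(x in (D : set T)) (phi x ^+ 2 * weight a d x))%:E *
   sqrte (\int[mu]_(x in (D : set T)) (energy x * (dot x x * weight a d x)))%:E)%E).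
  rewrite -EFinM lee_fin.
  exact: (weighted_bound hM hnu cK KM cphi n0 phi0 a d0).
have gA0 x : 0 <= gA x by rewrite mulr_ge0 ?sqr_ge0// invr_ge0 powR_ge0.
have energy0 x : 0 <= energy x by rewrite addr_ge0 ?sqr_ge0// mulr_ge0 ?sqr_ge0.
have intM0 g : (0 <= intM M g)%E.
  by apply: integral_ge0 => t _; exact: hausdorff_ge0.
apply: lee_pmul; rewrite ?sqrte_ge0// lee_sqrt//.
- apply: (Rintegral_le_intM (bmfunM (phi2_bmfun cK cphi) bw) gA_measurable) => x Dx.
  rewrite mulr_ge0 ?sqr_ge0 ?powR_ge0//= /gA enorm_powR -powRN.
  by rewrite ler_wpM2l ?sqr_ge0// weight_le.
- apply: (Rintegral_le_intM (bmfunM (energy_bmfun hnu cK KM cphi) (bmfunM bu bw)) gC_measurable) => x Dx.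
  have u0 := D_dot_gt0 Dx.
  rewrite mulr_ge0 ?energy0 ?mulr_ge0 ?dot_ge0 ?powR_ge0//= /gC enorm_powR -powRN.
  rewrite ler_wpM2l ?energy0// (_ : - ((a - 2) / 2) = 1 + - (a / 2)); last by field.
  by rewrite powRD ?(lt0r_neq0 u0) ?implybT// powRr1 ?(ltW u0)// ler_wpM2l ?(ltW u0)// weight_le.
Qed.

(** Fatou's lemma asks for no dominating function, and none is at hand near the origin, where
    [phi^2 |x|^(-a)] has not been shown integrable; the bound uniform in [d] passes to the lower
    limit. *)
Lemma hardy_inequality : ((n%:R - a)%:E * intM M gA + a%:E * intM M gB <=
  sqrte (intM M gA) * sqrte (intM M gC))%E.
Proof.
have n0 : (0 < n)%N by rewrite -(ltr_nat R) (le_lt_trans a0).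
have na0 : 0 <= n%:R - a by rewrite subr_ge0 ltW.
have gA0 x : 0 <= gA x by rewrite mulr_ge0 ?sqr_ge0// invr_ge0 powR_ge0.
have gB0 x : 0 <= gB x by rewrite mulr_ge0 ?sqr_ge0//; exact: gA0.
have gAout x : M x -> ~ K x -> gA x = 0.
  by move=> Mx nKx; rewrite /gA phi0// expr0n mul0r.
have gBout x : M x -> ~ K x -> gB x = 0.
  by move=> Mx nKx; rewrite /gB phi0// expr0n mul0r mulr0.
have mD := punctured_measurable cK.
have Koo := compact_hausdorff_finite hM hnu cK KM.
have Doo : (H D < +oo)%E by apply: le_lt_trans Koo; apply: le_hausdorff => x [].
have mA := (measurable_EFinP (D : set T) (gA : T -> R)).2 gA_measurable.
have mB := (measurable_EFinP (D : set T) (gB : T -> R)).2 gB_measurable.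
have ena : (0 <= (n%:R - a)%:E)%E by rewrite lee_fin.
have ea : (0 <= a%:E)%E by rewrite lee_fin.
apply: (@le_trans _ _ ((n%:R - a)%:E * intM D gA + a%:E * intM D gB)%E).
  exact: (leeD (lee_wpmul2l ena (intM_le_null n0 KM gAout)) (lee_wpmul2l ea (intM_le_null n0 KM gBout))).
rewrite -(intME mD Doo gA_measurable (fun x _ => gA0 x)).
rewrite -(intME mD Doo gB_measurable (fun x _ => gB0 x)).
have eA x : D x -> (0 <= (gA x)%:E)%E by move=> _; rewrite lee_fin.
have eB x : D x -> (0 <= (gB x)%:E)%E by move=> _; rewrite lee_fin.
rewrite -(ge0_integralZl mu mD mA eA ena) -(ge0_integralZl mu mD mB eB ea).
have eA' x : D x -> (0 <= (n%:R - a)%:E * (gA x)%:E)%E by move=> /eA; exact: mule_ge0.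
have eB' x : D x -> (0 <= a%:E * (gB x)%:E)%E by move=> /eB; exact: mule_ge0.
rewrite -(ge0_integralD mu mD eA' (measurable_funeM _ mA) eB' (measurable_funeM _ mB)).
apply: (@le_trans _ _ (\int[mu]_(x in (D : set T)) limn_einf (fun k => (F (harmonic k) x)%:E))%E).
  rewrite le_eqVlt; apply/orP; left; apply/eqP; apply: eq_integral => x; rewrite inE => Dx.
  have cF : (fun k : nat => (F (harmonic k) x)%:E) @ \oo --> ((n%:R - a) * gA x + a * gB x)%:E.
    by apply: cvg_EFin; [near=> k|exact: F_cvg].
  rewrite is_cvg_limn_einfE; last by apply/cvg_ex; exists ((n%:R - a) * gA x + a * gB x)%:E.
  by rewrite (cvg_lim _ cF)// EFinD !EFinM.
have bF d : 0 < d -> bmfun K (F d).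
  by move=> d0; exact: (lower_bmfun hnu cK KM cphi).
apply: (@le_trans _ _ (limn_einf (fun k => \int[mu]_(x in (D : set T)) (F (harmonic k) x)%:E))%E).
  have mF k := (measurable_EFinP (D : set T) (F (harmonic k) : T -> R)).2
    (bmfun_punctured (bF _ (harmonic_gt0 k))).
  have F0 k x : D x -> (0 <= (F (harmonic k) x)%:E)%E.
    by move=> Dx; rewrite lee_fin F_ge0// harmonic_gt0.
  exact: (fatou mu mD mF F0).
apply: limn_einf_le => k; have d0 := harmonic_gt0 k : 0 < harmonic k :> R.
apply: le_trans (F_bound d0); rewrite fineK//.
have DK : D `<=` K by move=> x [].
have bD := bmfunS (compact_hausdorff_measurable cK) DK (bF _ d0).
exact: (integrable_fin_num mD (bmfun_integrable mD Doo bD)).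
Unshelve. all: by end_near. Qed.

End Main.

Theorem theorem1p3 (R : realType) (n : nat) (M : set 'rV[R]_n.+1)
  (nu : 'rV[R]_n.+1 -> 'rV[R]_n.+1) (a : R) (phi : 'rV[R]_n.+1 -> R) :
  is_hypersurface M -> unit_normal_field M nu ->
  0 <= a -> a < n%:R -> C1c M phi ->
  ((n%:R - a)%:E * intM M (fun x => (phi x ^+ 2 / enorm x `^ a)%R)
   + a%:E * intM M (fun x => ((dot x (nu x) / enorm x) ^+ 2 *
                               (phi x ^+ 2 / enorm x `^ a))%R)
   <= sqrte (intM M (fun x => (phi x ^+ 2 / enorm x `^ a)%R))
      * sqrte (intM M (fun x =>
           ((4 * enorm (gradT nu phi x) ^+ 2 + (meancurv nu x * phi x) ^+ 2)
           / enorm x `^ (a - 2))%R)))%E.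
Proof.
move=> hM hnu a0 an [cphi [K [cK [KM phi0]]]].
exact: (hardy_inequality hM hnu cK KM cphi phi0 a0 an).
Qed.
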